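(* Let $(\beta,\gamma,\lambda)$ be anti-ferromagnetic (fixed constants) and let $\Delta\ge3$ be an integer or $\Delta=\infty$. If $(\beta,\gamma,\lambda)$ is $\Delta$-unique, then there is a fully polynomial-time approximation scheme (FPTAS) for the partition function $Z(G)$ of the two-state spin system with parameters $(\beta,\gamma,\lambda)$ on graphs $G$ of maximum degree at most $\Delta$ (for $\Delta=\infty$: on all finite graphs).
   Context: A two-state spin system with parameters $\beta,\gamma\ge 0$, $\lambda>0$ on a finite graph $G=(V,E)$: each configuration $\sigma:V\to\{0,1\}$ has weight $w(\sigma)=\prod_{(u,v)\in E}A_{\sigma(u),\sigma(v)}\prod_{v\in V}b_{\sigma(v)}$, where $A_{0,0}=\beta$, $A_{0,1}=A_{1,0}=1$, $A_{1,1}=\gamma$, $b_0=\lambda$, $b_1=1$; the partition function is $Z(G)=\sum_\sigma w(\sigma)$. The parameters are anti-ferromagnetic if $0\le\beta\le\gamma$, $\gamma>0$, $\beta\gamma<1$, $\lambda>0$. For an integer $d\ge1$ let $f_d(x)=\lambda\left(\frac{\beta x+1}{x+\gamma}\right)^d$ and $\hat x_d$ its unique positive fixed point. $(\beta,\gamma,\lambda)$ is $\Delta$-unique if for every integer $1\le d<\Delta$, $|f_d'(\hat x_d)|=\frac{d(1-\beta\gamma)\hat x_d}{(\beta\hat x_d+1)(\hat x_d+\gamma)}<1$ (i.e. the parameters lie in the interior of the uniqueness region of the infinite $(d+1)$-regular tree for all such $d$). An FPTAS is a deterministic algorithm that, given $G$ with $n$ vertices and $\epsilon>0$, outputs $\hat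 Z$ with $(1-\epsilon)Z(G)\le\hat Z\le(1+\epsilon)Z(G)$ in time polynomial in $n$ and $1/\epsilon$. *)

(* Defs.v *)
From HB Require Import structures.
From mathcomp Require Import all_boot all_order all_algebra.
From mathcomp Require Import all_classical all_reals all_analysis.
From mathcomp Require Import ring lra.

Set Implicit Arguments.
Unset Strict Implicit.
Unset Printing Implicit Defensive.

Import Order.TTheory GRing.Theory Num.Theory.
Import numFieldNormedType.Exports.

Local Open Scope classical_set_scope.
Local Open Scope ring_scope.

Record sgraph (n : nat) := SGraph {
  adj :> rel 'I_n;
  adj_sym : symmetric adj;
  adj_irr : irreflexive adj }.

Definition degree n (G : sgraph n) (u : 'I_n) : nat := #|[pred v | G u v]|.

(* [None] stands for Delta = oo. *)
Definition degree_bound := option nat.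

Definition ltn_degree_bound (d : nat) (Delta : degree_bound) : bool :=
  if Delta is Some D then (d < D)%N else true.

Definition leq_degree_bound (d : nat) (Delta : degree_bound) : bool :=
  if Delta is Some D then (d <= D)%N else true.

Definition max_degree_le (Delta : degree_bound) n (G : sgraph n) : Prop :=
  forall u, leq_degree_bound (degree G u) Delta.

Section SpinSystem.
Context {R : realType}.
Variables beta gamma lambda : R.

(* [false] is the spin 0 and [true] the spin 1. *)
Definition edge_weight (a b : bool) : R :=
  match a, b with
  | false, false => beta
  | true, true => gamma
  | _, _ => 1
  end.

Definition vertex_weight (a : bool) : R := if a then 1 else lambda.

(* Every undirected edge contributes once, as the pair (u, v) with u < v. *)
Definition weight n (G : sgraph n) (sigma : {ffun 'I_n -> bool}) : R :=
  (\prod_(e : 'I_n * 'I_n | ((e.1 < e.2)%N && G e.1 e.2))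
      edge_weight (sigma e.1) (sigma e.2)) *
  \prod_(v < n) vertex_weight (sigma v).

Definition partition_function n (G : sgraph n) : R :=
  \sum_(sigma : {ffun 'I_n -> bool}) weight G sigma.

Definition antiferromagnetic : Prop :=
  [/\ 0 <= beta, beta <= gamma, 0 < gamma, beta * gamma < 1 & 0 < lambda].

Definition tree_rec (d : nat) (x : R) : R :=
  lambda * ((beta * x + 1) / (x + gamma)) ^+ d.

Definition pos_fixpoint (d : nat) : set R :=
  [set x | 0 < x /\ tree_rec d x = x].

(* Existence and uniqueness of the fixed point are proved below. *)
Definition xhat (d : nat) : R := xget 0 (pos_fixpoint d).

Definition unique_up_to (Delta : degree_bound) : Prop :=
  forall d : nat, (1 <= d)%N -> ltn_degree_bound d Delta ->
    `| derive1 (tree_rec d) (xhat d) | < 1.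

Lemma tree_rec_nincr d x y : antiferromagnetic ->
  0 <= x -> x <= y -> tree_rec d y <= tree_rec d x.
Proof.
move=> [b0 bg g0 bg1 l0] x0 xy; rewrite /tree_rec ler_pM2l//.
have Hx : 0 < x + gamma by lra.
have Hy : 0 < y + gamma by lra.
apply: lerXn2r; rewrite ?nnegrE ?divr_ge0 ?addr_ge0 ?mulr_ge0//; try lra.
rewrite ler_pdivrMr// mulrAC ler_pdivlMr// -subr_ge0.
have -> : (beta * x + 1) * (y + gamma) - (beta * y + 1) * (x + gamma) =
  (y - x) * (1 - beta * gamma) by ring.
by apply: mulr_ge0; lra.
Qed.

Lemma is_derive_tree_rec d x : x + gamma != 0 ->
  is_derive x (1 : R) (tree_rec d)
    (- (lambda * ((beta * x + 1) / (x + gamma)) ^+ d.-1 *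
        (d%:R * (1 - beta * gamma) / (x + gamma) ^+ 2))).
Proof.
move=> xg.
have dn : is_derive x (1 : R) (beta \*o @id R + cst 1 : R -> R) beta.
  have h : is_derive x (1 : R) (beta *: @id R + cst 1 : R -> R) (beta *: 1 + 0).
    exact: is_deriveD.
  by have := h; rewrite addr0 -[beta *: 1]/(beta * 1) mulr1.
have dd : is_derive x (1 : R) (@id R + cst gamma : R -> R) 1.
  have h : is_derive x (1 : R) (@id R + cst gamma : R -> R) (1 + 0).
    exact: is_deriveD.
  by have := h; rewrite addr0.
have dV := @is_deriveV R (@id R + cst gamma) x 1 1 xg dd.
have dZ := is_deriveZ lambda (is_deriveX d (is_deriveM dn dV)).
set g : R -> R := (X in is_derive _ _ X _) in dZ.
have <- : g = tree_rec d.
  by apply/funext => y; rewrite /g /tree_rec /=; congr (lambda * _); rewrite exprfctE.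
apply: (is_derive_eq dZ); rewrite /= /GRing.scale /=.
rewrite -[(_ * _) x]/((beta * x + 1) / (x + gamma)).
rewrite -[(beta \*o _ + _) x]/(beta * x + 1).
rewrite -[(id + cst gamma) x]/(x + gamma).
set z := _ ^+ d.-1; field.
by [].
Qed.

Lemma xhatP d : antiferromagnetic ->
  pos_fixpoint d (xhat d) /\ forall x, pos_fixpoint d x -> x = xhat d.
Proof.
move=> af; have [b0 bg g0 bg1 l0] := af.
have pos0 : 0 < tree_rec d 0.
  by rewrite /tree_rec mulr_gt0// exprn_gt0// divr_gt0; lra.
have [x [x0 fx]] : exists x, pos_fixpoint d x.
  have c : {within `[0, tree_rec d 0], continuous (fun x => tree_rec d x - x)}.
    apply: derivable_within_continuous => x; rewrite in_itv /= => /andP[x0 _].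
    apply: derivableB => //.
    apply: (@ex_derive _ _ _ _ _ _ _ (is_derive_tree_rec d _)).
    by apply: lt0r_neq0; lra.
  have [|x] := @IVT R _ 0 (tree_rec d 0) 0 (ltW pos0) c.
    rewrite subr0 ge_min le_max (ltW pos0) /= subr_le0.
    by rewrite tree_rec_nincr ?orbT// ltW.
  rewrite in_itv /= => /andP[x0 _] /eqP; rewrite subr_eq0 => /eqP fx.
  exists x; split=> //; rewrite lt_neqAle x0 andbT.
  by apply/eqP => x00; move: fx pos0; rewrite -x00 => ->; rewrite ltxx.
have uniq y z : pos_fixpoint d y -> pos_fixpoint d z -> y <= z.
  move=> [y0 fy] [z0 fz]; rewrite leNgt; apply/negP => zy.
  have := tree_rec_nincr d af (ltW z0) (ltW zy).
  by rewrite fy fz leNgt zy.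
have px : pos_fixpoint d x by [].
have ph : pos_fixpoint d (xhat d) by apply: (xgetI 0 px).
by split=> // y py; apply/eqP; rewrite eq_le !uniq.
Qed.

Lemma normr_derive_xhat d : antiferromagnetic -> (1 <= d)%N ->
  `| derive1 (tree_rec d) (xhat d) | =
  d%:R * (1 - beta * gamma) * xhat d /
    ((beta * xhat d + 1) * (xhat d + gamma)).
Proof.
move=> af d1; have [b0 bg g0 bg1 l0] := af.
have [[x0 fx] _] := xhatP d af; set x := xhat d in x0 fx *.
have xg : 0 < x + gamma by lra.
have bx : 0 < beta * x + 1 by have := mulr_ge0 b0 (ltW x0); lra.
have D := is_derive_tree_rec d (lt0r_neq0 xg).
rewrite derive1E (@derive_val _ _ _ _ _ _ _ D) normrN ger0_norm; last first.
  do ?[apply: mulr_ge0 | apply: exprn_ge0 | rewrite invr_ge0]; try lra.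
  by [].
move: fx; rewrite /tree_rec -{1}(prednK d1) exprS; set z := _ ^+ d.-1 => fx.
have -> : d%:R * (1 - beta * gamma) * x =
    d%:R * (1 - beta * gamma) * (lambda * ((beta * x + 1) / (x + gamma) * z)).
  by rewrite fx.
by field; rewrite !lt0r_neq0.
Qed.

End SpinSystem.

(* Random access machines with logarithmic cost.  Memory consists of arrays [s a] (the name [a] is fixed in the program text)
   whose cells hold natural numbers of any size.  Every evaluated
   subexpression is charged the bit length of its value, so that time is
   polynomially related to Turing machine time.

   Real numbers ([beta], [gamma], [lambda] and the accuracy [eps]) are never
   held in memory: a program reaches them only by asking whether p / q <= x for
   natural numbers p and q that it has computed and paid for.  For a rational x
   such a query is itself answered in time polynomial in the bit lengths. *)

Inductive real_datum := Beta | Gamma | Lambda | Eps.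

Inductive expr :=
  | Const of nat
  | Get of nat & expr
  | Add of expr & expr
  | Sub of expr & expr
  | Mul of expr & expr
  | Div of expr & expr
  | Query of real_datum & expr & expr.

Inductive cmd :=
  | Skip
  | Put of nat & expr & expr
  | Seq of cmd & cmd
  | If of expr & cmd & cmd
  | While of expr & cmd.

Definition state := nat -> nat -> nat.

Definition bitlength (n : nat) : nat := (trunc_log 2 n).+1.

Definition update (s : state) (a i v : nat) : state :=
  fun b j => if (b == a) && (j == i) then v else s b j.

Section Semantics.
Context {R : realType}.
Variable rho : real_datum -> R.

(* Subtraction is truncated, division is Euclidean with m / 0 = 0. *)
Fixpoint eval (s : state) (e : expr) : nat :=
  match e with
  | Const n => n
  | Get a e1 => s a (eval s e1)
  | Add e1 e2 => eval s e1 + eval s e2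
  | Sub e1 e2 => eval s e1 - eval s e2
  | Mul e1 e2 => eval s e1 * eval s e2
  | Div e1 e2 => eval s e1 %/ eval s e2
  | Query x e1 e2 => ((eval s e1)%:R <= rho x * (eval s e2)%:R)%R
  end%N.

Fixpoint cost (s : state) (e : expr) : nat :=
  (bitlength (eval s e) +
   match e with
   | Const _ => 0
   | Get _ e1 => cost s e1
   | Add e1 e2 | Sub e1 e2 | Mul e1 e2 | Div e1 e2 | Query _ e1 e2 =>
       cost s e1 + cost s e2
   end)%N.

(* [exec c s s' t]: started in [s], [c] halts in [s'] after time [t]. *)
Inductive exec : cmd -> state -> state -> nat -> Prop :=
  | exec_skip s : exec Skip s s 1
  | exec_put s a e1 e2 :
      exec (Put a e1 e2) s (update s a (eval s e1) (eval s e2))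
        (cost s e1 + cost s e2).+1
  | exec_seq c1 c2 s s1 s2 t1 t2 :
      exec c1 s s1 t1 -> exec c2 s1 s2 t2 ->
      exec (Seq c1 c2) s s2 (t1 + t2).+1
  | exec_if_true e c1 c2 s s' t :
      eval s e <> 0%N -> exec c1 s s' t ->
      exec (If e c1 c2) s s' (cost s e + t).+1
  | exec_if_false e c1 c2 s s' t :
      eval s e = 0%N -> exec c2 s s' t ->
      exec (If e c1 c2) s s' (cost s e + t).+1
  | exec_while_true e c s s1 s2 t1 t2 :
      eval s e <> 0%N -> exec c s s1 t1 -> exec (While e c) s1 s2 t2 ->
      exec (While e c) s s2 (cost s e + t1 + t2).+1
  | exec_while_false e c s :
      eval s e = 0%N -> exec (While e c) s s (cost s e).+1.

Lemma exec_deterministic c s s1 s2 t1 t2 :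
  exec c s s1 t1 -> exec c s s2 t2 -> s1 = s2 /\ t1 = t2.
Proof.
move=> H; elim: H s2 t2 => {c s s1 t1};
  do ?[move=> ?]; match goal with H : exec _ _ _ _ |- _ => inversion H end; subst => //;
  repeat match goal with
  | IH : forall _ _, exec ?c ?s _ _ -> _, H : exec ?c ?s _ _ |- _ =>
      have [? ?] := IH _ _ H; clear IH; subst
  end; by [].
Qed.

End Semantics.

(* Array 0 holds n in cell 0; array 1 holds the adjacency matrix, row by row;
   all other cells are 0. *)
Definition input_state n (G : sgraph n) : state := fun a k =>
  match a, k with
  | 0%N, 0%N => n
  | 1%N, _ =>
      [exists u : 'I_n, exists v : 'I_n, (k == u * n + v)%N && G u v] : nat
  | _, _ => 0%N
  end.

(* The output is the rational number (cell 0) / (cell 1) of array 2. *)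
Definition output_num (s : state) : nat := s 2%N 0%N.
Definition output_den (s : state) : nat := s 2%N 1%N.

Definition real_inputs {R : realType} (beta gamma lambda eps : R)
    (x : real_datum) : R :=
  match x with
  | Beta => beta | Gamma => gamma | Lambda => lambda | Eps => eps
  end.

(* The program may depend on the parameters and on Delta, but not on the graph
   or on eps; C and k witness a time bound polynomial in n and 1 / eps. *)
Definition partition_function_FPTAS {R : realType} (beta gamma lambda : R)
    (Delta : degree_bound) : Prop :=
  exists (prog : cmd) (C k : nat),
  forall (n : nat) (G : sgraph n) (eps : R),
    max_degree_le Delta G -> 0 < eps ->
    exists (s : state) (t : nat),
      [/\ exec (real_inputs beta gamma lambda eps) prog (input_state G) s t,
          t%:R <= C%:R * (n%:R + eps^-1 + 1) ^+ k,
          (0 < output_den s)%N,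
          (1 - eps) * partition_function beta gamma lambda G
            <= (output_num s)%:R / (output_den s)%:R &
          (output_num s)%:R / (output_den s)%:R
            <= (1 + eps) * partition_function beta gamma lambda G].

(* Main.v *)
Require Import Defs.
From HB Require Import structures.
From mathcomp Require Import all_boot all_order all_algebra.
From mathcomp Require Import all_classical all_reals all_analysis.
From mathcomp Require Import ring lra zify.

Set Implicit Arguments.
Unset Strict Implicit.
Unset Printing Implicit Defensive.

Import Order.TTheory GRing.Theory Num.Theory.
Import numFieldNormedType.Exports.

(** Ordering the vertices and pinning the earlier ones to spin 1 telescopes the partition function
    into gamma^|E| times a product of factors 1 + R, where R is a ratio of marginals.  Each R obeys a
    tree recursion along self-avoiding walks from its vertex.  In the coordinate w = sqrt x with
    metric dw / sqrt ((beta w^2 + 1) (w^2 + gamma)), a vertex with d children multiplies lengths by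
    at most d sqrt (gain d m) for some common message m; at an interior critical point of the gain
    this is < 1 exactly because the tree recursion is contracting at its fixed point.  For
    Delta = oo, uniqueness forces gamma > 1, so that the gain decays exponentially in d.  Hence the
    contraction is at most (d+1)^(-kappa) with a uniform kappa > 0, and cutting the recursion when
    an integer budget, divided at each vertex by its degree, is exhausted leaves an error
    polynomially small in the budget, with a computation tree of polynomial size.  The recursion is
    then evaluated in exact rational arithmetic with an explicit stack, for rational parameters
    approximating beta, gamma and lambda. *)

Local Open Scope classical_set_scope.
Local Open Scope ring_scope.

(** Up to a constant factor the metric is sqrt(response x) d log x. As [response] is the absolute
    logarithmic derivative of a message, passing from child i to the new ratio F stretches lengths
    by sqrt(response F) times sqrt(response x_i), so each end of an edge is charged half of its
    response. Cauchy-Schwarz and concavity leave only the case of equal messages; with all ratios at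
    the fixed point the factor is d times the response there, which is exactly the derivative that
    uniqueness bounds by 1. The coordinate sqrt x, unlike log x, keeps the ratio 0 at finite
    distance; 0 is the value used at a cut. Unbounded degree is the obstacle to a cut at fixed
    depth: a tree of logarithmic depth may have superpolynomial size. Dividing the budget by the
    degree bounds the size of the tree, but then a vertex of large degree consumes much budget and
    must contract accordingly; hence a power of the degree rather than a constant. The root, having
    no parent, gets no contraction, only a factor n paid once. *)

Section PointwiseDerivatives.
Context {R : realType}.
Implicit Types (f g : R -> R) (t a b : R).

(** The rules of this section are stated for explicit [fun s => ...], so that derivatives of
    formulas are assembled by plain application and only the value is adjusted at the end. *)
Lemma is_derive_mul f g t a b : is_derive t 1 f a -> is_derive t 1 g b ->
  is_derive t 1 (fun s => f s * g s) (a * g t + f t * b).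
Proof.
move=> df dg; apply: (is_derive_eq (is_deriveM df dg)).
by rewrite /GRing.scale /=; ring.
Qed.

Lemma is_derive_add f g t a b : is_derive t 1 f a -> is_derive t 1 g b ->
  is_derive t 1 (fun s => f s + g s) (a + b).
Proof. by move=> df dg; apply: (is_derive_eq (is_deriveD df dg)). Qed.

Lemma is_derive_sub f g t a b : is_derive t 1 f a -> is_derive t 1 g b ->
  is_derive t 1 (fun s => f s - g s) (a - b).
Proof. by move=> df dg; apply: (is_derive_eq (is_deriveB df dg)). Qed.

Lemma is_derive_const t a : is_derive t 1 (fun=> a) 0.
Proof. exact: is_derive_cst. Qed.

Lemma is_derive_pow f t a n : is_derive t 1 f a ->
  is_derive t 1 (fun s => f s ^+ n) (n%:R * f t ^+ n.-1 * a).
Proof.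
move=> df; have := is_deriveX n df; rewrite exprfctE.
by move=> h; apply: (is_derive_eq h).
Qed.

Lemma is_derive_div f g t a b :
  is_derive t 1 f a -> is_derive t 1 g b -> g t != 0 ->
  is_derive t 1 (fun s => f s / g s) ((a * g t - f t * b) / g t ^+ 2).
Proof.
move=> df dg gt0; apply: (is_derive_eq (is_derive_mul df (is_deriveV gt0 dg))).
by rewrite /GRing.scale /=; field.
Qed.

Lemma is_derive_comp f g t a b : is_derive (g t) 1 f a -> is_derive t 1 g b ->
  is_derive t 1 (fun s => f (g s)) (a * b).
Proof. by move=> df dg; apply: (is_derive_eq (is_derive1_comp df dg)). Qed.

End PointwiseDerivatives.

(** * Contraction of the tree recursion *)

Section Contraction.
Context {R : realType}.
Variables beta gamma lambda : R.
Hypothesis af : antiferromagnetic beta gamma lambda.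
Implicit Types (x m : R) (d : nat).

Let b0 : 0 <= beta. Proof. by case: af. Qed.
Let g0 : 0 < gamma. Proof. by case: af. Qed.
Let bg : beta <= gamma. Proof. by case: af. Qed.
Let bg1 : 0 < 1 - beta * gamma. Proof. by case: af; lra. Qed.
Let l0 : 0 < lambda. Proof. by case: af. Qed.

(* [message x] is the factor a neighbour of ratio [x] contributes to the ratio
   of a vertex; [response x] is |d log (message x) / d log x|, and
   [response_of_message] is the same quantity in terms of m = message x. *)
Definition message (x : R) : R := (beta * x + 1) / (x + gamma).
Definition response (x : R) : R :=
  (1 - beta * gamma) * x / ((beta * x + 1) * (x + gamma)).
Definition response_of_message (m : R) : R :=
  (1 - gamma * m) * (m - beta) / ((1 - beta * gamma) * m).

(* response (lambda * m ^+ d) * response_of_message m, with the common factor m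
   cancelled so that it is continuous at m = 0. *)
Definition gain (d : nat) (m : R) : R :=
  lambda * m ^+ d.-1 * ((1 - gamma * m) * (m - beta)) /
  ((beta * (lambda * m ^+ d) + 1) * (lambda * m ^+ d + gamma)).

Lemma betaD1_gt0 x : 0 <= x -> 0 < beta * x + 1.
Proof. by move=> x0; have := mulr_ge0 b0 x0; lra. Qed.

Lemma Dgamma_gt0 x : 0 <= x -> 0 < x + gamma.
Proof. by move=> x0; have := g0; lra. Qed.

Lemma message_gt0 x : 0 <= x -> 0 < message x.
Proof. by move=> x0; rewrite divr_gt0 ?betaD1_gt0 ?Dgamma_gt0. Qed.

Lemma message_ge x : 0 <= x -> beta <= message x.
Proof.
move=> x0; rewrite /message ler_pdivlMr ?Dgamma_gt0// mulrDr.
by have := bg1; lra.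
Qed.

Lemma message_le x : 0 <= x -> message x <= gamma^-1.
Proof.
move=> x0; rewrite /message ler_pdivrMr ?Dgamma_gt0// -(ler_pM2l g0) mulrA divff ?gt_eqF// mul1r.
by have := mulr_ge0 (ltW bg1) x0; lra.
Qed.

Lemma response_ge0 x : 0 <= x -> 0 <= response x.
Proof.
move=> x0; rewrite divr_ge0 ?mulr_ge0// ltW// ?betaD1_gt0 ?Dgamma_gt0//.
Qed.

Lemma response_gt0 x : 0 < x -> 0 < response x.
Proof.
move=> x0; rewrite divr_gt0 ?mulr_gt0//.
- by rewrite betaD1_gt0// ltW.
- by rewrite Dgamma_gt0// ltW.
Qed.

Lemma response_le1 x : 0 <= x -> response x <= 1.
Proof.
move=> x0; rewrite ler_pdivrMr ?mulr_gt0 ?betaD1_gt0 ?Dgamma_gt0// mul1r.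
have := mulr_ge0 b0 (mulr_ge0 x0 x0); have := mulr_ge0 (mulr_ge0 b0 (ltW g0)) x0.
by move: g0; lra.
Qed.

Lemma response_messageE x : 0 <= x -> response_of_message (message x) = response x.
Proof.
move=> x0; rewrite /response_of_message /response /message.
have := betaD1_gt0 x0; have := Dgamma_gt0 x0; move: bg1 => H1 H2 H3.
by field; rewrite !gt_eqF.
Qed.

Lemma gain_ge0 d m : beta <= m -> m <= gamma^-1 -> 0 <= gain d m.
Proof.
move=> bm mg; have m0 : 0 <= m by apply: le_trans bm.
have F0 : 0 <= lambda * m ^+ d by rewrite mulr_ge0 ?exprn_ge0// ltW.
have gm : gamma * m <= 1 by rewrite mulrC -ler_pdivlMr// div1r.
have := betaD1_gt0 F0; have := Dgamma_gt0 F0 => H1 H2.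
by rewrite divr_ge0 ?mulr_ge0 ?exprn_ge0 ?subr_ge0 ?(ltW l0) ?(ltW H1) ?(ltW H2).
Qed.

Lemma gainE d m : 0 < m -> (0 < d)%N ->
  gain d m = response (lambda * m ^+ d) * response_of_message m.
Proof.
move=> m0 d0; rewrite /gain /response /response_of_message.
have F0 : 0 <= lambda * m ^+ d by rewrite mulr_ge0 ?exprn_ge0// ltW.
have := betaD1_gt0 F0; have := Dgamma_gt0 F0.
rewrite -(prednK d0) /= exprS; set z := m ^+ d.-1 => H1 H2; move: bg1 => H3.
by field; rewrite !gt_eqF.
Qed.

(** Here [x] is the ratio whose message is m, and [F] the ratio produced by d messages m. The
    bracket is d (gamma/F - beta F) response(F) - (gamma/x - beta x), so its vanishing is the
    critical equation of [critical_gain_lt1]. *)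
Lemma is_derive_gain d m : (0 < d)%N -> beta < m -> m < gamma^-1 ->
  let F := lambda * m ^+ d in
  let x := (1 - gamma * m) / (m - beta) in
  is_derive m 1 (gain d) (gain d m / m / (1 - beta * gamma) *
     (d%:R * (1 - beta * gamma) * (gamma - beta * F ^+ 2) /
        ((beta * F + 1) * (F + gamma)) - (gamma / x - beta * x))).
Proof.
move=> d0 bm mg F x; have m0 : 0 < m by apply: le_lt_trans bm.
have gm : 0 < 1 - gamma * m.
  by rewrite subr_gt0 mulrC -ltr_pdivlMr// div1r.
have mb : 0 < m - beta by rewrite subr_gt0.
have F0 : 0 <= lambda * m ^+ d by rewrite mulr_ge0 ?exprn_ge0// ltW.
have H1 := betaD1_gt0 F0; have H2 := Dgamma_gt0 F0; have H3 := bg1.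
have dF : is_derive m 1 (fun s => lambda * s ^+ d) (d%:R * F / m).
  apply: (is_derive_eq (is_derive_mul (is_derive_const m lambda) (is_derive_pow d (is_derive_id m 1)))).
  rewrite /F -[in RHS](prednK d0) /= exprS (prednK d0); set z := m ^+ d.-1.
  by rewrite /=; field; rewrite gt_eqF.
have dP : is_derive m 1 (fun s => lambda * s ^+ d.-1) ((d%:R - 1) * (lambda * m ^+ d.-1) / m).
  apply: (is_derive_eq (is_derive_mul (is_derive_const m lambda) (is_derive_pow d.-1 (is_derive_id m 1)))).
  have -> : d%:R - 1 = d.-1%:R :> R by rewrite -{1}(prednK d0) -natr1 addrK.
  case: d.-1 => [|e] /=; first by ring.
  by rewrite exprS; field; rewrite gt_eqF.
have dA : is_derive m 1 (fun s => 1 - gamma * s) (- gamma).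
  apply: (is_derive_eq (is_derive_sub (is_derive_const m 1) (is_derive_mul (is_derive_const m gamma) (is_derive_id m 1)))).
  by rewrite /=; ring.
have dB : is_derive m 1 (fun s => s - beta) 1.
  by apply: (is_derive_eq (is_derive_sub (is_derive_id m 1) (is_derive_const m beta))); ring.
have dC : is_derive m 1 (fun s => beta * (lambda * s ^+ d) + 1) (beta * (d%:R * F / m)).
  apply: (is_derive_eq (is_derive_add (is_derive_mul (is_derive_const m beta) dF) (is_derive_const m 1))).
  by rewrite /=; ring.
have dD : is_derive m 1 (fun s => lambda * s ^+ d + gamma) (d%:R * F / m).
  by apply: (is_derive_eq (is_derive_add dF (is_derive_const m gamma))); ring.
have nz : (beta * (lambda * m ^+ d) + 1) * (lambda * m ^+ d + gamma) != 0 by rewrite mulf_neq0 ?gt_eqF.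
apply: (is_derive_eq (is_derive_div (is_derive_mul dP (is_derive_mul dA dB)) (is_derive_mul dC dD) nz)).
rewrite /= /gain -/F /x; rewrite -/F in H1 H2 nz.
move: H1 H2; set z := m ^+ d.-1; move: F {dF dP dC dD F0 nz} => F H1 H2.
by field; rewrite !gt_eqF.
Qed.

(* With h the response and q(y) = (gamma/y - beta y) h(y), a critical point of the gain satisfies
   d q(F) = gamma/x - beta x; both q and y |-> gamma/y - beta y decrease, and comparing them at
   x, F and the fixed point (which separates x from F) forces d^2 h(x) h(F) < 1. *)
Lemma critical_gain_lt1 (D x F y : R) :
  let g z := gamma / z - beta * z in
  let h := response in
  0 < D -> 0 < x -> 0 < F -> 0 < y ->
  (x <= y -> y <= F) -> (y <= x -> F <= y) ->
  D * h y < 1 -> D * (g F * h F) = g x -> D ^+ 2 * (h x * h F) < 1.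
Proof.
move=> g h D0 x0 F0 y0 xy yx Dh crit.
have gd u v : 0 < u -> u <= v -> g v <= g u.
  move=> u0 uv; rewrite /g; apply: lerB; last by rewrite ler_wpM2l.
  by rewrite ler_pM2l// lef_pV2// posrE; apply: lt_le_trans uv.
have hp u : 0 < u -> 0 < h u by exact: response_gt0.
have qE u : 0 < u -> g u * h u = (1 - beta * gamma) * (gamma - beta * u ^+ 2) / ((beta * u + 1) * (u + gamma)).
  move=> u0; have := betaD1_gt0 (ltW u0); have := Dgamma_gt0 (ltW u0) => H1 H2.
  by rewrite /g /h /response; field; rewrite !gt_eqF.
have qd u v : 0 < u -> u <= v -> g v * h v <= g u * h u.
  move=> u0 uv; have v0 : 0 < v by apply: lt_le_trans uv.
  rewrite !qE// -!mulrA ler_pM2l//.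
  have := betaD1_gt0 (ltW u0); have := Dgamma_gt0 (ltW u0) => H1 H2.
  have := betaD1_gt0 (ltW v0); have := Dgamma_gt0 (ltW v0) => H3 H4.
  rewrite ler_pdivrMr ?mulr_gt0// mulrAC ler_pdivlMr ?mulr_gt0// -subr_ge0.
  have -> : (gamma - beta * u ^+ 2) * ((beta * v + 1) * (v + gamma)) -
    (gamma - beta * v ^+ 2) * ((beta * u + 1) * (u + gamma)) =
    (v - u) * ((1 + beta * gamma) * gamma + 2 * beta * gamma * (u + v) + (1 + beta * gamma) * beta * u * v).
    by ring.
  have bg0 := mulr_ge0 b0 (ltW g0).
  apply: mulr_ge0; first by rewrite subr_ge0.
  have A1 : 0 <= (1 + beta * gamma) * gamma by rewrite mulr_ge0 ?ltW// ltr_pwDl.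
  have A2 : 0 <= 2 * beta * gamma * (u + v) by rewrite -(mulrA 2) mulr_ge0 ?addr_ge0 ?mulr_ge0 // ltW.
  have A3 : 0 <= (1 + beta * gamma) * beta * u * v.
    by rewrite !mulr_ge0// ?ltW// ltr_pwDl.
  by rewrite !addr_ge0.
have key u v : D * (g v * h v) = g u -> 0 < u -> 0 < v -> h v * D * (h u * D) * g v = D * (g u * h u).
  by move=> e _ _; rewrite -e; ring.
(* With q = g h this reads w g(F) = D q(x), where w is the quantity to be bounded by 1. *)
have E := key _ _ crit x0 F0.
have hx := hp _ x0; have hF := hp _ F0; have hy := hp _ y0.
have goalE : D ^+ 2 * (h x * h F) = h F * D * (h x * D) by ring.
rewrite goalE; set w := h F * D * (h x * D) in E *.
(* On either side of y, one strict sign of g(x) and the value 0 contradict the critical equation;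
   for the other sign, g(F) has that sign too and dominates D q(x) strictly in absolute value, so
   that division by g(F) gives w < 1. *)
have [yx'|xy'|exy] := ltgtP y x.
- have Fy := yx (ltW yx').
  have gyF := gd _ _ F0 Fy; have gxy := gd _ _ y0 (ltW yx').
  have qyF := qd _ _ F0 Fy; have qxy := qd _ _ y0 (ltW yx').
  have [gx|gx|gx] := ltgtP (g x) 0.
  + have qF : g F * h F < 0 by move: crit gx; nra.
    have gF : g F < 0 by move: qF; nra.
    have gy : g y < 0 by lra.
    have : D * (g y * h y) > g y by nra.
    have : D * (g y * h y) <= D * (g F * h F) by rewrite ler_pM2l.
    by lra.
  + have gy : 0 < g y by lra.
    have gF : 0 < g F by lra.
    have : D * (g x * h x) <= D * (g y * h y) by rewrite ler_pM2l.
    have : D * (g y * h y) < g y by nra.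
    have : w * g F < g F by rewrite E; nra.
    by move=> *; nra.
  + have gF0 : g F = 0.
      apply/eqP; move/eqP: crit.
      by rewrite gx mulf_eq0 (gt_eqF D0) /= mulf_eq0 (gt_eqF hF) orbF.
    have gy0 : g y = 0 by lra.
    have : g x < g y.
      rewrite /g ltr_leD ?ltr_pM2l ?ltf_pV2// lerN2 ler_wpM2l// ltW//.
    by lra.
- have yF := xy (ltW xy').
  have gFy := gd _ _ y0 yF; have gyx := gd _ _ x0 (ltW xy').
  have qFy := qd _ _ y0 yF; have qyx := qd _ _ x0 (ltW xy').
  have [gx|gx|gx] := ltgtP (g x) 0.
  + have gy : g y < 0 by lra.
    have gF : g F < 0 by lra.
    have : D * (g y * h y) <= D * (g x * h x) by rewrite ler_pM2l.
    have : D * (g y * h y) > g y by nra.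
    have : w * g F > g F by rewrite E; nra.
    by move=> *; nra.
  + have qF : 0 < g F * h F by move: crit gx; nra.
    have gF : 0 < g F by move: qF; nra.
    have gy : 0 < g y by lra.
    have : D * (g y * h y) < g y by nra.
    have : D * (g F * h F) <= D * (g y * h y) by rewrite ler_pM2l.
    by lra.
  + have gF0 : g F = 0.
      apply/eqP; move/eqP: crit.
      by rewrite gx mulf_eq0 (gt_eqF D0) /= mulf_eq0 (gt_eqF hF) orbF.
    have gy0 : g y = 0 by lra.
    have : g y < g x.
      rewrite /g ltr_leD ?ltr_pM2l ?ltf_pV2// lerN2 ler_wpM2l// ltW//.
    by lra.
- have FE : F = y by apply/eqP; rewrite eq_le xy ?yx// exy.
  rewrite /w FE -exy.
  have : 0 < D * h y by rewrite mulr_gt0.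
  by nra.
Qed.

(** Unlike [is_derive_gain] this includes the ends of the interval, and m = 0 when beta = 0, as the
    extreme value theorem needs continuity on the closed interval. *)
Lemma gain_derivable d m : beta <= m -> derivable (gain d) m 1.
Proof.
move=> bm; have m0 : 0 <= m by apply: le_trans bm.
have F0 : 0 <= lambda * m ^+ d by rewrite mulr_ge0 ?exprn_ge0// ltW.
have H1 := betaD1_gt0 F0; have H2 := Dgamma_gt0 F0.
have nz : (beta * (lambda * m ^+ d) + 1) * (lambda * m ^+ d + gamma) != 0 by rewrite mulf_neq0 ?gt_eqF.
have dX e := is_derive_mul (is_derive_const m lambda) (is_derive_pow e (is_derive_id m 1)).
have dC := is_derive_add (is_derive_mul (is_derive_const m beta) (dX d)) (is_derive_const m 1).
have dD := is_derive_add (dX d) (is_derive_const m gamma).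
have dA := is_derive_sub (is_derive_const m 1) (is_derive_mul (is_derive_const m gamma) (is_derive_id m 1)).
have dB := is_derive_sub (is_derive_id m 1) (is_derive_const m beta).
exact: (@ex_derive _ _ _ _ _ _ _ (is_derive_div (is_derive_mul (dX d.-1) (is_derive_mul dA dB)) (is_derive_mul dC dD) nz)).
Qed.

Lemma beta_le_Vgamma : beta <= gamma^-1.
Proof. by rewrite -div1r ler_pdivlMr//; have := bg1; lra. Qed.

(** The gain vanishes at both ends of the interval of messages, so a nonzero maximum is an interior
    critical point, and [critical_gain_lt1] applies there. *)
Lemma gain_bounded_lt1 d : (0 < d)%N ->
  `| derive1 (tree_rec beta gamma lambda d) (xhat beta gamma lambda d) | < 1 ->
  exists2 S : R, 0 <= S < 1 &
    forall m, beta <= m -> m <= gamma^-1 -> d%:R ^+ 2 * gain d m <= S.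
Proof.
move=> d0; rewrite normr_derive_xhat//.
have [[]] := xhatP d af; rewrite /pos_fixpoint /=; set y := xhat _ _ _ _ => y0 fy _ Dy.
have cont : {within `[beta, gamma^-1], continuous (gain d)}.
  apply: derivable_within_continuous => x; rewrite in_itv /= => /andP[bx _].
  exact: gain_derivable.
have [c] := EVT_max beta_le_Vgamma cont.
rewrite in_itv /= => /andP[bc cg] cmax.
have c0 : 0 <= c by apply: le_trans bc.
have gc0 := gain_ge0 d bc cg.
exists (d%:R ^+ 2 * gain d c); last first.
  by move=> m bm mg; rewrite ler_wpM2l ?exprn_ge0// cmax// in_itv /= bm.
rewrite mulr_ge0 ?exprn_ge0//=.
have [->|gcn] := eqVneq (gain d c) 0; first by rewrite mulr0.
have bc' : beta < c.
  rewrite lt_neqAle bc andbT; apply: contraNneq gcn => <-.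
  by rewrite /gain subrr !(mulr0, mul0r).
have cg' : c < gamma^-1.
  rewrite lt_neqAle cg andbT; apply: contraNneq gcn => ->.
  by rewrite /gain (divff (lt0r_neq0 g0)) subrr !(mul0r, mulr0).
have cp : 0 < c by apply: le_lt_trans bc'.
have dmax : is_derive c 1 (gain d) 0.
  apply: (@derive1_at_max _ _ beta gamma^-1); first exact: beta_le_Vgamma.
  - by move=> t; rewrite in_itv /= => /andP[bt _]; apply: gain_derivable; apply: ltW.
  - by rewrite in_itv /= bc'.
  - by move=> t; rewrite in_itv /= => /andP[bt tg]; apply: cmax; rewrite in_itv /= !ltW.
have := is_derive_gain d0 bc' cg'.
set F := lambda * c ^+ d; set x := (1 - gamma * c) / (c - beta) => /=.
move=> /(@derive_val _ _ _ _ _ _ _); rewrite (@derive_val _ _ _ _ _ _ _ dmax).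
move=> /esym /eqP; rewrite mulf_eq0 => /orP[|].
  by rewrite (mulf_eq0 _ (1 - _)^-1) (mulf_eq0 _ c^-1) !invr_eq0 (negbTE gcn) (gt_eqF cp) (gt_eqF bg1).
rewrite subr_eq0 => /eqP crit.
have gc : 0 < 1 - gamma * c by rewrite subr_gt0 mulrC -ltr_pdivlMr// div1r.
have cb : 0 < c - beta by rewrite subr_gt0.
have x0 : 0 < x by rewrite divr_gt0.
have F0 : 0 < F by rewrite mulr_gt0 ?exprn_gt0.
have xc : (beta * x + 1) / (x + gamma) = c.
  have xg := lt0r_neq0 (Dgamma_gt0 (ltW x0)).
  have xE : x * (c - beta) = 1 - gamma * c by rewrite /x divfK// lt0r_neq0.
  apply: (mulIf xg); rewrite divfK//; apply: subr0_eq.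
  have -> : beta * x + 1 - c * (x + gamma) = 1 - gamma * c - x * (c - beta) by ring.
  by rewrite xE subrr.
(* One step of the nonincreasing recursion leads from x to F, hence its fixed point y lies between
   them. *)
have fx : tree_rec beta gamma lambda d x = F by rewrite /tree_rec xc.
rewrite (gainE cp d0) -/F -[in response_of_message c]xc -/(message x) response_messageE ?ltW//.
rewrite [response F * _]mulrC.
apply: (@critical_gain_lt1 d%:R x F y) => //.
- by rewrite ltr0n.
- by move=> xy; rewrite -fy -fx tree_rec_nincr// ltW.
- by move=> yx; rewrite -fy -fx tree_rec_nincr// ltW.
- by rewrite /response !mulrA.
- rewrite -crit /response; have := betaD1_gt0 (ltW F0); have := Dgamma_gt0 (ltW F0) => H1 H2.
  by field; rewrite !gt_eqF.
Qed.

(** * Reduction to equal messages *)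

Lemma sqr_sum_le (I : finType) (A : {pred I}) (s : I -> R) : (0 < #|A|)%N ->
  (\sum_(i in A) s i) ^+ 2 <= #|A|%:R * \sum_(i in A) s i ^+ 2.
Proof.
move=> A0; have d0 : (0 : R) < #|A|%:R by rewrite ltr0n.
set T := \sum_(i in A) s i; set a := T / #|A|%:R.
have : 0 <= \sum_(i in A) (s i - a) ^+ 2 by apply: sumr_ge0 => i _; apply: sqr_ge0.
have -> : \sum_(i in A) (s i - a) ^+ 2 = \sum_(i in A) s i ^+ 2 - 2 * a * T + #|A|%:R * a ^+ 2.
  have -> : #|A|%:R * a ^+ 2 = \sum_(i in A) a ^+ 2 by rewrite sumr_const mulr_natl.
  rewrite mulr_sumr -sumrB -big_split /=.
  by apply: eq_bigr => i _; ring.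
have -> : 2 * a * T = 2 * (T ^+ 2 / #|A|%:R) by rewrite /a; ring.
have -> : #|A|%:R * a ^+ 2 = T ^+ 2 / #|A|%:R by rewrite /a; field; rewrite gt_eqF.
set W := \sum_(i in A) _ => h.
by rewrite mulrC -ler_pdivrMr//; lra.
Qed.

Lemma response_of_messageE m : 0 < m ->
  response_of_message m = (1 + beta * gamma - gamma * m - beta / m) / (1 - beta * gamma).
Proof. by move=> m0; rewrite /response_of_message; move: bg1 => ?; field; rewrite !gt_eqF. Qed.

Lemma response_of_message_ge0 m : beta <= m -> m <= gamma^-1 -> 0 <= response_of_message m.
Proof.
move=> bm mg; have m0 : 0 <= m by apply: le_trans bm.
have gm : gamma * m <= 1 by rewrite mulrC -ler_pdivlMr// div1r.
apply: divr_ge0; apply: mulr_ge0; rewrite ?subr_ge0// -subr_ge0.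
exact: ltW.
Qed.

(* Concavity of the response in log m (AM-GM for the m_i and for the 1/m_i)
   reduces the bound to equal messages. *)
Lemma sum_response_le (I : finType) (A : {pred I}) (mu : I -> R) (S : R) :
  (0 < #|A|)%N -> 0 <= S ->
  (forall i, i \in A -> beta <= mu i <= gamma^-1) ->
  (forall m, beta <= m -> m <= gamma^-1 -> #|A|%:R ^+ 2 * gain #|A| m <= S) ->
  response (lambda * \prod_(i in A) mu i) *
    (\sum_(i in A) Num.sqrt (response_of_message (mu i))) ^+ 2 <= S.
Proof.
move=> A0 S0 mub gS; set P := \prod_(i in A) mu i.
have mu0 i : i \in A -> 0 <= mu i by move=> /mub /andP[h _]; apply: le_trans h.
have [P0|Pn] := eqVneq P 0; first by rewrite P0 /response !(mulr0, mul0r).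
have P0 : 0 < P by rewrite lt_neqAle eq_sym Pn prodr_ge0.
have mup i : i \in A -> 0 < mu i.
  move=> iA; rewrite lt_neqAle mu0// andbT eq_sym; apply: contraNneq Pn => e.
  by rewrite /P (bigD1 i)//= e mul0r.
set d := #|A| in A0 gS *.
have d0 : (0 : R) < d%:R by rewrite ltr0n.
(* The geometric mean: replacing every message by M leaves their product, and hence the first
   response, unchanged. *)
pose M := P `^ d%:R^-1.
have M0 : 0 < M by rewrite powR_gt0.
have Md : M ^+ d = P.
  by rewrite -powR_mulrn ?ltW// -powRrM mulVf ?gt_eqF// powRr1// ltW.
have pexp (u v : R) : 0 <= u -> 0 <= v -> u ^+ d <= v ^+ d -> u <= v.
  by move=> u0 v0; rewrite ler_pXn2r ?nnegrE.
have bM : beta <= M.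
  apply: pexp => //; rewrite ?(ltW M0)// Md /d /P -prodr_const; apply: ler_prod => i iA.
  by rewrite b0; have /andP[] := mub i iA.
have Mg : M <= gamma^-1.
  apply: pexp; rewrite ?invr_ge0 ?(ltW M0) ?(ltW g0)// Md /d /P -prodr_const; apply: ler_prod => i iA.
  by rewrite mu0//; have /andP[] := mub i iA.
have AM : M <= (\sum_(i in A) mu i) / d%:R.
  apply: pexp; rewrite ?divr_ge0 ?sumr_ge0 ?(ltW M0)// Md.
  by case: (leif_AGM mu0).
have AV : M^-1 <= (\sum_(i in A) (mu i)^-1) / d%:R.
  have muV0 i : i \in A -> 0 <= (mu i)^-1 by move=> iA; rewrite invr_ge0 mu0.
  apply: pexp; rewrite ?divr_ge0 ?sumr_ge0 ?invr_ge0 ?(ltW M0)// exprVn Md /P -prodfV.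
  by case: (leif_AGM muV0).
(* [response_of_message] is affine in m and 1/m with nonpositive coefficients, so both AM-GM
   inequalities push in the same direction. *)
have sH : \sum_(i in A) response_of_message (mu i) <= d%:R * response_of_message M.
  rewrite (eq_bigr (fun i => (1 + beta * gamma - gamma * mu i - beta / mu i) / (1 - beta * gamma))); last first.
    by move=> i iA; rewrite response_of_messageE// mup.
  rewrite -mulr_suml response_of_messageE// mulrA ler_pM2r ?invr_gt0//.
  rewrite !sumrB sumr_const -!mulr_sumr -/d -[X in X - _ - _]mulr_natl.
  rewrite ler_pdivlMr// in AM; rewrite ler_pdivlMr// in AV.
  have := ler_wpM2l (ltW g0) AM; have := ler_wpM2l b0 AV.
  by rewrite !mulrBr; lra.
have rF : 0 <= response (lambda * P) by rewrite response_ge0// mulr_ge0// ltW.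
apply: le_trans (gS M bM Mg).
rewrite gainE// Md.
have CS := @sqr_sum_le I A (fun i => Num.sqrt (response_of_message (mu i))) A0.
have sE : \sum_(i in A) Num.sqrt (response_of_message (mu i)) ^+ 2 = \sum_(i in A) response_of_message (mu i).
  apply: eq_bigr => i iA; rewrite sqr_sqrtr// response_of_message_ge0//; by have /andP[] := mub i iA.
rewrite sE -/d in CS.
rewrite [X in _ <= X]mulrCA ler_wpM2l//; apply: le_trans CS _.
by rewrite expr2 -mulrA ler_pM2l.
Qed.

(** * Uniformity of the contraction in the degree *)

(** Turns a strict bound S < 1 at one degree into a negative power of the degree. The inner bound is
    Bernoulli's inequality for 1/S, cleared of denominators. *)
Lemma pow_mul_le1 (S : R) (n : nat) : 0 <= S -> S < 1 ->
  exists N : nat, S ^+ N * n.+1%:R <= 1.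
Proof.
move=> S0 S1; have u0 : 0 < 1 - S by lra.
have B N : S ^+ N * (1 + N%:R * (1 - S)) <= 1.
  elim: N => [|N IH]; first by rewrite expr0 mul0r; lra.
  have SN : S ^+ N <= 1 by rewrite exprn_ile1// ltW.
  rewrite exprS -natr1; have SN0 : 0 <= S ^+ N by rewrite exprn_ge0.
  have -> : S * S ^+ N * (1 + (N%:R + 1) * (1 - S)) =
    S * (S ^+ N * (1 + N%:R * (1 - S))) + S * (S ^+ N * (1 - S)) by ring.
  have h1 := ler_wpM2l S0 IH.
  have h2 : S ^+ N * (1 - S) <= 1 - S by rewrite ler_piMl// ltW.
  have h3 := ler_wpM2l S0 h2.
  by have := sqr_ge0 (1 - S); lra.
pose N := Num.bound (n%:R / (1 - S)); exists N.
have hN : n%:R / (1 - S) < N%:R by apply: archi_boundP; rewrite divr_ge0// ltW.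
rewrite ltr_pdivrMr// in hN; apply: le_trans (B N).
by rewrite ler_wpM2l ?exprn_ge0// -natr1; lra.
Qed.

(** If gamma <= 1, the fixed points y_d stay bounded and the derivative condition forces d y_d < a
    for a constant a. But each message is then at least 1/(1 + y_d), so y_d >= lambda (1 + y_d)^(-d)
    >= lambda exp(-a), which is impossible for large d. *)
Lemma unique_all_gamma_gt1 : unique_up_to beta gamma lambda None -> 1 < gamma.
Proof.
move=> U; rewrite ltNge; apply/negP => gle1.
have blt1 : beta < 1.
  rewrite ltNge; apply/negP => b1.
  have g1 : 1 <= gamma by apply: le_trans bg.
  have : 1 <= beta * gamma by rewrite -[1]mulr1 ler_pM.
  by move: bg1; lra.
(* Beyond (1 - gamma)/(1 - beta) messages are at most 1 and the recursion yields at most lambda, so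
   no fixed point exceeds X. *)
pose X := Num.max lambda ((1 - gamma) / (1 - beta)).
pose K := (beta * X + 1) * (X + gamma).
have X0 : 0 <= X by rewrite le_max (ltW l0).
have K0 : 0 < K by rewrite mulr_gt0 ?betaD1_gt0 ?Dgamma_gt0.
pose a := K / (1 - beta * gamma).
have a0 : 0 < a by rewrite divr_gt0.
pose y d := xhat beta gamma lambda d.
have main d : (0 < d)%N -> [/\ 0 < y d, y d * d%:R < a & lambda * expR (- a) <= y d].
  move=> d0; have := U d d0 isT; rewrite normr_derive_xhat// -/(y d).
  have [[]] := xhatP d af; rewrite -/(y d) => y0 fy _ hy.
  have dp : (0 : R) < d%:R by rewrite ltr0n.
  have H1 := betaD1_gt0 (ltW y0); have H2 := Dgamma_gt0 (ltW y0).
  have yX : y d <= X.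
    rewrite leNgt; apply/negP; rewrite gt_max => /andP[ly].
    rewrite ltr_pdivrMr ?subr_gt0// => h.
    have mle : (beta * y d + 1) / (y d + gamma) <= 1.
      by rewrite ler_pdivrMr// mul1r; lra.
    have : tree_rec beta gamma lambda d (y d) <= lambda.
      by rewrite /tree_rec ler_piMr ?(ltW l0)// exprn_ile1// divr_ge0 ?(ltW H1) ?(ltW H2).
    by rewrite fy; lra.
  have ya : y d * d%:R < a.
    rewrite /a ltr_pdivlMr//.
    rewrite ltr_pdivrMr ?mulr_gt0// mul1r in hy.
    have -> : y d * d%:R * (1 - beta * gamma) = d%:R * (1 - beta * gamma) * y d by ring.
    apply: lt_le_trans hy _; rewrite /K ler_pM ?(ltW H1) ?(ltW H2) ?lerD2r//.
    by rewrite ler_wpM2l.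
  split=> //.
  rewrite -[X in _ <= X]fy /tree_rec ler_pM2l//.
  have le1 : (1 + y d)^-1 <= (beta * y d + 1) / (y d + gamma).
    rewrite ler_pdivlMr// mulrC ler_pdivrMr; last by lra.
    have := mulr_ge0 b0 (ltW y0); have := mulr_ge0 (mulr_ge0 b0 (ltW y0)) (ltW y0); lra.
  have e1 : expR (- a) <= (1 + y d)^-1 ^+ d.
    rewrite exprVn expRN lef_pV2 ?posrE ?expR_gt0 ?exprn_gt0 ?addr_gt0//.
    apply: (@le_trans _ _ (expR (y d) ^+ d)).
      by rewrite ler_pXn2r// ?nnegrE ?expR_ge1Dx ?expR_ge0 ?addr_ge0// ltW.
    by rewrite -expRM_natl ler_expR mulrC ltW.
  apply: le_trans e1 _.
  by rewrite ler_pXn2r// nnegrE ?invr_ge0 ?addr_ge0 ?(ltW y0)// divr_ge0// ltW.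
pose N := Num.bound (a / (lambda * expR (- a))).
have p0 : 0 < lambda * expR (- a) by rewrite mulr_gt0 ?expR_gt0.
have hN : a / (lambda * expR (- a)) < N%:R by apply: archi_boundP; rewrite divr_ge0// ltW.
have [y0 ya yl] := main N.+1 isT.
rewrite ltr_pdivrMr// in hN.
have : N%:R * (lambda * expR (- a)) <= N.+1%:R * y N.+1.
  by rewrite ler_pM ?(ltW p0)// ler_nat.
by rewrite [X in _ <= X]mulrC; lra.
Qed.

Lemma gain_le d m : (0 < d)%N -> 1 < gamma -> beta <= m -> m <= gamma^-1 ->
  gain d m <= lambda * gamma^-1 ^+ d.
Proof.
move=> d0 g1 bm mg; have m0 : 0 <= m by apply: le_trans bm.
have F0 : 0 <= lambda * m ^+ d by rewrite mulr_ge0 ?exprn_ge0// ltW.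
have H1 := betaD1_gt0 F0; have H2 := Dgamma_gt0 F0.
have gm : gamma * m <= 1 by rewrite mulrC -ler_pdivlMr// div1r.
rewrite /gain ler_pdivrMr ?mulr_gt0//.
have Z0 : 0 <= lambda * m ^+ d.-1 by rewrite mulr_ge0 ?exprn_ge0// ltW.
have q1 : (1 - gamma * m) * (m - beta) <= m.
  have := mulr_ge0 (ltW g0) m0; have : 0 <= m - beta by lra.
  by move=> h1 h2; rewrite -[X in _ <= X]mul1r ler_pM//; have := b0; lra.
have := ler_wpM2l Z0 q1; rewrite -[_ * _ ^+ _ * m]mulrA -exprSr prednK// => /le_trans; apply.
apply: (@le_trans _ _ (lambda * gamma^-1 ^+ d)).
  by rewrite ler_pM2l// ler_pXn2r// nnegrE// invr_ge0 ltW.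
have bF := mulr_ge0 b0 F0.
rewrite ler_peMr ?mulr_ge0 ?exprn_ge0 ?invr_ge0 ?(ltW l0) ?(ltW g0)//.
by rewrite -[X in X <= _]mulr1 ler_pM//; lra.
Qed.

Lemma cubic_le_exp (c : R) : 1 < gamma -> 0 <= c ->
  exists D : nat, forall d, (D <= d)%N -> (0 < d)%N ->
    d%:R ^+ 2 * (c * gamma^-1 ^+ d) * d.+1%:R <= 1.
Proof.
move=> g1 c0; pose a := ln gamma; have a0 : 0 < a by rewrite ln_gt0.
(* The exponential is bounded below by its fourth order term; 48 is 4! times the 2 from d + 1 <= 2
   d. *)
pose D := Num.bound (48%:R * c / a ^+ 4); exists D => d Dd d0.
have hD : 48%:R * c / a ^+ 4 < D%:R.
  by apply: archi_boundP; rewrite divr_ge0 ?mulr_ge0 ?exprn_ge0 ?(ltW a0).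
have hd : 48%:R * c < d%:R * a ^+ 4.
  rewrite -ltr_pdivrMr ?exprn_gt0//; apply: lt_le_trans hD _; by rewrite ler_nat.
have dp : (1 : R) <= d%:R by rewrite ler1n.
have gd : (d%:R * a) ^+ 4 / 24%:R <= gamma ^+ d.
  have -> : gamma ^+ d = expR (d%:R * a) by rewrite expRM_natl lnK// posrE.
  have := @expR_ge1Dxn _ (d%:R * a) 3; rewrite mulr_ge0 ?(ltW a0)// => /(_ isT).
  by rewrite (_ : 4`!%:R = 24%:R :> R)//; lra.
have gp : 0 < gamma ^+ d by rewrite exprn_gt0.
rewrite exprVn; have -> : d%:R ^+ 2 * (c / gamma ^+ d) * d.+1%:R = d%:R ^+ 2 * c * d.+1%:R / gamma ^+ d by ring.
rewrite ler_pdivrMr// mul1r; apply: le_trans gd.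
rewrite ler_pdivlMr// exprMn.
have -> : d%:R ^+ 4 * a ^+ 4 = d%:R ^+ 3 * (d%:R * a ^+ 4) by ring.
apply: (@le_trans _ _ (d%:R ^+ 3 * (48%:R * c))); last first.
  by rewrite ler_wpM2l ?exprn_ge0// ltW.
have -> : d%:R ^+ 3 * (48%:R * c) = d%:R ^+ 2 * c * 24%:R * (d%:R + d%:R) by ring.
rewrite -natr1.
have -> : d%:R ^+ 2 * c * (d%:R + 1) * 24%:R = d%:R ^+ 2 * c * 24%:R * (d%:R + 1) by ring.
by rewrite ler_wpM2l ?mulr_ge0 ?exprn_ge0// lerD2l.
Qed.

(** Finitely many degrees are treated one at a time by compactness; for unbounded degree the
    remaining ones follow from the exponential decay of the gain. *)
Lemma uniform_contraction Delta : unique_up_to beta gamma lambda Delta ->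
  exists2 kappa : R, 0 < kappa &
    forall d, (0 < d)%N -> ltn_degree_bound d Delta ->
    forall m, beta <= m -> m <= gamma^-1 ->
      d%:R ^+ 2 * gain d m <= (d.+1%:R `^ (- kappa)) ^+ 2.
Proof.
move=> U.
have ge0 d m : beta <= m -> m <= gamma^-1 -> 0 <= d%:R ^+ 2 * gain d m.
  by move=> bm mg; rewrite mulr_ge0 ?exprn_ge0 ?gain_ge0.
(* The first bound says d^2 gain <= (d+1)^(-1/N); the second makes [ok] monotone in N, so that
   exponents found for different degrees can be merged by taking the maximum. *)
pose ok N d := (0 < d)%N -> ltn_degree_bound d Delta ->
    forall m, beta <= m -> m <= gamma^-1 ->
      (d%:R ^+ 2 * gain d m) ^+ N * d.+1%:R <= 1 /\ d%:R ^+ 2 * gain d m <= 1.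
have mono N N' d : (N <= N')%N -> ok N d -> ok N' d.
  move=> NN h d0 dD m bm mg; have [h1 h2] := h d0 dD m bm mg; split=> //.
  apply: le_trans h1; rewrite ler_wpM2r//.
  by rewrite ler_wiXn2l// ge0.
have fin D : exists N, forall d, (d < D)%N -> ok N d.
  elim: D => [|D [N hN]]; first by exists 0%N.
  have [D0|D0] := posnP D.
    by exists N => d; rewrite D0 ltnS leqn0 => /eqP -> //.
  case lD : (ltn_degree_bound D Delta); last first.
    exists N => d; rewrite ltnS leq_eqVlt => /orP[/eqP ->|]; last exact: hN.
    by move=> _; rewrite lD.
  have [S /andP[S0 S1] hS] := gain_bounded_lt1 D0 (U D D0 lD).
  have [N' hN'] := pow_mul_le1 D S0 S1.
  exists (maxn N N') => d; rewrite ltnS leq_eqVlt => /orP[/eqP ->|].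
    apply: (@mono N'); first exact: leq_maxr.
    move=> _ _ m bm mg; split; last by apply: le_trans (hS _ bm mg) (ltW S1).
    apply: le_trans hN'; rewrite ler_wpM2r// lerXn2r ?nnegrE ?ge0//; exact: hS.
  by move=> dD; apply: (@mono N); [exact: leq_maxl|exact: hN].
have [N hN] : exists N, forall d, ok N d.
  case: Delta U @ok mono fin => [D|] U ok mono fin.
    have [N hN] := fin D; exists N => d d0 dD; exact: hN.
  have g1 := unique_all_gamma_gt1 U.
  have [D hD] := cubic_le_exp g1 (ltW l0).
  have [N hN] := fin D; exists (maxn N 1) => d.
  have [dD|Dd] := ltnP d D; first by apply: (@mono N); [exact: leq_maxl|exact: hN].
  apply: (@mono 1%N); first exact: leq_maxr.
  move=> d0 _ m bm mg; rewrite expr1.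
  have h : d%:R ^+ 2 * gain d m * d.+1%:R <= 1.
    apply: le_trans (hD d Dd d0); rewrite ler_wpM2r// ler_wpM2l ?exprn_ge0//.
    exact: gain_le.
  split=> //; apply: le_trans h; rewrite ler_peMr ?ge0// ler1n//.
have {}hN : forall d, ok N.+1 d by move=> d; apply: (@mono N).
(* The factor 2 compensates the square in the conclusion. *)
exists (2 * N.+1%:R)^-1; first by rewrite invr_gt0 mulr_gt0.
move=> d d0 dD m bm mg; have [h _] := hN d d0 dD m bm mg.
have dp : (0 : R) < d.+1%:R by [].
rewrite -(@ler_pXn2r _ N.+1)// ?nnegrE ?ge0 ?exprn_ge0 ?powR_ge0//.
have -> : ((d.+1%:R `^ (- (2 * N.+1%:R)^-1)) ^+ 2) ^+ N.+1 = d.+1%:R^-1 :> R.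
  rewrite -exprM -powR_mulrn ?powR_ge0// -powRrM natrM mulNr mulVf ?powR_inv1//.
by rewrite -[X in _ <= X]mul1r ler_pdivlMr.
Qed.

End Contraction.

(** * The self-avoiding walk recursion *)

Section Recursion.
Context {R : realType}.
Variables (beta gamma lambda : R) (n : nat) (G : sgraph n).
Implicit Types (st : nat -> nat) (u v w i : 'I_n) (sigma : {ffun 'I_n -> bool}) (c : bool).

Local Notation ew := (edge_weight beta gamma).

Definition set_status (st : nat -> nat) (v t : nat) : nat -> nat :=
  fun w : nat => if w == v then t else st w.

(* A vertex of status 0 is free.  A vertex of status t > 0 has been removed; it acts on a free
   neighbour v as if pinned to spin 0 when 2v+3 < t, to spin 1 when t < 2v+3, and not at all
   when t = 2v+3. *)
Definition pin_weight (t v : nat) (c : bool) : R :=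
  if (v.*2.+3 < t)%N then ew false c else
  if (t < v.*2.+3)%N then ew true c else 1.

(** The quotient of [pin_weight] at the two spins of v. *)
Definition pin_message (t v : nat) : R :=
  if (v.*2.+3 < t)%N then beta else if (t < v.*2.+3)%N then gamma^-1 else 1.

Definition pinned_edge st sigma u w : R :=
  if st u == 0%N then
    if st w == 0%N then ew (sigma u) (sigma w) else pin_weight (st w) u (sigma u)
  else if st w == 0%N then pin_weight (st u) w (sigma w) else 1.

(** A removed vertex is frozen at [true] with weight 1, whatever its neighbours see, so that sums
    still range over all configurations without multiplicity. *)
Definition pinned_vertex st u c : R :=
  if st u == 0%N then vertex_weight lambda c else c%:R.

Definition pinned_weight st sigma : R :=
  (\prod_(e : 'I_n * 'I_n | (e.1 < e.2)%N && G e.1 e.2) pinned_edge st sigma e.1 e.2) *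
  \prod_v pinned_vertex st v (sigma v).

Definition pinned_Z st : R := \sum_sigma pinned_weight st sigma.
Definition pinned_Z_at st v c : R := \sum_(sigma : {ffun 'I_n -> bool} | sigma v == c) pinned_weight st sigma.
Definition ratio st v : R := pinned_Z_at st v false / pinned_Z_at st v true.

Lemma edge_weightC a b : ew a b = ew b a.
Proof. by case: a; case: b. Qed.

Lemma pinned_edgeC st sigma u w : pinned_edge st sigma u w = pinned_edge st sigma w u.
Proof. by rewrite /pinned_edge edge_weightC; case: eqP; case: eqP. Qed.

(** Only the edges at v change. Each edge is listed with its smaller end first, so v occurs as first
    or second coordinate and its neighbours are split accordingly. *)
Lemma prod_edges_star (f f' : 'I_n -> 'I_n -> R) (c : 'I_n -> R) v :
  (forall u w, f u w = f w u) -> (forall u w, f' u w = f' w u) ->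
  (forall u w, u != v -> w != v -> f' u w = f u w) ->
  (forall w, G v w -> f' v w = c w * f v w) ->
  \prod_(e : 'I_n * 'I_n | (e.1 < e.2)%N && G e.1 e.2) f' e.1 e.2 =
  (\prod_(w | G v w) c w) *
  \prod_(e : 'I_n * 'I_n | (e.1 < e.2)%N && G e.1 e.2) f e.1 e.2.
Proof.
move=> fC f'C same star.
pose k (u w : 'I_n) : R := if u == v then c w else if w == v then c u else 1.
have kE : \prod_(e : 'I_n * 'I_n | (e.1 < e.2)%N && G e.1 e.2) f' e.1 e.2 =
  (\prod_(e : 'I_n * 'I_n | (e.1 < e.2)%N && G e.1 e.2) k e.1 e.2) *
  \prod_(e : 'I_n * 'I_n | (e.1 < e.2)%N && G e.1 e.2) f e.1 e.2.
  rewrite -big_split /=; apply: eq_bigr => -[u w] /= /andP[_ Guw]; rewrite /k.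
  have [uv|uv] := eqVneq u v; first by rewrite uv star// -uv.
  have [wv|wv] := eqVneq w v; last by rewrite mul1r same.
  by rewrite wv f'C star ?[f u v]fC// (adj_sym G) -wv.
rewrite kE; congr (_ * _).
rewrite -(pair_big_dep xpredT (fun u w : 'I_n => (u < w)%N && G u w) k) /=.
rewrite (bigD1 v)//= [RHS](bigID (fun w : 'I_n => (v < w)%N)) /=; congr (_ * _).
  rewrite (eq_bigl (fun w : 'I_n => G v w && (v < w)%N)); last by move=> w; rewrite andbC.
  by apply: eq_bigr => w _; rewrite /k eqxx.
rewrite (big_mkcond (fun i => i != v)) (big_mkcond (fun i => G v i && ~~ (v < i)%N)) /=.
apply: eq_bigr => u _; have [->|uv] := eqVneq u v; first by rewrite (adj_irr G).
have kE' w : k u w = if w == v then c u else 1 by rewrite /k (negbTE uv).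
rewrite (eq_bigr _ (fun w _ => kE' w)) -big_mkcondr /=.
have -> : ~~ (v < u)%N = (u < v)%N.
  by rewrite -leqNgt leq_eqVlt (negbTE (_ : (u : nat) != v)) //.
rewrite (adj_sym G v u); case: ifP => [/andP[Guv uv']|h].
  by rewrite (big_pred1 v)// => w /=; case: eqP => [->|]; rewrite ?uv' ?Guv ?andbF.
rewrite big_pred0// => w; apply/negP => /andP[/andP[uw Guw] /eqP wv].
by move: h; rewrite -wv uw Guw.
Qed.

(** The factor left behind by the edge to a removed neighbour when v is removed with spin c. A free
    neighbour leaves 1, since its edge survives as a pin weight. *)
Definition dead_weight st v c w : R :=
  if st w == 0%N then 1 else pin_weight (st w) v c.

Lemma set_status_eq st v t : set_status st v t v = t.
Proof. by rewrite /set_status eqxx. Qed.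

Lemma set_status_neq st (v w : 'I_n) t : w != v -> set_status st v t w = st w.
Proof. by rewrite /set_status => h; rewrite ifN. Qed.

Lemma pinned_edge_away st sigma sigma' (v u w : 'I_n) t : u != v -> w != v ->
  (forall x, x != v -> sigma' x = sigma x) ->
  pinned_edge (set_status st v t) sigma' u w = pinned_edge st sigma u w.
Proof. by move=> uv wv h; rewrite /pinned_edge !set_status_neq// !h. Qed.

Lemma pinned_weight_true st sigma v : st v = 0%N -> sigma v ->
  pinned_weight st sigma =
  (\prod_(w | G v w) dead_weight st v true w) * pinned_weight (set_status st v 2) sigma.
Proof.
move=> sv tv; rewrite /pinned_weight mulrA; congr (_ * _).
  apply: (@prod_edges_star (pinned_edge (set_status st v 2) sigma) (pinned_edge st sigma) _ v).
  - exact: pinned_edgeC.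
  - exact: pinned_edgeC.
  - by move=> u w uv wv; apply/esym/pinned_edge_away.
  - move=> w Gvw; have wv : w != v by apply: contraTneq Gvw => ->; rewrite (adj_irr G).
    rewrite /pinned_edge /dead_weight sv eqxx set_status_eq set_status_neq//= tv.
    by case: eqP => _; rewrite ?mulr1 ?mul1r// /pin_weight.
apply: eq_bigr => w _; rewrite /pinned_vertex; have [->|wv] := eqVneq w v.
  by rewrite sv set_status_eq /= tv.
by rewrite set_status_neq.
Qed.

Definition set_spin sigma v c : {ffun 'I_n -> bool} :=
  [ffun w => if w == v then c else sigma w].

Lemma pinned_weight_false st sigma v : st v = 0%N -> ~~ sigma v ->
  pinned_weight st sigma =
  lambda * (\prod_(w | G v w) dead_weight st v false w) *
    pinned_weight (set_status st v n.*2.+2) (set_spin sigma v true).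
Proof.
move=> sv tv; rewrite /pinned_weight.
have away x : x != v -> set_spin sigma v true x = sigma x by move=> xv; rewrite ffunE ifN.
rewrite (@prod_edges_star (pinned_edge (set_status st v n.*2.+2) (set_spin sigma v true))
  (pinned_edge st sigma) (dead_weight st v false) v).
- have -> : \prod_x pinned_vertex st x (sigma x) =
    lambda * \prod_x pinned_vertex (set_status st v n.*2.+2) x (set_spin sigma v true x).
    rewrite (bigD1 v)//= [X in _ = _ * X](bigD1 v)//= {1 3}/pinned_vertex sv eqxx set_status_eq /=.
    rewrite (negbTE tv) ffunE eqxx /= mul1r; congr (_ * _).
    by apply: eq_bigr => w wv; rewrite /pinned_vertex set_status_neq// away.
  by ring.
- exact: pinned_edgeC.
- exact: pinned_edgeC.
- by move=> u w uv wv; apply/esym/pinned_edge_away.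
- move=> w Gvw; have wv : w != v by apply: contraTneq Gvw => ->; rewrite (adj_irr G).
  rewrite /pinned_edge /dead_weight sv eqxx set_status_eq set_status_neq//= (negbTE tv) away//.
  case: eqP => _; rewrite ?mulr1 ?mul1r// /pin_weight ifT//.
  by have := ltn_ord w; lia.
Qed.

(** The even statuses 2, 4, ..., 2n+2 of v interpolate between all neighbours seeing spin 1 and all
    seeing spin 0, switching one vertex i at a time. The odd status 2i+3 is the midpoint at which
    the edge to i is cut, and both sides are compared with it. *)
Lemma pinned_weight_step st sigma v i : i != v -> st v = 0%N ->
  let f t := pinned_weight (set_status st v t) sigma in
  let a := G v i && (st i == 0%N) in
  f i.*2.+4 = (if a then ew false (sigma i) else 1) * f i.*2.+3 /\
  f i.*2.+2 = (if a then ew true (sigma i) else 1) * f i.*2.+3.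
Proof.
move=> iv sv f a.
have gen t b : (t != 0)%N -> (forall w c, w != i -> pin_weight t w c = pin_weight i.*2.+3 w c) ->
   (forall c, pin_weight t i c = ew b c) ->
   f t = (if a then ew b (sigma i) else 1) * f i.*2.+3.
  move=> t0 hw hi; rewrite /f /pinned_weight mulrA; congr (_ * _); last first.
    apply: eq_bigr => w _; rewrite /pinned_vertex; have [->|wv] := eqVneq w v.
      by rewrite !set_status_eq (negbTE t0).
    by rewrite !set_status_neq.
  rewrite (@prod_edges_star (pinned_edge (set_status st v i.*2.+3) sigma)
    (pinned_edge (set_status st v t) sigma)
    (fun w => if (w == i) && (st i == 0%N) then ew b (sigma i) else 1) v).
  - congr (_ * _); rewrite /a; case: (boolP (G v i)) => Gvi /=.
      rewrite (bigD1 i)//= eqxx /= big1 ?mulr1// => w /andP[_ wi].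
      by rewrite (negbTE wi).
    rewrite big1// => w Gvw; rewrite ifN// negb_and; apply/orP; left.
    by apply: contraTneq Gvw => ->.
  - exact: pinned_edgeC.
  - exact: pinned_edgeC.
  - by move=> u w uv wv; rewrite !(@pinned_edge_away st sigma sigma).
  - move=> w Gvw; have wv : w != v by apply: contraTneq Gvw => ->; rewrite (adj_irr G).
    rewrite /pinned_edge !set_status_eq !set_status_neq// (negbTE t0) /=.
    have [->|wi] := eqVneq w i; last first.
      by rewrite mul1r; case: eqP => // _; rewrite hw.
    rewrite /=; case: eqP => // _; rewrite ?mulr1// hi.
    by rewrite /pin_weight !ltnn mulr1.
split; apply: gen => //.
- move=> w c wi; have {}wi : (w : nat) != i by [].
  rewrite /pin_weight; do ![case: ifP => //]; lia.
- by move=> c; rewrite /pin_weight ltnSn.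
- move=> w c wi; have {}wi : (w : nat) != i by [].
  rewrite /pin_weight; do ![case: ifP => //]; lia.
- by move=> c; rewrite /pin_weight ifN ?ltnSn// -leqNgt.
Qed.

Hypotheses (b0 : 0 <= beta) (g0 : 0 < gamma) (l0 : 0 < lambda).

Lemma edge_weight_ge0 a b : 0 <= ew a b.
Proof. by case: a; case: b => //=; rewrite ltW. Qed.

Lemma edge_weight_true_gt0 a : 0 < ew a true.
Proof. by case: a => //=. Qed.

Lemma pin_weight_ge0 t v c : 0 <= pin_weight t v c.
Proof. by rewrite /pin_weight; do ![case: ifP => _]; rewrite ?edge_weight_ge0. Qed.

Lemma pin_weight_true_gt0 t v : 0 < pin_weight t v true.
Proof. by rewrite /pin_weight; do ![case: ifP => _]; rewrite ?edge_weight_true_gt0. Qed.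

Lemma pinned_weight_ge0 st sigma : 0 <= pinned_weight st sigma.
Proof.
rewrite mulr_ge0// prodr_ge0//.
  move=> e _; rewrite /pinned_edge; do ![case: ifP => _]; rewrite ?edge_weight_ge0 ?pin_weight_ge0//.
move=> v _; rewrite /pinned_vertex /vertex_weight; case: ifP => _; case: (sigma v) => //.
exact: ltW.
Qed.

Lemma pinned_weight_true_gt0 st : 0 < pinned_weight st [ffun=> true].
Proof.
rewrite mulr_gt0// prodr_gt0//.
  move=> e _; rewrite /pinned_edge !ffunE.
  by do ![case: ifP => _]; rewrite ?edge_weight_true_gt0 ?pin_weight_true_gt0.
by move=> v _; rewrite /pinned_vertex /vertex_weight ffunE; case: ifP.
Qed.

Lemma pinned_Z_gt0 st : 0 < pinned_Z st.
Proof.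
rewrite /pinned_Z (bigD1 [ffun=> true])//= ltr_pwDl ?pinned_weight_true_gt0//.
by apply: sumr_ge0 => s _; apply: pinned_weight_ge0.
Qed.

Lemma pinned_Z_at_gt0 st v : 0 < pinned_Z_at st v true.
Proof.
rewrite /pinned_Z_at (bigD1 [ffun=> true])//=; last by rewrite ffunE.
rewrite ltr_pwDl ?pinned_weight_true_gt0//.
by apply: sumr_ge0 => s _; apply: pinned_weight_ge0.
Qed.

Lemma pinned_Z_at_ge0 st v c : 0 <= pinned_Z_at st v c.
Proof. by apply: sumr_ge0 => s _; apply: pinned_weight_ge0. Qed.

Lemma ratio_ge0 st v : 0 <= ratio st v.
Proof. by rewrite divr_ge0// pinned_Z_at_ge0. Qed.

Lemma pinned_Z_split st v : pinned_Z st = pinned_Z_at st v false + pinned_Z_at st v true.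
Proof.
rewrite /pinned_Z (bigID (fun s : {ffun 'I_n -> bool} => s v == false)) /=; congr (_ + _).
by apply: eq_bigl => s; case: (s v).
Qed.

Lemma pinned_weight_dead st sigma v : st v != 0%N -> ~~ sigma v -> pinned_weight st sigma = 0.
Proof.
move=> sv tv; rewrite /pinned_weight [X in _ * X](bigD1 v)//= /pinned_vertex (negbTE sv) (negbTE tv).
by rewrite mul0r mulr0.
Qed.

Lemma pinned_Z_at_dead st v : st v != 0%N -> pinned_Z_at st v false = 0.
Proof.
by move=> sv; apply: big1 => s /eqP sF; apply: (@pinned_weight_dead _ _ v); rewrite ?sF.
Qed.

Lemma pinned_Z_at_trueE st v : st v = 0%N ->
  pinned_Z_at st v true =
  (\prod_(w | G v w) dead_weight st v true w) * pinned_Z (set_status st v 2).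
Proof.
move=> sv; rewrite (pinned_Z_split _ v) [X in _ * (X + _)]pinned_Z_at_dead ?set_status_eq// add0r.
rewrite /pinned_Z_at mulr_sumr; apply: eq_bigr => s /eqP sT.
by apply: pinned_weight_true.
Qed.

Lemma pinned_Z_at_falseE st v : st v = 0%N ->
  pinned_Z_at st v false =
  lambda * (\prod_(w | G v w) dead_weight st v false w) * pinned_Z (set_status st v n.*2.+2).
Proof.
move=> sv; rewrite (pinned_Z_split _ v) [X in _ * (X + _)]pinned_Z_at_dead ?set_status_eq// add0r.
rewrite /pinned_Z_at mulr_sumr.
rewrite (reindex_onto (fun s => set_spin s v false) (fun s => set_spin s v true)) /=; last first.
  move=> s /eqP sF; apply/ffunP => w; rewrite !ffunE; by case: eqP => // ->.
apply: eq_big => s.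
  rewrite ffunE !eqxx /=; apply/eqP/eqP => [<-|sT]; first by rewrite ffunE eqxx.
  by apply/ffunP => w; rewrite !ffunE; case: eqP => // ->.
move=> /andP[_ /eqP e]; rewrite (pinned_weight_false sv) ?ffunE ?eqxx//.
by rewrite e.
Qed.

Definition pinned_message st v u : R :=
  if st u == 0%N then message beta gamma (ratio (set_status st v u.*2.+3) u)
  else pin_message (st u) v.

Lemma pinned_Z_step st v i : st v = 0%N ->
  pinned_Z (set_status st v i.*2.+4) =
  (if G v i && (st i == 0%N) then message beta gamma (ratio (set_status st v i.*2.+3) i) else 1) *
  pinned_Z (set_status st v i.*2.+2).
Proof.
(* A vertex is not its own neighbour: for i = v the statuses 2v+2 and 2v+4 act alike on all other
   vertices. *)
move=> sv; have [iv|iv] := eqVneq i v.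
  rewrite iv (adj_irr G) /= mul1r; apply: eq_bigr => s _; rewrite /pinned_weight; congr (_ * _).
    apply: eq_bigr => -[u w] /= /andP[uw Guw]; rewrite /pinned_edge /set_status.
    case: (eqVneq (u : nat) v) => [uv|uv]; case: (eqVneq (w : nat) v) => [wv|wv] //=.
    - case: eqP => // _; rewrite /pin_weight.
      have {}wv : (w : nat) != v by []. by do ![case: ifP => //]; lia.
    - case: eqP => // _; rewrite /pin_weight.
      by do ![case: ifP => //]; lia.
  apply: eq_bigr => w _; rewrite /pinned_vertex /set_status.
  by case: (w == v :> nat).
have step s := @pinned_weight_step st s v i iv sv.
case: ifP => h; last first.
  rewrite mul1r; apply: eq_bigr => s _; have [-> ->] := step s.
  by rewrite h.
set st' := set_status st v i.*2.+3.
have E b t : (forall s, pinned_weight (set_status st v t) s = ew b (s i) * pinned_weight st' s) ->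
  pinned_Z (set_status st v t) = ew b false * pinned_Z_at st' i false + ew b true * pinned_Z_at st' i true.
  move=> hs; rewrite (pinned_Z_split _ i) /pinned_Z_at !mulr_sumr.
  by congr (_ + _); apply: eq_bigr => s /eqP <-.
rewrite (E false) => [|s]; last by have [-> _] := step s; rewrite h.
rewrite (E true) => [|s]; last by have [_ ->] := step s; rewrite h.
rewrite /message /ratio /=.
have := pinned_Z_at_gt0 st' i; have := pinned_Z_at_ge0 st' i false.
move: (pinned_Z_at _ _ _) (pinned_Z_at _ _ _) => A B A0 B0.
have nz : B + gamma * A != 0 by rewrite lt0r_neq0// ltr_wpDl// mulr_gt0.
have nA : A != 0 by rewrite lt0r_neq0.
have -> : B / A + gamma = (B + gamma * A) / A by field.
by field; rewrite nz nA.
Qed.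

(** The quotient of the partition functions for statuses 2n+2 and 2 telescopes over the neighbours,
    each free one contributing the message of its own ratio at the midpoint status. Removed
    neighbours enter through [dead_weight]. *)
Lemma ratio_recursion st v : st v = 0%N ->
  ratio st v = lambda * \prod_(u | G v u) pinned_message st v u.
Proof.
move=> sv; rewrite /ratio pinned_Z_at_trueE// pinned_Z_at_falseE//.
pose m (i : 'I_n) := if G v i && (st i == 0%N) then message beta gamma (ratio (set_status st v i.*2.+3) i) else 1.
have tele k : (k <= n)%N -> pinned_Z (set_status st v k.*2.+2) =
    (\prod_(i < n | (i < k)%N) m i) * pinned_Z (set_status st v 2).
  elim: k => [|k IH] kn; first by rewrite big_pred0 ?mul1r.
  rewrite doubleS (@pinned_Z_step st v (Ordinal kn) sv) /= IH 1?ltnW// mulrA; congr (_ * _).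
  rewrite [RHS](bigD1 (Ordinal kn))//=; congr (_ * _).
  apply: eq_bigl => i; rewrite ltnS -(inj_eq val_inj) /=.
  by case: ltngtP.
rewrite tele//; have Z0 := pinned_Z_gt0 (set_status st v 2).
have -> : \prod_(i < n | (i < n)%N) m i = \prod_(i | G v i) (if st i == 0%N then message beta gamma (ratio (set_status st v i.*2.+3) i) else 1).
  rewrite [LHS]big_mkcond [RHS]big_mkcond; apply: eq_bigr => i _.
  by rewrite ltn_ord /m; case: (G v i).
rewrite (_ : \prod_(u | G v u) pinned_message st v u =
  (\prod_(i | G v i) (if st i == 0%N then message beta gamma (ratio (set_status st v i.*2.+3) i) else 1)) *
  ((\prod_(w | G v w) dead_weight st v false w) / \prod_(w | G v w) dead_weight st v true w)).
  have D0 : \prod_(w | G v w) dead_weight st v true w != 0.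
    apply/prodf_neq0 => w _; rewrite /dead_weight; case: ifP => _; rewrite ?oner_eq0//.
    by rewrite gt_eqF// pin_weight_true_gt0.
  by field; rewrite D0 gt_eqF.
rewrite -prodf_div -big_split /=; apply: eq_bigr => w _.
rewrite /pinned_message /dead_weight; case: ifP => _; first by rewrite divr1 mulr1.
rewrite mul1r /pin_message /pin_weight; do ![case: ifP => _] => /=; by rewrite ?divr1 ?div1r.
Qed.

(* Since 2 < 2v+3, the first k vertices are pinned to spin 1. *)
Definition root_status (k : nat) : nat -> nat := fun w : nat => if (w < k)%N then 2%N else 0%N.

Lemma eq_pinned_Z st st' : (forall v, st v = st' v) -> pinned_Z st = pinned_Z st'.
Proof.
move=> e; apply: eq_bigr => s _; rewrite /pinned_weight; congr (_ * _).
  by apply: eq_bigr => x _; rewrite /pinned_edge !e.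
by apply: eq_bigr => x _; rewrite /pinned_vertex !e.
Qed.

Lemma partition_function_telescope :
  partition_function beta gamma lambda G =
  \prod_(k < n) (gamma ^+ #|[pred w : 'I_n | G k w && (w < k)%N]| * (1 + ratio (root_status k) k)).
Proof.
have tele k : (k <= n)%N -> pinned_Z (root_status 0) =
   (\prod_(i < n | (i < k)%N) (gamma ^+ #|[pred w : 'I_n | G i w && (w < i)%N]| * (1 + ratio (root_status i) i))) *
   pinned_Z (root_status k).
  elim: k => [|k IH] kn; first by rewrite big_pred0 ?mul1r.
  rewrite (IH (ltnW kn)) [in RHS](bigD1 (Ordinal kn))//=.
  set P := \prod_(i < n | _) _; set P' := \prod_(i < n | _) _.
  have -> : P' = P.
    apply: eq_bigl => i; rewrite ltnS -(inj_eq val_inj) /=.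
    by case: ltngtP.
  set o := Ordinal kn.
  have so : root_status k o = 0%N by rewrite /root_status ltnn.
  have Z1 := pinned_Z_at_gt0 (root_status k) o.
  have -> : pinned_Z (root_status k) = (1 + ratio (root_status k) o) * pinned_Z_at (root_status k) o true.
    by rewrite (pinned_Z_split _ o) /ratio; field; rewrite gt_eqF.
  rewrite pinned_Z_at_trueE//.
  have -> : pinned_Z (set_status (root_status k) o 2) = pinned_Z (root_status k.+1).
    apply: eq_pinned_Z => w; rewrite /set_status /root_status ltnS /=.
    by case: ltngtP.
  have -> : \prod_(w | G o w) dead_weight (root_status k) o true w = gamma ^+ #|[pred w : 'I_n | G o w && (w < o)%N]|.
    rewrite -prodr_const [RHS]big_mkcond /= [LHS]big_mkcond; apply: eq_bigr => w _.
    rewrite inE /dead_weight /root_status; case: (G o w) => //=.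
    by case: (w < k)%N.
  by ring.
have -> : partition_function beta gamma lambda G = pinned_Z (root_status 0).
  by apply: eq_bigr => s _.
have Zn : pinned_Z (root_status n) = 1.
  rewrite /pinned_Z (bigD1 [ffun=> true])//= [X in _ + X]big1 ?addr0; last first.
    move=> s sn; have [v sv] : exists v, ~~ s v.
      apply/existsP; rewrite -negb_forall; apply: contraNN sn => /forallP h.
      by apply/eqP/ffunP => x; rewrite ffunE h.
    by apply: (@pinned_weight_dead _ _ v) => //; rewrite /root_status ltn_ord.
  rewrite /pinned_weight [X in X * _]big1 ?mul1r; last first.
    by move=> e _; rewrite /pinned_edge /root_status !ltn_ord.
  apply: big1 => i _.
  by rewrite /pinned_vertex /root_status ltn_ord ffunE.
rewrite (tele n (leqnn n)) Zn mulr1 [LHS]big_mkcond; apply: eq_bigr => i _.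
by rewrite ltn_ord.
Qed.

End Recursion.

(** * Correlation decay *)

Section Paths.
Context {R : realType}.
Variables beta gamma lambda : R.
Hypothesis af : antiferromagnetic beta gamma lambda.
Variable wmax : R.
Implicit Types (e x y w t : R).

Let b0 : 0 <= beta. Proof. by case: af. Qed.
Let g0 : 0 < gamma. Proof. by case: af. Qed.
Let bg1 : 0 < 1 - beta * gamma. Proof. by case: af; lra. Qed.

Definition speed (w : R) : R := Num.sqrt ((beta * w ^+ 2 + 1) * (w ^+ 2 + gamma)).

(* [close e x y]: in the coordinate w = sqrt x, x and y are joined by a path of length at most e for
   the metric dw / speed w.  Lengths contract under the tree recursion, and no primitive of
   1 / speed (an elliptic integral) is needed. *)
Definition close (e x y : R) : Prop := exists w w' : R -> R,
  [/\ w 0 ^+ 2 = x, w 1 ^+ 2 = y &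
   forall t : R, 0 <= t <= 1 ->
     [/\ is_derive t 1 w (w' t), 0 <= w t <= wmax & `|w' t| <= e * speed (w t)]].

Lemma quad_gt0 (w : R) : 0 < (beta * w ^+ 2 + 1) * (w ^+ 2 + gamma).
Proof. by rewrite mulr_gt0 ?(betaD1_gt0 af) ?(Dgamma_gt0 af) ?sqr_ge0. Qed.

Lemma speed_gt0 w : 0 < speed w.
Proof. by rewrite sqrtr_gt0 quad_gt0. Qed.

Lemma sqr_speed w : speed w ^+ 2 = (beta * w ^+ 2 + 1) * (w ^+ 2 + gamma).
Proof. by rewrite sqr_sqrtr// ltW// quad_gt0. Qed.

Lemma ler_speed w w' : 0 <= w -> w <= w' -> speed w <= speed w'.
Proof.
move=> w0 ww; apply: ler_wsqrtr.
have h : w ^+ 2 <= w' ^+ 2 by rewrite lerXn2r ?nnegrE// (le_trans w0).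
have := sqr_ge0 w; have := mulr_ge0 b0 (sqr_ge0 w); have := ler_wpM2l b0 h => h1 h2 h3.
by rewrite ler_pM//; have := g0; lra.
Qed.

Lemma close_le e e' x y : e <= e' -> close e x y -> close e' x y.
Proof.
move=> ee [w [w' [h0 h1 h]]]; exists w, w'; split=> // t t01.
have [d r s] := h t t01; split=> //; apply: le_trans s _.
by rewrite ler_wpM2r// ltW// speed_gt0.
Qed.

(** The straight segment from 0 to sqrt y is used, along which [speed] is at least sqrt gamma. This
    pays for cutting the recursion. *)
Lemma close_zero e y : 0 <= y -> y <= wmax ^+ 2 -> 0 <= wmax ->
  wmax <= e * Num.sqrt gamma -> close e 0 y.
Proof.
move=> y0 yw w0 we; have sy : Num.sqrt y <= wmax.
  by rewrite -(ger0_norm w0) -[X in _ <= X]sqrtr_sqr ler_wsqrtr.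
have e0 : 0 <= e by rewrite -(@pmulr_lge0 _ (Num.sqrt gamma)) ?sqrtr_gt0//; apply: le_trans we.
exists (fun t => t * Num.sqrt y), (fun=> Num.sqrt y); split.
- by rewrite mul0r expr0n.
- by rewrite mul1r sqr_sqrtr.
move=> t /andP[t0 t1]; split.
- apply: (is_derive_eq (is_derive_mul (is_derive_id t 1) (is_derive_const t (Num.sqrt y)))).
  by rewrite /=; ring.
- rewrite mulr_ge0 ?sqrtr_ge0//=; apply: le_trans sy.
  by rewrite ler_piMl ?sqrtr_ge0.
- rewrite ger0_norm ?sqrtr_ge0//; apply: le_trans sy _; apply: le_trans we _.
  rewrite ler_wpM2l// ler_wsqrtr//.
  rewrite -[X in X <= _]mul1r; have := sqr_ge0 (t * Num.sqrt y) => h.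
  by rewrite ler_pM// ?(ltW g0)//; have := mulr_ge0 b0 h; lra.
Qed.

(** By the mean value theorem, and x - y factors as the difference of the end points of the path
    times their sum. *)
Lemma close_dist e x y : 0 <= wmax -> close e x y ->
  `|x - y| <= 2 * wmax * (e * speed wmax).
Proof.
move=> wm0 [w [w' [<- <- h]]].
have in0 : 0 <= (0 : R) <= 1 by rewrite lexx ler01.
have in1 : 0 <= (1 : R) <= 1 by rewrite lexx ler01.
have e0 : 0 <= e.
  have [_ _ s] := h 0 in0.
  by rewrite -(@pmulr_lge0 _ (speed (w 0))) ?speed_gt0//; apply: le_trans s.
have [c c01 E] : exists2 c : R, 0 <= c <= 1 & w 1 - w 0 = w' c.
  have cont : {within `[0, 1], continuous w}.
    apply: derivable_within_continuous => z; rewrite in_itv /= => z01.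
    by have [d _ _] := h z z01; apply: (@ex_derive _ _ _ _ _ _ _ d).
  have [|c] := @MVT R w w' 0 1 ltr01 _ cont.
    by move=> z; rewrite in_itv /= => /andP[z0 z1]; have [] := h z; rewrite ?(ltW z0) ?(ltW z1).
  rewrite in_itv /= => /andP[c0' c1'] ->; exists c; first by rewrite (ltW c0') (ltW c1').
  by rewrite subr0 mulr1.
have [_ /andP[wc wcm] s] := h c c01.
have [_ /andP[p0 h0] _] := h 0 in0; have [_ /andP[p1 h1] _] := h 1 in1.
rewrite distrC subr_sqr E mulrC normrM ler_pM//.
  by rewrite ger0_norm ?addr_ge0//; lra.
apply: le_trans s _; by rewrite ler_wpM2l// ler_speed.
Qed.

(** The exponential form displays the logarithmic derivative, which is what products of messages add
    up. *)
Definition sqrt_message (w : R) : R :=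
  expR ((ln (beta * w ^+ 2 + 1) - ln (w ^+ 2 + gamma)) / 2).

Lemma sqr_sqrt_message w : sqrt_message w ^+ 2 = message beta gamma (w ^+ 2).
Proof.
have p1 := betaD1_gt0 af (sqr_ge0 w); have p2 := Dgamma_gt0 af (sqr_ge0 w).
rewrite /sqrt_message -expRM_natl mulrC divfK ?pnatr_eq0// expRD expRN !lnK// posrE//.
Qed.

Lemma is_derive_sqrt_message (w : R -> R) t (a : R) : is_derive t 1 w a ->
  is_derive t 1 (fun s => sqrt_message (w s))
    (sqrt_message (w t) * (- ((1 - beta * gamma) * w t * a / speed (w t) ^+ 2))).
Proof.
move=> dw; have p1 := betaD1_gt0 af (sqr_ge0 (w t)); have p2 := Dgamma_gt0 af (sqr_ge0 (w t)).
have d2 := is_derive_pow 2 dw.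
have d3 := is_derive_add (is_derive_mul (is_derive_const t beta) d2) (is_derive_const t 1).
have d4 := is_derive_add d2 (is_derive_const t gamma).
have d5 := is_derive_sub (is_derive_comp (g := fun s => beta * w s ^+ 2 + 1) (is_derive1_ln p1) d3)
  (is_derive_comp (g := fun s => w s ^+ 2 + gamma) (is_derive1_ln p2) d4).
have d6 := is_derive_mul d5 (is_derive_const t 2^-1).
apply: (is_derive_eq (is_derive_comp (is_derive_expR _) d6)).
rewrite sqr_speed /sqrt_message; congr (_ * _); rewrite /= expr1.
by field; rewrite (gt_eqF p1) (gt_eqF p2).
Qed.

Lemma is_derive_prod_seq (I : Type) (r : seq I) (f : I -> R -> R) (l : I -> R) t :
  (forall i, is_derive t 1 (f i) (f i t * l i)) ->
  is_derive t 1 (fun s => \prod_(i <- r) f i s) ((\prod_(i <- r) f i t) * \sum_(i <- r) l i).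
Proof.
move=> df; elim: r => [|i r IH].
  under [X in is_derive _ _ X _]eq_fun do rewrite big_nil.
  by rewrite !big_nil mulr0; exact: is_derive_const.
under [X in is_derive _ _ X _]eq_fun do rewrite big_cons.
rewrite !big_cons; apply: (is_derive_eq (is_derive_mul (df i) IH)).
by ring.
Qed.

(** Identifies dw / speed w, up to a constant, with sqrt(response) d log w. *)
Lemma response_sqr w : 0 <= w ->
  Num.sqrt (response beta gamma (w ^+ 2)) = Num.sqrt (1 - beta * gamma) * (w / speed w).
Proof.
move=> w0; rewrite /response -sqr_speed.
have s0 := speed_gt0 w.
have -> : (1 - beta * gamma) * w ^+ 2 / speed w ^+ 2 = (1 - beta * gamma) * (w / speed w) ^+ 2.
  by field; rewrite gt_eqF.
by rewrite sqrtrM ?(ltW bg1)// sqrtr_sqr ger0_norm// divr_ge0// ltW.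
Qed.

(** The paths of the arguments are pushed through the node map. Child i moves the logarithm of W by
    at most sqrt(1 - beta gamma) sqrt(response z_i) e, and the factor W / speed W that converts this
    back into length supplies the remaining sqrt(response F). *)
Lemma close_node (I : finType) (A : {pred I}) (c e theta : R) (x y : I -> R) :
  0 <= c -> 0 <= e ->
  (forall i, i \in A -> close e (x i) (y i)) ->
  (forall z : I -> R, (forall i, i \in A -> 0 <= z i) ->
     let F := c * \prod_(i in A) message beta gamma (z i) in
     F <= wmax ^+ 2 /\
     Num.sqrt (response beta gamma F) *
       \sum_(i in A) Num.sqrt (response beta gamma (z i)) <= theta) ->
  0 <= wmax ->
  close (theta * e) (c * \prod_(i in A) message beta gamma (x i))
                    (c * \prod_(i in A) message beta gamma (y i)).
Proof.
move=> c0 e0 xy st wm0.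
have /choice[p pP] : forall i, exists q : (R -> R) * (R -> R), i \in A ->
   [/\ q.1 0 ^+ 2 = x i, q.1 1 ^+ 2 = y i &
    forall t : R, 0 <= t <= 1 ->
     [/\ is_derive t 1 q.1 (q.2 t), 0 <= q.1 t <= wmax & `|q.2 t| <= e * speed (q.1 t)]].
  move=> i.
  case: (boolP (i \in A)) => iA; last by exists (idfun, idfun).
  by have [w [w' h]] := xy i iA; exists (w, w').
pose f i s := if i \in A then sqrt_message ((p i).1 s) else 1.
pose l i t := if i \in A then - ((1 - beta * gamma) * (p i).1 t * (p i).2 t / speed ((p i).1 t) ^+ 2) else 0.
pose W s := Num.sqrt c * \prod_(i <- enum A) f i s.
have W2 s : W s ^+ 2 = c * \prod_(i in A) message beta gamma ((p i).1 s ^+ 2).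
  rewrite /W exprMn sqr_sqrtr// -prodrXl big_enum /=; congr (_ * _).
  by apply: eq_bigr => i iA; rewrite /f iA sqr_sqrt_message.
have W0 s : 0 <= W s.
  rewrite mulr_ge0 ?sqrtr_ge0// prodr_ge0// => i _; rewrite /f; case: ifP => // _.
  exact: expR_ge0.
exists W, (fun t => W t * \sum_(i <- enum A) l i t); split.
- by rewrite W2; congr (_ * _); apply: eq_bigr => i iA; have [-> _ _] := pP i iA.
- by rewrite W2; congr (_ * _); apply: eq_bigr => i iA; have [_ -> _] := pP i iA.
move=> t t01.
have dW : is_derive t 1 W (W t * \sum_(i <- enum A) l i t).
  have df i : is_derive t 1 (f i) (f i t * l i t).
    rewrite /f /l; case: (boolP (i \in A)) => iA; last by rewrite mulr0; exact: is_derive_const.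
    by have [_ _ /(_ t t01) [d _ _]] := pP i iA; apply: is_derive_sqrt_message.
  apply: (is_derive_eq (is_derive_mul (is_derive_const t (Num.sqrt c)) (is_derive_prod_seq (enum A) df))).
  by rewrite /W; ring.
have [F1 F2] := st (fun i => (p i).1 t ^+ 2) (fun i _ => sqr_ge0 _).
rewrite -W2 in F1 F2.
split=> //.
  rewrite W0 /=; rewrite -(ger0_norm wm0) -(ger0_norm (W0 t)).
  by rewrite -!sqrtr_sqr ler_wsqrtr.
rewrite normrM ger0_norm//.
have lb i : i \in A -> `|l i t| <= Num.sqrt (1 - beta * gamma) * Num.sqrt (response beta gamma ((p i).1 t ^+ 2)) * e.
  move=> iA; have [_ _ /(_ t t01) [_ /andP[w0 _] s]] := pP i iA.
  have s0 := speed_gt0 ((p i).1 t).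
  rewrite /l iA normrN response_sqr// mulrA -expr2 sqr_sqrtr ?(ltW bg1)//.
  rewrite normrM normfV [X in _ / X]ger0_norm ?sqr_ge0// normrM (ger0_norm (mulr_ge0 (ltW bg1) w0)).
  rewrite ler_pdivrMr ?exprn_gt0//.
  have -> : (1 - beta * gamma) * ((p i).1 t / speed ((p i).1 t)) * e * speed ((p i).1 t) ^+ 2 =
     (1 - beta * gamma) * (p i).1 t * (e * speed ((p i).1 t)) by field; rewrite gt_eqF.
  by rewrite ler_wpM2l// mulr_ge0// ltW.
have sl : `|\sum_(i <- enum A) l i t| <=
    Num.sqrt (1 - beta * gamma) * (\sum_(i in A) Num.sqrt (response beta gamma ((p i).1 t ^+ 2))) * e.
  apply: le_trans (ler_norm_sum _ _ _) _; rewrite big_enum /= mulr_sumr mulr_suml.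
  by apply: ler_sum => i iA; apply: lb.
apply: le_trans (ler_wpM2l (W0 t) sl) _.
have sW := speed_gt0 (W t).
rewrite response_sqr// in F2; set S := \sum_(i in A) _ in F2 *.
have -> : W t * (Num.sqrt (1 - beta * gamma) * S * e) =
  Num.sqrt (1 - beta * gamma) * (W t / speed (W t)) * S * e * speed (W t).
  by field; rewrite gt_eqF.
by rewrite ler_wpM2r ?(ltW sW)// ler_wpM2r.
Qed.

End Paths.

Section Truncation.
Context {R : realType}.
Variables (beta gamma lambda : R) (n : nat) (G : sgraph n).

(* The recursion [ratio_recursion], cut off when the budget [B] is exhausted; a vertex splits its
   budget evenly by its degree.  [k] is recursion fuel and never runs out when [B < k]. *)
Fixpoint approx (k B : nat) (st : nat -> nat) (v : 'I_n) : R :=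
  lambda * \prod_(u | G v u)
    (if st u == 0%N then
       message beta gamma
         (if k is k'.+1 then
            if (B %/ degree G v == 0)%N then 0
            else approx k' (B %/ degree G v)%N (set_status st v u.*2.+3) u
          else 0)
     else pin_message beta gamma (st u) v).

End Truncation.

Section Decay.
Context {R : realType}.
Variables beta gamma lambda : R.
Hypothesis af : antiferromagnetic beta gamma lambda.
Variable Delta : degree_bound.
Variables kappa wmax : R.
Hypothesis kappa0 : 0 < kappa.
Hypothesis contr : forall d, (0 < d)%N -> ltn_degree_bound d Delta ->
    forall m : R, beta <= m -> m <= gamma^-1 ->
      d%:R ^+ 2 * gain beta gamma lambda d m <= (d.+1%:R `^ (- kappa)) ^+ 2.
Hypothesis wmax0 : 0 <= wmax.
Hypothesis wmaxP : forall d, leq_degree_bound d Delta -> lambda * gamma^-1 ^+ d <= wmax ^+ 2.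
Variables (n : nat) (G : sgraph n).
Hypothesis hdeg : max_degree_le Delta G.
Implicit Types (st : nat -> nat) (u v w p : 'I_n).

Let b0 : 0 <= beta. Proof. by case: af. Qed.
Let g0 : 0 < gamma. Proof. by case: af. Qed.
Let l0 : 0 < lambda. Proof. by case: af. Qed.

Lemma pin_message_range t (v : nat) : t != v.*2.+3 -> beta <= pin_message beta gamma t v <= gamma^-1.
Proof.
move=> tv; rewrite /pin_message; case: ltngtP tv => // _ _.
  by rewrite lexx (beta_le_Vgamma af).
by rewrite (beta_le_Vgamma af) lexx.
Qed.

Definition free_nbrs st v : {pred 'I_n} := [pred u | G v u && (st u == 0%N)].
(** Removed neighbours are absorbed into a constant, giving the recursion the shape required by
    [close_node]. *)
Definition dead_const st v : R :=
  lambda * \prod_(u | G v u && (st u != 0%N)) pin_message beta gamma (st u) v.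
Definition node_message st v (z : 'I_n -> R) u : R :=
  if st u == 0%N then message beta gamma (z u) else pin_message beta gamma (st u) v.

Lemma dead_constE st v (z : 'I_n -> R) :
  dead_const st v * \prod_(u in free_nbrs st v) message beta gamma (z u) =
  lambda * \prod_(u | G v u) node_message st v z u.
Proof.
rewrite /dead_const -mulrA; congr (_ * _).
rewrite [RHS](bigID (fun u => st u != 0%N)) /=; congr (_ * _).
  by apply: eq_bigr => u /andP[_ h]; rewrite /node_message (negbTE h).
by apply: eq_big => [u|u /andP[_ h]]; rewrite ?inE ?negbK// /node_message h.
Qed.

Lemma pin_message_ge0 t (v : nat) : 0 <= pin_message beta gamma t v.
Proof. by rewrite /pin_message; do ![case: ifP => _] => //; rewrite invr_ge0 ltW. Qed.

Lemma dead_const_ge0 st v : 0 <= dead_const st v.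
Proof. by rewrite mulr_ge0 ?(ltW l0)// prodr_ge0// => u _; apply: pin_message_ge0. Qed.

Lemma prod_message_le (A : {pred 'I_n}) (mu : 'I_n -> R) : leq_degree_bound #|A| Delta ->
  (forall u, u \in A -> 0 <= mu u <= gamma^-1) -> lambda * \prod_(u in A) mu u <= wmax ^+ 2.
Proof.
move=> dA h; apply: le_trans (wmaxP dA); rewrite ler_pM2l// -prodr_const.
by apply: ler_prod.
Qed.

(** Status 2v+3 gives the pin message 1, which may lie outside the interval from beta to 1/gamma.
    The predecessor on the walk is the only vertex having it, so all other messages stay in
    range. *)
Definition has_parent st v p : Prop :=
  [/\ G v p, st p = v.*2.+3 & forall w, w != p -> st w != v.*2.+3].

Lemma node_message_range st v p (z : 'I_n -> R) u : has_parent st v p -> u != p ->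
  (u \in free_nbrs st v -> 0 <= z u) -> G v u -> beta <= node_message st v z u <= gamma^-1.
Proof.
move=> [_ _ h] up z0 Gvu; rewrite /node_message; case: eqP => su; last exact: pin_message_range (h u up).
have {}z0 : 0 <= z u by apply: z0; rewrite inE Gvu su eqxx.
by rewrite (message_ge af z0) (message_le af z0).
Qed.

Lemma leq_degree_boundW d d' : (d <= d')%N -> leq_degree_bound d' Delta -> leq_degree_bound d Delta.
Proof. by case: Delta => //= D h h'; apply: leq_trans h h'. Qed.

(** Apart from the parent there are degree - 1 neighbours, a number below [Delta]. Removed ones are
    kept as ordinary messages, so the contraction is applied with d + 1 equal to the degree of v;
    dropping their terms only lowers the sum. *)
Lemma node_contraction st v p (z : 'I_n -> R) : has_parent st v p ->
  (forall u, u \in free_nbrs st v -> 0 <= z u) ->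
  let F := dead_const st v * \prod_(u in free_nbrs st v) message beta gamma (z u) in
  F <= wmax ^+ 2 /\
  Num.sqrt (response beta gamma F) *
    \sum_(u in free_nbrs st v) Num.sqrt (response beta gamma (z u)) <= (degree G v)%:R `^ (- kappa).
Proof.
move=> hp z0 F; have [Gvp sp _] := hp.
pose U : {pred 'I_n} := [pred u | G v u && (u != p)].
have degE : degree G v = #|U|.+1.
  rewrite /degree (cardD1 p) inE /= Gvp add1n; congr _.+1; apply: eq_card => u.
  by rewrite !inE andbC.
have FE : F = lambda * \prod_(u in U) node_message st v z u.
  rewrite /F dead_constE (bigD1 p)//= {1}/node_message sp /= /pin_message ltnn mul1r; congr (_ * _).
have mr u : u \in U -> beta <= node_message st v z u <= gamma^-1.
  by rewrite inE => /andP[Gvu up]; apply: node_message_range hp up _ Gvu; apply: z0.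
split.
  rewrite FE; apply: prod_message_le => [|u uU].
    by apply: (leq_degree_boundW _ (hdeg v)); rewrite degE.
  by have /andP[h ->] := mr u uU; rewrite andbT (le_trans b0).
(* A vertex without free neighbours may be a leaf, where the contraction hypothesis would need d =
   0; its sum is empty. *)
have [A0|/pred0Pn[a aA]] := eqVneq #|free_nbrs st v| 0%N.
  rewrite big_pred0 ?mulr0 ?powR_ge0//; exact: (card0_eq A0).
have aU : a \in U.
  move: aA; rewrite !inE => /andP[-> sa] /=; apply: contraTneq sa => ->.
  by rewrite sp.
have U0 : (0 < #|U|)%N by apply/card_gt0P; exists a.
have ltU : ltn_degree_bound #|U| Delta.
  by have := hdeg v; rewrite degE; case: (Delta).
have S0 : 0 <= (#|U|.+1%:R `^ (- kappa)) ^+ 2 :> R by rewrite sqr_ge0.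
have := sum_response_le af U0 S0 mr (contr U0 ltU).
rewrite -FE -degE => main.
have F0 : 0 <= F.
  rewrite mulr_ge0 ?dead_const_ge0// prodr_ge0// => u uA.
  by rewrite ltW// (message_gt0 af)// z0.
set S := \sum_(u in U) _ in main.
have le_sum : \sum_(u in free_nbrs st v) Num.sqrt (response beta gamma (z u)) <= S.
  rewrite /S [X in _ <= X](bigID (fun u => st u == 0%N)) /=.
  rewrite -[X in X <= _]addr0 lerD//; last by apply: sumr_ge0 => u _; apply: sqrtr_ge0.
  rewrite le_eqVlt; apply/orP; left; apply/eqP; apply: eq_big => u.
    rewrite !inE; case: (boolP (st u == 0%N)) => su; rewrite ?andbF// !andbT.
    rewrite andb_idr// => _; apply: contraTneq su => ->; by rewrite sp.
  move=> uA; rewrite /node_message; move: (uA); rewrite inE => /andP[_ ->].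
  by rewrite (response_messageE af)// z0.
apply: le_trans (ler_wpM2l (sqrtr_ge0 _) le_sum) _.
rewrite -(@ler_pXn2r _ 2)// ?nnegrE ?powR_ge0// ?mulr_ge0 ?sqrtr_ge0 ?sumr_ge0//.
  by rewrite exprMn sqr_sqrtr// (response_ge0 af).
Qed.

(** Without a parent, the number of neighbours may equal [Delta], which uniqueness does not cover.
    Responses are at most 1, so n is a safe factor. *)
Lemma root_contraction st v (z : 'I_n -> R) :
  (forall w, st w != 0%N -> (st w < v.*2.+3)%N) ->
  (forall u, u \in free_nbrs st v -> 0 <= z u) ->
  let F := dead_const st v * \prod_(u in free_nbrs st v) message beta gamma (z u) in
  F <= wmax ^+ 2 /\
  Num.sqrt (response beta gamma F) *
    \sum_(u in free_nbrs st v) Num.sqrt (response beta gamma (z u)) <= n%:R.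
Proof.
move=> hst z0 F.
have F0 : 0 <= F.
  rewrite mulr_ge0 ?dead_const_ge0// prodr_ge0// => u uA.
  by rewrite ltW// (message_gt0 af)// z0.
split.
  rewrite /F dead_constE; apply: (@prod_message_le [pred u | G v u]); first exact: hdeg.
  move=> u; rewrite inE => Gvu; rewrite /node_message; case: eqP => su.
    have {}z0 : 0 <= z u by apply: z0; rewrite inE Gvu su eqxx.
    by rewrite (message_le af z0) andbT ltW// (message_gt0 af).
  have /eqP su' := su; have lt := hst u su'.
  have /andP[h ->] : beta <= pin_message beta gamma (st u) v <= gamma^-1.
    by apply: pin_message_range; rewrite ltn_eqF.
  by rewrite andbT (le_trans b0).
have sq1 (x : R) : 0 <= x -> Num.sqrt (response beta gamma x) <= 1.
  by move=> x0; rewrite -sqrtr1 ler_wsqrtr// (response_le1 af).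
have : \sum_(u in free_nbrs st v) Num.sqrt (response beta gamma (z u)) <= n%:R.
  apply: (@le_trans _ _ (\sum_(u in free_nbrs st v) 1)).
    by apply: ler_sum => u uA; apply: sq1; apply: z0.
  by rewrite sumr_const ler_nat -[X in (_ <= X)%N]card_ord max_card.
by move=> h; rewrite -[X in _ <= X]mul1r ler_pM ?sqrtr_ge0 ?sq1// sumr_ge0//.
Qed.

(** At B = 0 this is the length that [close_zero] requires for a cut vertex. *)
Definition rate (B : nat) : R := wmax / Num.sqrt gamma * B.+1%:R `^ (- kappa).

Lemma rate_ge0 B : 0 <= rate B.
Proof. by rewrite mulr_ge0 ?powR_ge0// divr_ge0// sqrtr_ge0. Qed.

Lemma approxE k B st v :
  approx beta gamma lambda G k B st v = dead_const st v * \prod_(u in free_nbrs st v)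
    message beta gamma (if k is k'.+1 then
            if (B %/ degree G v == 0)%N then 0
            else approx beta gamma lambda G k' (B %/ degree G v)%N (set_status st v u.*2.+3) u
          else 0).
Proof. by rewrite dead_constE; case: k. Qed.

Lemma ratioE st v : st v = 0%N ->
  ratio beta gamma lambda G st v = dead_const st v * \prod_(u in free_nbrs st v)
    message beta gamma (ratio beta gamma lambda G (set_status st v u.*2.+3) u).
Proof. by move=> sv; rewrite dead_constE ratio_recursion. Qed.

(* A removed vertex of status 2u+3 is the predecessor of u on the walk, which currently ends at v. *)
Definition pointers_ok st v : Prop :=
  forall w u, st w = u.*2.+3 -> st u != 0%N \/ u = v.

(** Since u is free and differs from v, [pointers_ok] shows that no earlier vertex has status 2u+3,
    so v becomes the only one. *)
Lemma child_has_parent st v u : pointers_ok st v -> st v = 0%N -> u \in free_nbrs st v ->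
  [/\ has_parent (set_status st v u.*2.+3) u v, pointers_ok (set_status st v u.*2.+3) u,
      set_status st v u.*2.+3 u = 0%N & u != v].
Proof.
move=> ok sv; rewrite inE => /andP[Gvu /eqP su].
have uv : u != v by apply: contraTneq Gvu => ->; rewrite (adj_irr G).
split=> //; last by rewrite set_status_neq.
  split; first by rewrite (adj_sym G).
    by rewrite set_status_eq.
  move=> w wv; rewrite set_status_neq//; apply/eqP => /ok[|uv']; first by rewrite su.
  by rewrite uv' eqxx in uv.
move=> w x; have [->|wv] := eqVneq w v.
  by rewrite set_status_eq => -[] /double_inj /val_inj ->; right.
rewrite set_status_neq// => /ok; have [->|xv] := eqVneq x v.
  by move=> _; left; rewrite set_status_eq.
by rewrite set_status_neq// => -[|/eqP]; [left|rewrite (negbTE xv)].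
Qed.

Lemma close_truncated st v p : has_parent st v p -> st v = 0%N ->
  close beta gamma wmax (rate 0) 0 (ratio beta gamma lambda G st v).
Proof.
move=> hp sv.
have r0 := ratio_ge0 G b0 g0 l0 st v.
apply: (close_zero af) => //.
  rewrite ratioE//; apply: (proj1 (node_contraction hp _)) => u _.
  exact: ratio_ge0.
by rewrite /rate powR1 mulr1 divfK// lt0r_neq0// sqrtr_gt0.
Qed.

Lemma decay k B st v p : (0 < B)%N -> (B <= k)%N -> has_parent st v p -> pointers_ok st v -> st v = 0%N ->
  close beta gamma wmax (rate B) (approx beta gamma lambda G k B st v) (ratio beta gamma lambda G st v).
Proof.
elim: k B st v p => [|k IH] B st v p B0 Bk hp ok sv; first by move: (leq_trans B0 Bk).
have d1 : (0 < degree G v)%N.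
  by have [Gvp _ _] := hp; apply/card_gt0P; exists p; rewrite inE.
set B' := (B %/ degree G v)%N.
(* B + 1 is at most the degree times B' + 1: the successor in [rate] absorbs the rounding of the
   division. *)
apply: (@close_le _ _ _ _ af _ ((degree G v)%:R `^ (- kappa) * rate B')).
  rewrite /rate mulrCA ler_wpM2l ?divr_ge0 ?sqrtr_ge0// -powRM//.
  rewrite !powRN lef_pV2 ?posrE ?powR_gt0 ?mulr_gt0 ?ltr0n//.
  apply: ge0_ler_powR; rewrite ?(ltW kappa0)// ?nnegrE ?mulr_ge0//.
  by rewrite -natrM ler_nat mulnC -ltn_divLR.
rewrite approxE ratioE//.
apply: (close_node af (dead_const_ge0 st v) (rate_ge0 B') _ _ wmax0); last first.
  by move=> z z0; apply: (node_contraction hp).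
move=> u uA; have [hp' ok' su uv] := child_has_parent ok sv uA.
rewrite -/B'; have [->|Bn] := eqVneq B' 0%N; first exact: close_truncated hp' su.
apply: (IH _ _ _ v) => //; first by rewrite lt0n.
(* A parent and a free child make the degree at least 2, so the budget strictly decreases and the
   fuel suffices. *)
have d2 : (1 < degree G v)%N.
  have [Gvp sp _] := hp; have up : u != p.
    by apply: contraTneq uA => ->; rewrite inE sp andbF.
  rewrite /degree (cardD1 p) inE /= Gvp add1n ltnS; apply/card_gt0P; exists u.
  by move: uA; rewrite !inE up => /andP[-> _].
by rewrite -ltnS; apply: leq_trans Bk; apply: ltn_Pdiv.
Qed.

Lemma root_decay k T v : (0 < T)%N -> (T <= k)%N ->
  `|approx beta gamma lambda G k.+1 (T * degree G v)%N (root_status v) v -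
    ratio beta gamma lambda G (root_status v) v| <=
  2 * wmax * (n%:R * rate T * speed beta gamma wmax).
Proof.
move=> T0 Tk; apply: (close_dist af wmax0).
have sv : root_status v v = 0%N by rewrite /root_status ltnn.
rewrite approxE ratioE//.
apply: (close_node af (dead_const_ge0 _ v) (rate_ge0 T) _ _ wmax0); last first.
  move=> z z0; apply: root_contraction => // w.
  by rewrite /root_status; case: ifP.
have ok : pointers_ok (root_status v) v.
  by move=> w u; rewrite /root_status; case: ifP.
move=> u uA; have [hp' ok' su uv] := child_has_parent ok sv uA.
have d1 : (0 < degree G v)%N.
  by apply/card_gt0P; exists u; move: uA; rewrite !inE => /andP[].
(* The root starts with T times its degree, so that every child receives exactly T. *)
rewrite mulnK// gtn_eqF//.
by apply: (@decay _ _ _ _ v).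
Qed.

(** The integer m stands in for 1/kappa: a budget N^m buys an error of order 1/N and is computable
    by the program. *)
Lemma rate_le (N m : nat) T : (0 < N)%N -> kappa^-1 <= m%:R -> (N ^ m <= T)%N ->
  rate T <= wmax / Num.sqrt gamma / N%:R.
Proof.
move=> N0 km NT; rewrite /rate ler_wpM2l ?divr_ge0 ?sqrtr_ge0//.
have Np : (0 : R) < N%:R by rewrite ltr0n.
rewrite powRN lef_pV2 ?posrE ?powR_gt0 ?ltr0n//.
have m1 : 1 <= m%:R * kappa by rewrite -ler_pdivrMr// div1r.
apply: (@le_trans _ _ (N%:R `^ (m%:R * kappa))).
  rewrite -[X in X <= _]powRr1 ?ler0n// ler_powR// ler1n//.
rewrite powRrM powR_mulrn ?ler0n// -natrX.
apply: ge0_ler_powR; rewrite ?(ltW kappa0) ?nnegrE ?ler0n// ler_nat.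
exact: leqW.
Qed.

End Decay.

(** * Rounding the parameters *)

Section Perturbation.
Context {R : realType}.

(** Relative closeness without a quotient, so that 0 is near 0; this matters for beta = 0. *)
Definition near_ratio (r x y : R) : Prop := x <= r * y /\ y <= r * x.

Implicit Types (r x y : R).

Lemma near_ratio_refl r x : 1 <= r -> 0 <= x -> near_ratio r x x.
Proof. by move=> r1 x0; split; rewrite ler_peMl. Qed.

Lemma near_ratio_le r r' x y : r <= r' -> 0 <= x -> 0 <= y -> near_ratio r x y -> near_ratio r' x y.
Proof.
by move=> rr x0 y0 [h1 h2]; split; [apply: le_trans h1 _|apply: le_trans h2 _]; rewrite ler_wpM2r.
Qed.

Lemma near_ratio_mul r r' x y x' y' : 0 <= x -> 0 <= y -> 0 <= x' -> 0 <= y' ->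
  near_ratio r x y -> near_ratio r' x' y' -> near_ratio (r * r') (x * x') (y * y').
Proof.
by move=> x0 y0 x0' y0' [h1 h2] [h3 h4]; split; rewrite mulrACA ler_pM.
Qed.

Lemma near_ratio_trans r r' x y z : 0 <= r -> 0 <= r' ->
  near_ratio r x y -> near_ratio r' y z -> near_ratio (r * r') x z.
Proof.
move=> r0 r0' [h1 h2] [h3 h4]; split.
  by apply: le_trans h1 _; rewrite -mulrA ler_wpM2l.
by apply: le_trans h4 _; rewrite -mulrA mulrCA ler_wpM2l.
Qed.

Lemma near_ratio_inv r x y : 0 < x -> 0 < y -> near_ratio r x y -> near_ratio r x^-1 y^-1.
Proof.
move=> x0 y0 [h1 h2]; split.
  by rewrite ler_pdivlMr// mulrC ler_pdivrMr.
by rewrite ler_pdivlMr// mulrC ler_pdivrMr.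
Qed.

Lemma near_ratio_prod (I : Type) (s : seq I) (P : pred I) (x y : I -> R) r (e : I -> nat) :
  (forall i, P i -> [/\ 0 <= x i, 0 <= y i & near_ratio (r ^+ e i) (x i) (y i)]) ->
  near_ratio (r ^+ \sum_(i <- s | P i) e i) (\prod_(i <- s | P i) x i) (\prod_(i <- s | P i) y i).
Proof.
move=> h; elim: s => [|i s IH]; first by rewrite !big_nil expr0; split; rewrite mul1r.
rewrite !big_cons; case: ifP => // Pi; have [x0 y0 n1] := h i Pi.
by rewrite exprD; apply: near_ratio_mul => //; apply: prodr_ge0 => j /h[].
Qed.

Variables (beta gamma lambda beta' gamma' lambda' r : R).
Hypothesis af : antiferromagnetic beta gamma lambda.
Hypothesis r1 : 1 <= r.
Hypotheses (nb : near_ratio r beta' beta) (ng : near_ratio r gamma' gamma)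
  (nl : near_ratio r lambda' lambda).
Hypotheses (b0' : 0 <= beta') (g0' : 0 < gamma') (l0' : 0 < lambda').

Let b0 : 0 <= beta. Proof. by case: af. Qed.
Let g0 : 0 < gamma. Proof. by case: af. Qed.
Let bg1 : 0 < 1 - beta * gamma. Proof. by case: af; lra. Qed.
Let l0 : 0 < lambda. Proof. by case: af. Qed.
Let r0 : 0 <= r. Proof. by apply: le_trans r1. Qed.

Lemma message_pos (b g : R) x : 0 <= b -> 0 < g -> 0 <= x -> 0 < message b g x.
Proof.
move=> hb hg hx; rewrite divr_gt0//; last by rewrite ltr_wpDl.
by rewrite ltr_wpDl// mulr_ge0.
Qed.

Lemma message_decr x y : 0 <= x -> x <= y -> message beta gamma y <= message beta gamma x.
Proof.
move=> x0 xy; have y0 : 0 <= y by apply: le_trans xy.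
have h1 := Dgamma_gt0 af x0; have h2 := Dgamma_gt0 af y0.
rewrite /message ler_pdivrMr// mulrAC ler_pdivlMr// -subr_ge0.
have -> : (beta * x + 1) * (y + gamma) - (beta * y + 1) * (x + gamma) =
  (y - x) * (1 - beta * gamma) by ring.
by rewrite mulr_ge0 ?subr_ge0// -subr_ge0 ltW.
Qed.

(** A message is 1-Lipschitz on the logarithmic scale, so the recursion does not amplify relative
    errors of its arguments. *)
Lemma near_ratio_message_arg (q : R) x y : 1 <= q -> 0 <= x -> 0 <= y -> near_ratio q x y ->
  near_ratio q (message beta gamma x) (message beta gamma y).
Proof.
move=> q1 x0 y0.
have gen u v : 0 <= u -> u <= v -> v <= q * u -> near_ratio q (message beta gamma u) (message beta gamma v).
  move=> u0 uv vu; have v0 : 0 <= v by apply: le_trans uv.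
  have h1 := Dgamma_gt0 af u0; have h2 := Dgamma_gt0 af v0.
  split; last first.
    apply: le_trans (message_decr u0 uv) _; rewrite ler_peMl//.
    by rewrite ltW// message_pos.
  rewrite /message mulrA ler_pdivrMr// mulrAC ler_pdivlMr// -mulrA mulrCA.
  have bu : beta * u + 1 <= beta * v + 1 by rewrite lerD2r ler_wpM2l.
  have vg : v + gamma <= q * (u + gamma).
    by rewrite mulrDr lerD// ler_peMl// ltW.
  rewrite ler_pM// ?(ltW h2)//; by have := mulr_ge0 b0 u0; lra.
move=> [h1 h2]; have [xy|/ltW yx] := leP x y; first exact: gen.
by have [] := gen _ _ y0 yx h1.
Qed.

Lemma near_ratio_message_param x : 0 <= x ->
  near_ratio (r ^+ 2) (message beta' gamma' x) (message beta gamma x).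
Proof.
move=> x0; rewrite expr2.
have affine (b c : R) : 0 <= c -> near_ratio r b c -> near_ratio r (b * x + 1) (c * x + 1).
  move=> c0 [h1 h2]; split.
    by rewrite mulrDr mulrA lerD ?mulr1// ler_wpM2r.
  by rewrite mulrDr mulrA lerD ?mulr1// ler_wpM2r.
have shift (b c : R) : near_ratio r b c -> near_ratio r (x + b) (x + c).
  by move=> [h1 h2]; split; rewrite mulrDr lerD// ler_peMl.
have p1 : 0 < x + gamma' by rewrite ltr_wpDl.
have p2 := Dgamma_gt0 af x0.
have q1 : 0 <= beta' * x + 1 by rewrite addr_ge0// mulr_ge0.
have q2 := betaD1_gt0 af x0.
apply: near_ratio_mul; rewrite ?invr_ge0 ?(ltW p1) ?(ltW p2) ?(ltW q2)//.
  exact: affine.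
by apply: near_ratio_inv => //; apply: shift.
Qed.

Variables (n : nat) (G : sgraph n).

Lemma approx_pos (b g l : R) k B st v : 0 <= b -> 0 < g -> 0 < l -> 0 <= approx b g l G k B st v.
Proof.
move=> hb hg hl; have pm t (w : nat) : 0 <= pin_message b g t w.
  by rewrite /pin_message; do ![case: ifP => _] => //; rewrite invr_ge0 ltW.
elim: k B st v => [|k IH] B st v /=; rewrite mulr_ge0 ?(ltW hl)// prodr_ge0// => u _;
  case: ifP => _; rewrite ?pm// ltW// message_pos//.
by case: ifP.
Qed.

Lemma near_ratio_pin t (v : nat) : near_ratio r (pin_message beta' gamma' t v) (pin_message beta gamma t v).
Proof.
rewrite /pin_message; do ![case: ifP => _] => //; first exact: near_ratio_inv.
exact: near_ratio_refl.
Qed.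

Lemma degree_le v : (degree G v <= n)%N.
Proof. by rewrite -[X in (_ <= X)%N]card_ord max_card. Qed.

(** The exponent counts perturbed parameters over the computation tree: one for lambda and two per
    message at each vertex. The budgets of the children add up to at most B, which keeps the count
    linear in k B. *)
Lemma approx_perturb k B st v :
  near_ratio (r ^+ ((2 * n).+1 * (1 + k * B)))
    (approx beta' gamma' lambda' G k B st v) (approx beta gamma lambda G k B st v).
Proof.
have pm0 t (w : nat) : 0 <= pin_message beta gamma t w.
  by rewrite /pin_message; do ![case: ifP => _] => //; rewrite invr_ge0 ltW.
have pm0' t (w : nat) : 0 <= pin_message beta' gamma' t w.
  by rewrite /pin_message; do ![case: ifP => _] => //; rewrite invr_ge0 ltW.
have up e e' (x y : R) : (e <= e')%N -> 0 <= x -> 0 <= y -> near_ratio (r ^+ e) x y -> near_ratio (r ^+ e') x y.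
  by move=> ee x0 y0; apply: near_ratio_le => //; rewrite ler_weXn2l.
have r2 : 1 <= r ^+ 2 by rewrite exprn_ege1.
set a := (2 * n).+1.
elim: k B st v => [|k IH] B st v /=.
  rewrite mul0n addn0 muln1 /a -add1n exprD expr1.
  apply: near_ratio_mul; rewrite ?(ltW l0) ?(ltW l0')//.
  - by apply: prodr_ge0 => u _; case: ifP => _ //; rewrite ltW// message_pos.
  - by apply: prodr_ge0 => u _; case: ifP => _ //; rewrite ltW// message_pos.
  apply: (@up (\sum_(u | G v u) 2)%N).
  - by rewrite sum_nat_const mulnC leq_mul2l degree_le.
  - by apply: prodr_ge0 => u _; case: ifP => _ //; rewrite ltW// message_pos.
  - by apply: prodr_ge0 => u _; case: ifP => _ //; rewrite ltW// message_pos.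
  apply: near_ratio_prod => u _; case: ifP => _.
    by split; rewrite ?(ltW (message_pos _ _ _))//; apply: near_ratio_message_param.
  by split=> //; apply: (@up 1%N) => //; rewrite expr1; apply: near_ratio_pin.
set B' := (B %/ degree G v)%N.
pose X (b g l : R) (u : 'I_n) : R := if B' == 0%N then 0 else approx b g l G k B' (set_status st v u.*2.+3) u.
have X0 b g l u : 0 <= b -> 0 < g -> 0 < l -> 0 <= X b g l u.
  by move=> *; rewrite /X; case: ifP => // _; apply: approx_pos.
have P0 : 0 <= \prod_(u | G v u) (if st u == 0%N then message beta gamma (X beta gamma lambda u) else pin_message beta gamma (st u) v).
  by apply: prodr_ge0 => u _; case: ifP => _ //; rewrite ltW// message_pos// X0.
have P0' : 0 <= \prod_(u | G v u) (if st u == 0%N then message beta' gamma' (X beta' gamma' lambda' u) else pin_message beta' gamma' (st u) v).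
  by apply: prodr_ge0 => u _; case: ifP => _ //; rewrite ltW// message_pos// X0.
apply: (@up (1 + \sum_(u | G v u) (2 + a * (k.+1 * B')))%N).
- rewrite sum_nat_const -/(degree G v).
  have h : (degree G v * B' <= B)%N by rewrite mulnC leq_trunc_div.
  have -> : (degree G v * (2 + a * (k.+1 * B')) = 2 * degree G v + a * k.+1 * (degree G v * B'))%N by ring.
  rewrite addnA mulnDr muln1 [(a * (k.+1 * B))%N]mulnA; apply: leq_add.
    by rewrite /a add1n ltnS leq_mul2l degree_le.
  exact: leq_mul.
- by rewrite mulr_ge0// ltW.
- by rewrite mulr_ge0// ltW.
rewrite exprD expr1; apply: near_ratio_mul; rewrite ?(ltW l0) ?(ltW l0')//.
apply: near_ratio_prod => u _; case: ifP => _; last first.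
  by split=> //; apply: (@up 1%N) => //; rewrite expr1; apply: near_ratio_pin.
have x0 := X0 beta gamma lambda u b0 g0 l0; have x0' := X0 beta' gamma' lambda' u b0' g0' l0'.
split; rewrite ?(ltW (message_pos _ _ _))//.
(* Arguments are compared under the exact parameters, because the rounded ones are not assumed
   antiferromagnetic. *)
rewrite exprD; apply: (@near_ratio_trans _ _ _ (message beta gamma (X beta' gamma' lambda' u))).
- exact: exprn_ge0.
- exact: exprn_ge0.
- exact: near_ratio_message_param.
apply: near_ratio_message_arg => //; first exact: exprn_ege1.
rewrite /X; case: eqP => [_|/eqP Bn]; first by apply: near_ratio_refl; rewrite ?exprn_ege1.
apply: up (IH B' _ u); rewrite ?approx_pos//.
by rewrite leq_mul2l mulSn leq_add2r lt0n Bn orbT.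
Qed.

End Perturbation.

Local Close Scope ring_scope.
Local Close Scope classical_set_scope.
Import Defs.

(** * The program *)

Section Machine.
Context {R : realType}.
Variable rho : real_datum -> R.
Implicit Types (s : state) (e : expr) (c : cmd) (L : nat).

Local Notation eval := (Defs.eval rho).
Local Notation cost := (Defs.cost rho).
Local Notation exec := (Defs.exec rho).

Fixpoint loop_free c : bool :=
  match c with
  | Skip | Put _ _ _ => true
  | Seq c1 c2 | If _ c1 c2 => loop_free c1 && loop_free c2
  | While _ _ => false
  end.

(** A functional semantics meant for loop-free commands; the value on [While] is a dummy. *)
Fixpoint run c s : state :=
  match c with
  | Skip | While _ _ => s
  | Put a e1 e2 => update s a (eval s e1) (eval s e2)
  | Seq c1 c2 => run c2 (run c1 s)
  | If e c1 c2 => if eval s e != 0 then run c1 s else run c2 s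
  end.

Definition bounded L s : Prop := forall a i, s a i < 2 ^ L.

(* Linear bounds in L for the bit lengths and times arising from a state with cells below 2^L. *)
Fixpoint expr_bits e : nat :=
  match e with
  | Const n => n.+1
  | Get _ _ | Query _ _ _ => 1
  | Add e1 e2 | Mul e1 e2 => expr_bits e1 + expr_bits e2
  | Sub e1 _ | Div e1 _ => expr_bits e1
  end.

Fixpoint expr_time e : nat :=
  expr_bits e +
  match e with
  | Const _ => 0
  | Get _ e1 => expr_time e1
  | Add e1 e2 | Sub e1 e2 | Mul e1 e2 | Div e1 e2 | Query _ e1 e2 =>
      expr_time e1 + expr_time e2
  end.

Fixpoint cmd_bits c : nat :=
  match c with
  | Skip | While _ _ => 1
  | Put _ _ e2 => (expr_bits e2).+1
  | Seq c1 c2 => cmd_bits c2 * cmd_bits c1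
  | If _ c1 c2 => cmd_bits c1 + cmd_bits c2
  end.

Fixpoint cmd_time c : nat :=
  match c with
  | Skip | While _ _ => 1
  | Put _ e1 e2 => (expr_time e1 + expr_time e2).+1
  | Seq c1 c2 => (cmd_time c1 + cmd_time c2 * cmd_bits c1).+1
  | If e c1 c2 => (expr_time e + (cmd_time c1 + cmd_time c2)).+1
  end.

Lemma expr_bits_gt0 e : 0 < expr_bits e.
Proof. by elim: e => //= e1 h1 e2 h2; rewrite ?addn_gt0 h1. Qed.

Lemma boundedW L L' s : L <= L' -> bounded L s -> bounded L' s.
Proof. by move=> LL h a i; apply: leq_trans (h a i) _; rewrite leq_exp2l. Qed.

Lemma eval_lt L s e : 0 < L -> bounded L s -> eval s e < 2 ^ (expr_bits e * L).
Proof.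
move=> L0 bs; elim: e => /=.
- move=> n; apply: leq_trans (ltn_expl n (isT : 1 < 2)) _; rewrite leq_exp2l//.
  by rewrite (leq_trans (leqnSn n))// leq_pmulr.
- by move=> a e _; rewrite mul1n.
- move=> e1 h1 e2 h2; rewrite mulnDl expnD.
  have p1 : 0 < expr_bits e1 * L by rewrite muln_gt0 expr_bits_gt0.
  have p2 : 0 < expr_bits e2 * L by rewrite muln_gt0 expr_bits_gt0.
  have q1 : 2 <= 2 ^ (expr_bits e1 * L) by rewrite -{1}(expn1 2) leq_exp2l.
  have q2 : 2 <= 2 ^ (expr_bits e2 * L) by rewrite -{1}(expn1 2) leq_exp2l.
  move: h1 h2 q1 q2; set A := 2 ^ _; set B := 2 ^ _; nia.
- by move=> e1 h1 e2 _; apply: leq_ltn_trans (leq_subr _ _) h1.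
- move=> e1 h1 e2 h2; rewrite mulnDl expnD; exact: ltn_mul.
- by move=> e1 h1 e2 _; apply: leq_ltn_trans (leq_div _ _) h1.
- move=> x e1 _ e2 _; apply: (@leq_trans 2); first by case: (_ <= _)%R.
  by rewrite mul1n -{1}(expn1 2) leq_exp2l.
Qed.

Lemma bitlength_le n b : 0 < b -> n < 2 ^ b -> bitlength n <= b.
Proof.
move=> b0 nb; rewrite /bitlength; have [->|n0] := posnP n; first by rewrite trunc_log0.
by rewrite -(@ltn_exp2l 2)//; apply: leq_ltn_trans nb; apply: trunc_logP.
Qed.

Lemma cost_le L s e : 0 < L -> bounded L s -> cost s e <= expr_time e * L.
Proof.
move=> L0 bs.
have bl e' : bitlength (eval s e') <= expr_bits e' * L.
  by apply: bitlength_le; [rewrite muln_gt0 expr_bits_gt0|exact: eval_lt].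
elim: e => [n|a e h|e1 h1 e2 h2|e1 h1 e2 h2|e1 h1 e2 h2|e1 h1 e2 h2|x e1 h1 e2 h2].
- by have := bl (Const n); rewrite /= !addn0.
- by have := bl (Get a e); rewrite /= mulnDl => h'; apply: leq_add.
- by have := bl (Add e1 e2); rewrite /= !mulnDl => h'; apply: leq_add; [exact: h'|exact: leq_add].
- by have := bl (Sub e1 e2); rewrite /= !mulnDl => h'; apply: leq_add; [exact: h'|exact: leq_add].
- by have := bl (Mul e1 e2); rewrite /= !mulnDl => h'; apply: leq_add; [exact: h'|exact: leq_add].
- by have := bl (Div e1 e2); rewrite /= !mulnDl => h'; apply: leq_add; [exact: h'|exact: leq_add].
- by have := bl (Query x e1 e2); rewrite /= !mulnDl => h'; apply: leq_add; [exact: h'|exact: leq_add].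
Qed.

Lemma bounded_update L s a i x : bounded L s -> x < 2 ^ L -> bounded L (update s a i x).
Proof. by move=> bs xL b j; rewrite /update; case: ifP. Qed.

Lemma cmd_bits_gt0 c : 0 < cmd_bits c.
Proof. by elim: c => //= [c1 h1 c2 h2|_ c1 h1 c2 h2]; rewrite ?muln_gt0 ?addn_gt0 ?h1 ?h2. Qed.

Lemma run_exec c s L : loop_free c -> 0 < L -> bounded L s ->
  exists t, [/\ exec c s (run c s) t, t <= cmd_time c * L & bounded (cmd_bits c * L) (run c s)].
Proof.
elim: c s L => //=.
- move=> s L _ L0 bs; exists 1; split; rewrite ?mul1n//; exact: exec_skip.
- move=> a e1 e2 s L _ L0 bs; eexists; split; first exact: exec_put.
    have := cost_le e1 L0 bs; have := cost_le e2 L0 bs; nia.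
  apply: bounded_update.
    by apply: boundedW bs; rewrite mulSn leq_addr.
  by apply: leq_trans (eval_lt e2 L0 bs) _; rewrite leq_exp2l// leq_mul2r leqnSn orbT.
- move=> c1 h1 c2 h2 s L /andP[l1 l2] L0 bs.
  have [t1 [x1 y1 z1]] := h1 s L l1 L0 bs.
  have L1 : 0 < cmd_bits c1 * L by rewrite muln_gt0 cmd_bits_gt0.
  have [t2 [x2 y2 z2]] := h2 _ _ l2 L1 z1.
  exists (t1 + t2).+1; split; first exact: exec_seq x1 x2.
    by move: y1 y2; nia.
  by rewrite -mulnA.
- move=> e c1 h1 c2 h2 s L /andP[l1 l2] L0 bs.
  have ce := cost_le e L0 bs.
  case: eqP => [e0|e0] /=.
    have [t [x y z]] := h2 s L l2 L0 bs.
    exists (cost s e + t).+1; split; first exact: exec_if_false.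
      by move: y; nia.
    by apply: boundedW z; rewrite leq_mul2r leq_addl orbT.
  have [t [x y z]] := h1 s L l1 L0 bs.
  exists (cost s e + t).+1; split; first exact: exec_if_true.
    by move: y; nia.
  by apply: boundedW z; rewrite leq_mul2r leq_addr orbT.
Qed.

Definition loop_time e c : nat := expr_time e + cmd_time c + 1.

(** [run_exec] multiplies the bit bound by a constant, which would compound over iterations. The
    fixed bound L must therefore be supplied afresh by the invariant before each pass. *)
Lemma while_exec e c L N (Inv : nat -> state -> Prop) s :
  loop_free c -> 0 < L -> Inv 0 s ->
  (forall j s, j < N -> Inv j s -> [/\ eval s e <> 0, bounded L s & Inv j.+1 (run c s)]) ->
  (forall s, Inv N s -> eval s e = 0 /\ bounded L s) ->
  exists s' t, [/\ exec (While e c) s s' t, Inv N s' & t <= N.+1 * (loop_time e c * L)].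
Proof.
move=> lf L0 I0 step stop.
have gen m j s1 : m + j = N -> Inv j s1 ->
   exists s' t, [/\ exec (While e c) s1 s' t, Inv N s' & t <= m.+1 * (loop_time e c * L)].
  elim: m j s1 => [|m IH] j s1 mj Ij.
    rewrite add0n in mj; rewrite {}mj in Ij; have [e0 bs] := stop _ Ij.
    exists s1, (cost s1 e).+1; split=> //; first exact: exec_while_false.
    by have := cost_le e L0 bs; rewrite mul1n /loop_time; nia.
  have jN : j < N by rewrite -mj addSn ltnS leq_addl.
  have [e0 bs I1] := step j s1 jN Ij.
  have [t1 [x1 y1 _]] := run_exec lf L0 bs.
  have [|s' [t2 [x2 y2 z2]]] := IH j.+1 _ _ I1; first by rewrite addnS -addSn.
  exists s', (cost s1 e + t1 + t2).+1; split=> //; first exact: exec_while_true x2.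
  have := cost_le e L0 bs; rewrite [m.+2 * _]mulSn.
  by move: y1 z2; rewrite {2}/loop_time; set X := m.+1 * _; nia.
by apply: (gen N 0); rewrite ?addn0.
Qed.

Lemma run_If_true e c1 c2 s : eval s e != 0 -> run (If e c1 c2) s = run c1 s.
Proof. by move=> /= ->. Qed.

Lemma run_If_false e c1 c2 s : eval s e = 0 -> run (If e c1 c2) s = run c2 s.
Proof. by move=> /= ->. Qed.

End Machine.

(* Memory layout: 3: ceil(1/eps); 4: budget T; 5: common denominator Q of the rational parameters, whose
   numerators are in 6 (beta), 7 (gamma), 8 (lambda); 9: degrees; 10: statuses; 11: stack height;
   12-16: for each frame of the stack, its vertex, its budget, the next neighbour to inspect, and
   numerator and denominator of its partial product; 17: current root; 18: counter.  Cells 2[0] / 2[1]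
   accumulate the partition function. *)
Definition scalar (a : nat) : expr := Get a (Const 0).
Definition height : expr := scalar 11.
Definition top (a : nat) : expr := Get a height.
Definition code (e : expr) : expr := Add (Mul (Const 2) e) (Const 3).

Fixpoint seqs (cs : seq cmd) : cmd := if cs is c :: cs' then Seq c (seqs cs') else Skip.

Definition scale_top (x y : expr) : cmd :=
  Seq (Put 15 height (Mul (top 15) x)) (Put 16 height (Mul (top 16) y)).
Definition next_nbr : cmd := Put 14 height (Add (top 14) (Const 1)).

Definition push_frame : cmd :=
  let h := Add height (Const 1) in
  seqs [:: Put 12 h (top 14); Put 13 h (Div (top 13) (Get 9 (top 12))); Put 14 h (Const 0);
           Put 15 h (scalar 8); Put 16 h (scalar 5); Put 10 (top 12) (code (top 14)); Put 11 (Const 0) h].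

(** The height is lowered first, so the finished frame is found just above the top. Its value p/q
    enters the frame below as the message (b p + Q q) / (Q p + g q), cleared of denominators. *)
Definition pop_frame : cmd :=
  let p := Get 15 (Add height (Const 1)) in let q := Get 16 (Add height (Const 1)) in
  seqs [:: Put 11 (Const 0) (Sub height (Const 1)); Put 10 (top 12) (Const 0);
           Put 15 height (Mul (top 15) (Add (Mul (scalar 6) p) (Mul (scalar 5) q)));
           Put 16 height (Mul (top 16) (Add (Mul (scalar 5) p) (Mul (scalar 7) q)));
           next_nbr].

Definition finish_root : cmd :=
  seqs [:: Put 2 (Const 0) (Mul (scalar 2) (Add (top 15) (top 16)));
           Put 2 (Const 1) (Mul (Get 2 (Const 1)) (top 16));
           Put 10 (scalar 17) (Const 2); Put 17 (Const 0) (Add (scalar 17) (Const 1));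
           Put 11 (Const 0) (Const 0)].

Definition start_root : cmd :=
  seqs [:: Put 12 (Const 1) (scalar 17); Put 13 (Const 1) (Mul (scalar 4) (Get 9 (scalar 17)));
           Put 14 (Const 1) (Const 0); Put 15 (Const 1) (scalar 8); Put 16 (Const 1) (scalar 5);
           Put 11 (Const 0) (Const 1)].

(** At height 1 the current vertex is a root and its removed neighbours are earlier roots: besides
    the message 1/gamma, each contributes a factor gamma to the accumulated partition function. *)
Definition dead_nbr : cmd :=
  Seq (If (Sub (Get 10 (top 14)) (code (top 12)))
         (scale_top (scalar 6) (scalar 5))
         (If (Sub (code (top 12)) (Get 10 (top 14)))
            (Seq (scale_top (scalar 5) (scalar 7))
                 (If (Sub height (Const 1)) Skip
                    (Seq (Put 2 (Const 0) (Mul (scalar 2) (scalar 7)))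
                         (Put 2 (Const 1) (Mul (Get 2 (Const 1)) (scalar 5))))))
            Skip))
      next_nbr.

(** A single loop-free transition: recursion lives on the explicit stack, and the running time
    reduces to a count of transitions. *)
Definition body : cmd :=
  If height
    (If (Sub (scalar 0) (top 14))
       (If (Get 1 (Add (Mul (top 12) (scalar 0)) (top 14)))
          (If (Get 10 (top 14))
             dead_nbr
             (If (Div (top 13) (Get 9 (top 12)))
                push_frame
                (Seq (scale_top (scalar 5) (scalar 7)) next_nbr)))
          next_nbr)
       (If (Sub height (Const 1)) pop_frame finish_root))
    start_root.

Record frame := Frame { fvert : nat; fbudget : nat; findex : nat; fnum : nat; fden : nat }.

Record conf := Conf {
  croot : nat; cstatus : nat -> nat; cstack : seq frame; cnum : nat; cden : nat }.

(** * An abstract stack machine and its simulation *)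

Section AbstractMachine.
Variables (n : nat) (nadj : nat -> nat -> bool) (deg : nat -> nat).
Variables T Q b g l : nat.

Definition skip_nbr (f : frame) : frame := Frame (fvert f) (fbudget f) (findex f).+1 (fnum f) (fden f).
Definition mul_frame (x y : nat) (f : frame) : frame :=
  Frame (fvert f) (fbudget f) (findex f).+1 (fnum f * x) (fden f * y).

Definition mstep (c : conf) : conf :=
  let: Conf k st stk zn zd := c in
  match stk with
  | [::] => Conf k st [:: Frame k (T * deg k) 0 l Q] zn zd
  | f :: r =>
    let v := fvert f in let u := findex f in
    if u < n then
      if nadj v u then
        if st u != 0 then
          if v.*2.+3 < st u then Conf k st (mul_frame b Q f :: r) zn zd
          else if st u < v.*2.+3 then
            if r is [::] then Conf k st [:: mul_frame Q g f] (zn * g) (zd * Q)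
            else Conf k st (mul_frame Q g f :: r) zn zd
          else Conf k st (skip_nbr f :: r) zn zd
        else if fbudget f %/ deg v == 0 then Conf k st (mul_frame Q g f :: r) zn zd
        else Conf k (set_status st v u.*2.+3) (Frame u (fbudget f %/ deg v) 0 l Q :: f :: r) zn zd
      else Conf k st (skip_nbr f :: r) zn zd
    else
      if r is f' :: r' then
        Conf k (set_status st (fvert f') 0)
          (mul_frame (b * fnum f + Q * fden f) (Q * fnum f + g * fden f) f' :: r') zn zd
      else Conf k.+1 (set_status st k 2) [::] (zn * (fnum f + fden f)) (zd * fden f)
  end.

Definition rep_frame (s : state) (h : nat) (f : frame) : Prop :=
  [/\ s 12 h = fvert f, s 13 h = fbudget f, s 14 h = findex f, s 15 h = fnum f & s 16 h = fden f].

Fixpoint rep_stack (s : state) (stk : seq frame) : Prop :=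
  if stk is f :: r then rep_frame s (size r).+1 f /\ rep_stack s r else True.

Definition rep_consts (s : state) : Prop :=
  [/\ s 0 0 = n, forall v u, (s 1 (v * n + u) != 0) = nadj v u, forall u, s 9 u = deg u,
      s 4 0 = T & [/\ s 5 0 = Q, s 6 0 = b, s 7 0 = g & s 8 0 = l]].

Definition rep_vars (s : state) (c : conf) : Prop :=
  [/\ s 17 0 = croot c, forall u, s 10 u = cstatus c u, s 11 0 = size (cstack c),
      s 2 0 = cnum c & s 2 1 = cden c].

Definition rep (s : state) (c : conf) : Prop :=
  [/\ rep_consts s, rep_vars s c & rep_stack s (cstack c)].

Definition conf_lt (V : nat) (c : conf) : Prop :=
  [/\ croot c < V, forall u, cstatus c u < V, size (cstack c) < V, cnum c < V /\ cden c < V &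
      forall f, List.In f (cstack c) ->
        [/\ fvert f < V, fbudget f < V, findex f < V, fnum f < V & fden f < V]].

Lemma rep_stack_ext s s' stk :
  (forall a h, 12 <= a <= 16 -> h <= size stk -> s' a h = s a h) ->
  rep_stack s stk -> rep_stack s' stk.
Proof.
elim: stk => //= f r IH h [[h1 h2 h3 h4 h5] hr]; split.
  by split; rewrite h.
by apply: IH hr => a i ha hi; apply: h => //; apply: leqW.
Qed.

Context {R : realType}.
Variable rho : real_datum -> R.

Variable L : nat.
Implicit Types (s : state) (f : frame) (r stk : seq frame) (st : nat -> nat).

Definition brep s (c : conf) : Prop := rep s c /\ bounded L s.

(** Cells above the stack are invisible, so a new frame can be written there before the height is
    raised. *)
Lemma brep_stale s c a h x : brep s c -> 12 <= a <= 16 -> size (cstack c) < h -> x < 2 ^ L ->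
  brep (update s a h x) c.
Proof.
move=> [[[n0 adj0 deg0 T0 [Q0 b0 g0 l0]] [k0 st0 h0 zn0 zd0] rs] bs] ha hh xL.
split; last exact: bounded_update.
have nl c' j : c' < 12 -> update s a h x c' j = s c' j.
  by move=> hc; rewrite /update; case: eqP => // e; move: ha hc; rewrite e; lia.
have nr c' j : 16 < c' -> update s a h x c' j = s c' j.
  by move=> hc; rewrite /update; case: eqP => // e; move: ha hc; rewrite e; lia.
split.
- split; [by rewrite nl|by move=> v' u'; rewrite nl|by move=> u'; rewrite nl|by rewrite nl|].
  by split; rewrite nl.
- by split; [rewrite nr|move=> u'; rewrite nl|rewrite nl|rewrite nl|rewrite nl].
apply: rep_stack_ext rs => a' h' _ hs; rewrite /update.
by case: (h' =P h) => [e|]; rewrite ?andbF//; move: hs; rewrite e; lia.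
Qed.

Lemma brep_field s k st v B i N D r zn zd a x :
  brep s (Conf k st (Frame v B i N D :: r) zn zd) -> x < 2 ^ L -> 14 <= a <= 16 ->
  brep (update s a (size r).+1 x)
    (Conf k st (Frame v B (if a == 14 then x else i) (if a == 15 then x else N)
       (if a == 16 then x else D) :: r) zn zd).
Proof.
move=> [[[n0 adj0 deg0 T0 [Q0 b0 g0 l0]] [k0 st0 h0 zn0 zd0] [[f1 f2 f3 f4 f5] rs]] bs] xL ha.
split; last exact: bounded_update.
have nl c' j : c' < 12 -> update s a (size r).+1 x c' j = s c' j.
  by move=> hc; rewrite /update; case: eqP => // e; move: ha hc; rewrite e; lia.
have nr c' j : 16 < c' -> update s a (size r).+1 x c' j = s c' j.
  by move=> hc; rewrite /update; case: eqP => // e; move: ha hc; rewrite e; lia.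
split.
- split; [by rewrite nl|by move=> v' u'; rewrite nl|by move=> u'; rewrite nl|by rewrite nl|].
  by split; rewrite nl.
- by split; [rewrite nr|move=> u'; rewrite nl|rewrite nl|rewrite nl|rewrite nl].
split.
  have : a \in [:: 14; 15; 16] by rewrite !inE; lia.
  by rewrite !inE => /or3P[] /eqP ->; split; rewrite /update /= ?eqxx.
apply: rep_stack_ext rs => a' h' _ hs; rewrite /update.
by case: (h' =P (size r).+1) => [e|]; rewrite ?andbF//; move: hs; rewrite e ltnn.
Qed.

Lemma brep_status s k st stk zn zd u x : brep s (Conf k st stk zn zd) -> x < 2 ^ L ->
  brep (update s 10 u x) (Conf k (set_status st u x) stk zn zd).
Proof.
move=> [[[n0 adj0 deg0 T0 [Q0 b0 g0 l0]] [k0 st0 h0 zn0 zd0] rs] bs] xL.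
split; last exact: bounded_update.
split.
- by split; [exact: n0|exact: adj0|exact: deg0|exact: T0|split].
- split; [exact: k0| |exact: h0|exact: zn0|exact: zd0].
  by move=> w; rewrite /update /set_status /=; case: eqP => // _; exact: st0.
apply: rep_stack_ext rs => a h ha _; rewrite /update.
by case: eqP => // e; move: ha; rewrite e.
Qed.

Lemma brep_num s k st stk zn zd x : brep s (Conf k st stk zn zd) -> x < 2 ^ L ->
  brep (update s 2 0 x) (Conf k st stk x zd).
Proof.
move=> [[[n0 adj0 deg0 T0 [Q0 b0 g0 l0]] [k0 st0 h0 zn0 zd0] rs] bs] xL.
split; last exact: bounded_update.
split.
- by split; [exact: n0|exact: adj0|exact: deg0|exact: T0|split].
- by split; [exact: k0|exact: st0|exact: h0| |exact: zd0].
apply: rep_stack_ext rs => a h ha _; rewrite /update.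
by case: eqP => // e; move: ha; rewrite e.
Qed.

Lemma brep_den s k st stk zn zd x : brep s (Conf k st stk zn zd) -> x < 2 ^ L ->
  brep (update s 2 1 x) (Conf k st stk zn x).
Proof.
move=> [[[n0 adj0 deg0 T0 [Q0 b0 g0 l0]] [k0 st0 h0 zn0 zd0] rs] bs] xL.
split; last exact: bounded_update.
split.
- by split; [exact: n0|exact: adj0|exact: deg0|exact: T0|split].
- by split; [exact: k0|exact: st0|exact: h0|exact: zn0|].
apply: rep_stack_ext rs => a h ha _; rewrite /update.
by case: eqP => // e; move: ha; rewrite e.
Qed.

Lemma brep_root s k st stk zn zd x : brep s (Conf k st stk zn zd) -> x < 2 ^ L ->
  brep (update s 17 0 x) (Conf x st stk zn zd).
Proof.
move=> [[[n0 adj0 deg0 T0 [Q0 b0 g0 l0]] [k0 st0 h0 zn0 zd0] rs] bs] xL.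
split; last exact: bounded_update.
split.
- by split; [exact: n0|exact: adj0|exact: deg0|exact: T0|split].
- by split; [|exact: st0|exact: h0|exact: zn0|exact: zd0].
apply: rep_stack_ext rs => a h ha _; rewrite /update.
by case: eqP => // e; move: ha; rewrite e.
Qed.

Lemma brep_push s k st f stk zn zd : brep s (Conf k st stk zn zd) ->
  rep_frame s (size stk).+1 f -> (size stk).+1 < 2 ^ L ->
  brep (update s 11 0 (size stk).+1) (Conf k st (f :: stk) zn zd).
Proof.
move=> [[[n0 adj0 deg0 T0 [Q0 b0 g0 l0]] [k0 st0 h0 zn0 zd0] rs] bs] hf xL.
split; last exact: bounded_update.
split.
- by split; [exact: n0|exact: adj0|exact: deg0|exact: T0|split].
- by split; [exact: k0|exact: st0| |exact: zn0|exact: zd0].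
split; first exact: hf.
apply: rep_stack_ext rs => a h ha _; rewrite /update.
by case: eqP => // e; move: ha; rewrite e.
Qed.

Lemma brep_pop s k st f r zn zd : brep s (Conf k st (f :: r) zn zd) -> size r < 2 ^ L ->
  brep (update s 11 0 (size r)) (Conf k st r zn zd).
Proof.
move=> [[[n0 adj0 deg0 T0 [Q0 b0 g0 l0]] [k0 st0 h0 zn0 zd0] [_ rs]] bs] xL.
split; last exact: bounded_update.
split.
- by split; [exact: n0|exact: adj0|exact: deg0|exact: T0|split].
- by split; [exact: k0|exact: st0| |exact: zn0|exact: zd0].
apply: rep_stack_ext rs => a h ha _; rewrite /update.
by case: eqP => // e; move: ha; rewrite e.
Qed.

Lemma brep_consts s c : brep s c ->
  [/\ s 4 0 = T, s 5 0 = Q, s 6 0 = b, s 7 0 = g & s 8 0 = l].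
Proof. by case=> [[[_ _ _ -> [-> -> -> ->]] _ _] _]. Qed.

Lemma brep_vars s k st stk zn zd : brep s (Conf k st stk zn zd) ->
  [/\ s 17 0 = k, forall u, s 10 u = st u, s 11 0 = size stk, s 2 0 = zn & s 2 1 = zd].
Proof. by case=> [[_ h _] _]. Qed.

Lemma brep_top s k st v B i N D r zn zd : brep s (Conf k st (Frame v B i N D :: r) zn zd) ->
  [/\ s 12 (size r).+1 = v, s 13 (size r).+1 = B, s 14 (size r).+1 = i,
      s 15 (size r).+1 = N & s 16 (size r).+1 = D].
Proof. by case=> [[_ _ [h _]] _]. Qed.

Lemma brep_scale s k st v B i N D r zn zd ax ay X Y :
  brep s (Conf k st (Frame v B i N D :: r) zn zd) ->
  s ax 0 = X -> s ay 0 = Y -> ay < 12 -> N * X < 2 ^ L -> D * Y < 2 ^ L ->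
  brep (run rho (scale_top (scalar ax) (scalar ay)) s)
       (Conf k st (Frame v B i (N * X) (D * Y) :: r) zn zd).
Proof.
move=> H sx sy ay12 hX hY.
have [_ _ h0 _ _] := brep_vars H; have [_ _ _ f4 f5] := brep_top H; rewrite /= in h0.
have H1 := brep_field H hX (isT : 14 <= 15 <= 16).
have [_ _ h1 _ _] := brep_vars H1; have [_ _ _ _ f5'] := brep_top H1; rewrite /= in h1 f5'.
have H2 := brep_field H1 hY (isT : 14 <= 16 <= 16); move: H2 => /=.
rewrite h0 sx f4 h1 f5'.
have -> : update s 15 (size r).+1 (N * X) ay 0 = Y.
  by rewrite /update; case: eqP ay12 => [->|] //= _ _; exact: sy.
by [].
Qed.

Lemma brep_next s k st v B i N D r zn zd :
  brep s (Conf k st (Frame v B i N D :: r) zn zd) -> i.+1 < 2 ^ L ->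
  brep (run rho next_nbr s) (Conf k st (Frame v B i.+1 N D :: r) zn zd).
Proof.
move=> H hi; have [_ _ h0 _ _] := brep_vars H; have [_ _ f3 _ _] := brep_top H; rewrite /= in h0.
have := brep_field H hi (isT : 14 <= 14 <= 16) => /=.
by rewrite h0 f3 addn1.
Qed.

Lemma run_Seq c1 c2 s : run rho (Seq c1 c2) s = run rho c2 (run rho c1 s).
Proof. by []. Qed.

Lemma run_Put a e1 e2 s : run rho (Put a e1 e2) s = update s a (eval rho s e1) (eval rho s e2).
Proof. by []. Qed.

Lemma brep_start s k st zn zd : brep s (Conf k st [::] zn zd) ->
  conf_lt (2 ^ L) (mstep (Conf k st [::] zn zd)) ->
  brep (run rho start_root s) (mstep (Conf k st [::] zn zd)).
Proof.
move=> H [_ _ hs _ /(_ _ (or_introl erefl)) [/= kV BV iV lV QV]].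
have [eT eQ _ _ el] := brep_consts H; have [ek _ _ _ _] := brep_vars H.
have eD : forall u, s 9 u = deg u by case: H => [[[_ _ hd _ _] _ _] _].
have H1 := @brep_stale _ _ 12 1 k H isT isT kV.
have H2 := @brep_stale _ _ 13 1 (T * deg k) H1 isT isT BV.
have H3 := @brep_stale _ _ 14 1 0 H2 isT isT iV.
have H4 := @brep_stale _ _ 15 1 l H3 isT isT lV.
have H5 := @brep_stale _ _ 16 1 Q H4 isT isT QV.
have := @brep_push _ _ _ (Frame k (T * deg k) 0 l Q) _ _ _ H5 _ hs.
rewrite /start_root /= /update /= ek eT eD el eQ; apply.
by split.
Qed.

Lemma brep_finish s k st v B i N D zn zd : brep s (Conf k st [:: Frame v B i N D] zn zd) ->
  conf_lt (2 ^ L) (Conf k.+1 (set_status st k 2) [::] (zn * (N + D)) (zd * D)) ->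
  brep (run rho finish_root s) (Conf k.+1 (set_status st k 2) [::] (zn * (N + D)) (zd * D)).
Proof.
move=> H [kV sV hV [znV zdV] _]; rewrite /= in kV sV hV znV zdV.
have V2 : 2 < 2 ^ L by have := sV k; rewrite /set_status eqxx.
have [ek _ eh ezn ezd] := brep_vars H; have [_ _ _ eN eD] := brep_top H; rewrite /= in eN eD eh.
have H1 := brep_num H znV.
have H2 := brep_den H1 zdV.
have H3 := brep_status k H2 V2.
have H4 := brep_root H3 kV.
have := brep_pop H4 hV.
by rewrite /finish_root /= /update /= ek eh /= ezn ezd eN eD addn1.
Qed.

Lemma brep_push_frame s k st v B i N D r zn zd :
  let f := Frame v B i N D in
  let c := Conf k (set_status st v i.*2.+3) (Frame i (B %/ deg v) 0 l Q :: f :: r) zn zd in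
  brep s (Conf k st (f :: r) zn zd) -> conf_lt (2 ^ L) c -> brep (run rho push_frame s) c.
Proof.
move=> f c H [kV sV hV _ /(_ _ (or_introl erefl)) [iV BV zV lV QV]].
rewrite /= in kV sV hV iV BV zV lV QV.
have V2 : i.*2.+3 < 2 ^ L by have := sV v; rewrite /set_status eqxx.
have [eT eQ _ _ el] := brep_consts H; have [ek _ eh _ _] := brep_vars H.
have eD : forall u, s 9 u = deg u by case: H => [[[_ _ hd _ _] _ _] _].
have [ev eB ei _ _] := brep_top H; rewrite /= in eh.
have sz : size (f :: r) < (size r).+2 by [].
have H1 := @brep_stale _ _ 12 (size r).+2 i H isT sz iV.
have H2 := @brep_stale _ _ 13 (size r).+2 (B %/ deg v) H1 isT sz BV.
have H3 := @brep_stale _ _ 14 (size r).+2 0 H2 isT sz zV.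
have H4 := @brep_stale _ _ 15 (size r).+2 l H3 isT sz lV.
have H5 := @brep_stale _ _ 16 (size r).+2 Q H4 isT sz QV.
have H6 := brep_status v H5 V2.
have := @brep_push _ _ _ (Frame i (B %/ deg v) 0 l Q) _ _ _ H6 _ hV.
have ne : ((size r).+1 == (size r).+2) = false by rewrite eqn_leq ltnn andbF.
rewrite /push_frame /= /update /= eh ?ne /= ?ev ?eB ?ei ?eD ?el ?eQ ?addn1 ?mul2n ?addn3 ?ne /=; apply.
by split; rewrite /= ?eqxx.
Qed.

Lemma brep_pop_frame s k st v B i N D v' B' i' N' D' r zn zd :
  let f := Frame v B i N D in let f' := Frame v' B' i' N' D' in
  let c := Conf k (set_status st v' 0)
     (Frame v' B' i'.+1 (N' * (b * N + Q * D)) (D' * (Q * N + g * D)) :: r) zn zd in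
  brep s (Conf k st (f :: f' :: r) zn zd) -> conf_lt (2 ^ L) c -> brep (run rho pop_frame s) c.
Proof.
move=> f f' c H [kV sV hV _ /(_ _ (or_introl erefl)) [vV BV iV NV DV]].
rewrite /= in kV sV hV vV BV iV NV DV.
have V0 : 0 < 2 ^ L by rewrite expn_gt0.
have [eT eQ eb eg el] := brep_consts H; have [ek _ eh _ _] := brep_vars H.
have [_ _ _ eN eD] := brep_top H; rewrite /= in eh eN eD.
have H1 := brep_pop H hV.
have [ev' _ ei' eN' eD'] := brep_top H1.
have H2 := brep_status v' H1 V0.
have H3 := brep_field H2 NV (isT : 14 <= 15 <= 16).
have H4 := brep_field H3 DV (isT : 14 <= 16 <= 16).
have := brep_next H4 iV.
have ne : ((size r).+2 == (size r).+1) = false by rewrite eqn_leq ltnn.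
rewrite /= in ev' ei' eN' eD'.
rewrite /pop_frame /= /update /= eh /= ?subn1 /= ?ne ?addn1 ?eN ?eD ?eQ ?eb ?eg ?ne /=.
move: ev' ei' eN' eD'; rewrite /update /= => -> _ -> ->.
by [].
Qed.

Lemma brep_Z s k st stk zn zd : brep s (Conf k st stk zn zd) -> zn * g < 2 ^ L -> zd * Q < 2 ^ L ->
  brep (run rho (Seq (Put 2 (Const 0) (Mul (scalar 2) (scalar 7)))
                     (Put 2 (Const 1) (Mul (Get 2 (Const 1)) (scalar 5)))) s)
       (Conf k st stk (zn * g) (zd * Q)).
Proof.
move=> H znV zdV; have := brep_den (brep_num H znV) zdV.
have [_ eQ _ eg _] := brep_consts H; have [_ _ _ ezn ezd] := brep_vars H.
by rewrite /= /update /= ezn ezd eQ eg.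
Qed.

(** Bounds on the target configuration suffice, because every value stored during the step already
    occurs in it. *)
Lemma body_step s c : brep s c -> conf_lt (2 ^ L) (mstep c) -> brep (run rho body s) (mstep c).
Proof.
case: c => k st stk zn zd H; have [ek es eh ezn ezd] := brep_vars H.
case: stk H eh => [|[v B i N D] r] H eh.
  by move=> cl; rewrite /body run_If_false //; apply: brep_start.
have [ev eB ei eN eD] := brep_top H; rewrite /= in eh.
have [eT eQ eb eg el] := brep_consts H.
have [en ea ed] : [/\ s 0 0 = n, forall v u, (s 1 (v * n + u) != 0) = nadj v u & forall u, s 9 u = deg u].
  by case: H => [[[]]].
rewrite /body run_If_true; last by rewrite /= eh.
rewrite [mstep _]/=; case: ltnP => [lt|ge]; last first.
  rewrite run_If_false; last by rewrite /= en eh ei; apply/eqP; rewrite subn_eq0.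
  case: r H eh ev eB ei eN eD => [|[v' B' i' N' D'] r] H eh ev eB ei eN eD cl.
    by rewrite run_If_false; [apply: brep_finish H cl|rewrite /= eh].
  by rewrite run_If_true; [apply: brep_pop_frame H cl|rewrite /= eh].
rewrite run_If_true; last by rewrite /= en eh ei subn_eq0 -ltnNge.
have top_lt X Y k' st' zn' zd' r' : conf_lt (2 ^ L) (Conf k' st' (Frame v B i.+1 X Y :: r') zn' zd') ->
   [/\ i.+1 < 2 ^ L, X < 2 ^ L & Y < 2 ^ L].
  by move=> [_ _ _ _ /(_ _ (or_introl erefl)) []].
case: ifP => ad; last first.
  rewrite run_If_false; last by rewrite /= en eh ei ev; apply/eqP; rewrite -[_ == 0]negbK ea ad.
  by move=> /top_lt[iV _ _]; apply: brep_next.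
rewrite run_If_true; last by rewrite /= en eh ei ev ea.
case: ifP => su; last first.
  rewrite run_If_false; last by rewrite /= eh ei es; apply/eqP/negPn; rewrite su.
  case: ifP => Bd.
    rewrite run_If_false; last by rewrite /= eh eB ev ed; apply/eqP.
    move=> /top_lt[iV XV YV]; rewrite run_Seq; apply: brep_next => //.
    exact: brep_scale.
  rewrite run_If_true; last by rewrite /= eh eB ev ed Bd.
  exact: brep_push_frame.
rewrite run_If_true; last by rewrite /= eh ei es su.
rewrite /dead_nbr run_Seq.
have e1 : eval rho s (Sub (Get 10 (top 14)) (code (top 12))) = st i - v.*2.+3.
  by rewrite /= eh ei ev es mul2n addn3.
have e2 : eval rho s (Sub (code (top 12)) (Get 10 (top 14))) = v.*2.+3 - st i.
  by rewrite /= eh ei ev es mul2n addn3.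
case: ifP => lt1.
  rewrite run_If_true; last by rewrite e1 subn_eq0 -ltnNge.
  move=> /top_lt[iV XV YV]; apply: brep_next => //; exact: brep_scale.
rewrite run_If_false; last by rewrite e1; apply/eqP; rewrite subn_eq0 leqNgt lt1.
case: ifP => lt2; last first.
  rewrite run_If_false; last by rewrite e2; apply/eqP; rewrite subn_eq0 leqNgt lt2.
  move=> /top_lt[iV XV YV]; exact: brep_next.
rewrite run_If_true; last by rewrite e2 subn_eq0 -ltnNge.
rewrite run_Seq.
case: r H eh ev eB ei eN eD e1 e2 => [|f' r] H eh ev eB ei eN eD e1 e2 cl;
  have [iV XV YV] := top_lt _ _ _ _ _ _ _ cl;
  have H1 := brep_scale H eQ eg isT XV YV;
  have [_ _ eh1 ezn1 ezd1] := brep_vars H1; rewrite [size _]/= in eh1.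
  rewrite run_If_false; last by rewrite [eval _ _ _]/= -[X in X - _]/(run rho (scale_top (scalar 5) (scalar 7)) s 11 0) eh1.
  have [_ _ _ [znV zdV] _] := cl; rewrite /= in znV zdV.
  by apply: brep_next => //; apply: brep_Z.
rewrite run_If_true; last by rewrite [eval _ _ _]/= -[X in X - _]/(run rho (scale_top (scalar 5) (scalar 7)) s 11 0) eh1.
exact: brep_next.
Qed.

End AbstractMachine.

(** * Growth of the stored numbers *)

Section Bounds.
Variables (n : nat) (nadj : nat -> nat -> bool) (deg : nat -> nat).
Variables T Q b g l : nat.
Hypotheses (Q0 : 0 < Q) (g0 : 0 < g) (degn : forall u, deg u <= n).
Local Notation mstep := (mstep n nadj deg T Q b g l).

Definition fsize (f : frame) : nat := fnum f + fden f.
(** A potential: popping multiplies a frame into the one below, which a product over the stack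
    survives with a bounded factor. Bit lengths thus grow linearly in the number of steps. *)
Definition csize (c : conf) : nat := (cnum c + cden c) * \prod_(f <- cstack c) fsize f.
(** Squared because a removed neighbour of a root scales both the frame and the accumulator in one
    step. *)
Definition growth : nat := (b + g + l + Q + 2) ^ 2.

(** A frame below the top is waiting for the neighbour at its index, so this index is still below n
    and may be advanced on return. *)
Definition conf_inv (j : nat) (c : conf) : Prop :=
  [/\ croot c <= n, forall u, cstatus c u <= n.*2.+3, size (cstack c) <= j,
      0 < cden c /\ csize c <= growth ^ j.+1 &
      (forall f, List.In f (cstack c) ->
         [/\ fvert f <= n, fbudget f <= T * n, findex f <= n & 0 < fden f]) /\
      forall f, List.In f (behead (cstack c)) -> findex f < n].

Lemma mul_sum_le x y p q : x * p + y * q <= (x + y) * (p + q).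
Proof. nia. Qed.

Lemma growth_ge p q r : p <= b + g + l + Q + 2 -> q <= b + g + l + Q + 2 ->
  r <= p * q -> r <= growth.
Proof. by move=> hp hq hr; apply: leq_trans hr _; rewrite /growth -mulnn leq_mul. Qed.

Lemma mstep_inv j c : conf_inv j c -> croot c < n -> conf_inv j.+1 (mstep c).
Proof.
case: c => k st stk zn zd [/= kn sn hj [zd0 sz] [fr tl]] lt.
have grow x y : x <= growth ^ j.+1 -> y <= x * growth -> y <= growth ^ j.+2.
  by move=> hx hy; apply: leq_trans hy _; rewrite [growth ^ j.+2]expnSr leq_mul2r hx orbT.
have sst u x : x <= n.*2.+3 -> forall w, set_status st u x w <= n.*2.+3.
  by move=> hx w; rewrite /set_status; case: ifP.
case: stk hj sz fr tl => [|[v B i N D] r] hj sz fr tl.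
  split=> //=; first split=> //.
    apply: grow sz _; rewrite /csize /= big_seq1 big_nil muln1 leq_mul2l; apply/orP; right.
    by apply: (@growth_ge 1 (l + Q)); rewrite /fsize /=; lia.
  by split=> // f [<-|//]; split=> //=; rewrite leq_mul.
have [/= vn Bn ni D0] := fr _ (or_introl erefl).
have fr' f : List.In f r -> [/\ fvert f <= n, fbudget f <= T * n, findex f <= n & 0 < fden f].
  by move=> h; apply: fr; right.
have scaled X Y zn' zd' z : 0 < Y -> 0 < zd' -> (zn' + zd') <= (zn + zd) * z -> z * (X + Y) <= growth -> i < n ->
   conf_inv j.+1 (Conf k st (Frame v B i.+1 (N * X) (D * Y) :: r) zn' zd').
  move=> Y0 z0' hz hg lti; split=> //=; first by apply: leqW.
    split=> //; apply: grow sz _; rewrite /csize /= !big_cons /fsize /=.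
    set P := \prod_(f <- r) _.
    apply: (@leq_trans (((zn + zd) * z) * ((N + D) * (X + Y) * P))).
      by apply: leq_mul => //; rewrite leq_mul2r mul_sum_le orbT.
    have -> : (zn + zd) * z * ((N + D) * (X + Y) * P) = (zn + zd) * ((N + D) * P) * (z * (X + Y)) by ring.
    by rewrite leq_mul2l hg orbT.
  split=> // f [<-|/fr' //]; split=> //=.
  by rewrite muln_gt0 D0.
have z1 : zn + zd <= (zn + zd) * 1 by rewrite muln1.
have skip : i < n -> conf_inv j.+1 (Conf k st (Frame v B i.+1 N D :: r) zn zd).
  move=> lti; split=> //=; first by apply: leqW.
    split=> //; apply: grow sz _; rewrite /csize /= !big_cons /fsize /= leq_pmulr//.
    by rewrite /growth expn_gt0; lia.
  by split=> // f [<-|/fr' //]; split.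
case: ltnP => [lti|gei]; last first.
  case: r hj sz fr tl fr' scaled skip => [|[v' B' i' N' D'] r] hj sz fr tl fr' scaled skip.
    split; [exact: lt|exact: sst|by []| |by split].
    split; first by rewrite muln_gt0 zd0.
    apply: grow sz _; rewrite /csize /= big_seq1 big_nil muln1 /fsize /=.
    apply: (@leq_trans ((zn + zd) * (N + D) * 1)); first by nia.
    by rewrite leq_mul2l /growth expn_gt0; lia.
  have [/= vn' Bn' ni' D0'] := fr' _ (or_introl erefl).
  have lti' : i' < n by apply: (tl _ (or_introl erefl)).
  split; [by []|exact: sst|by apply: leqW; apply: ltnW| |].
    split=> //; apply: grow sz _; rewrite /csize /= !big_cons /fsize /=.
    set P := \prod_(f <- r) _; set z := zn + zd; set M := b + g + l + Q + 2.
    apply: (@leq_trans (z * ((N' + D') * (M * (N + D)) * P))).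
      rewrite leq_mul2l leq_mul2r; apply/orP; right; apply/orP; right.
      rewrite mulnDl; apply: leq_add; rewrite leq_mul2l; apply/orP; right; rewrite /M; nia.
    have -> : z * ((N' + D') * (M * (N + D)) * P) = z * ((N + D) * ((N' + D') * P)) * M by ring.
    rewrite leq_mul2l; apply/orP; right; rewrite /growth -/M -mulnn leq_pmulr// /M; lia.
  split; last by move=> f h; apply: tl; right.
  move=> f [<-|h]; last by apply: fr'; right.
  split=> //=; rewrite muln_gt0 D0' /=; nia.
case: ifP => _; last exact: skip.
case: ifP => su.
  case: ifP => _.
    by apply: scaled z1 _ _; rewrite // mul1n; apply: (@growth_ge 1 (b + Q)); lia.
  case: ifP => _; last exact: skip.
  case: r hj sz fr tl fr' scaled skip => [|f' r] hj sz fr tl fr' scaled skip.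
    apply: (scaled _ _ _ _ (g + Q)) => //.
    - by rewrite muln_gt0 zd0.
    - exact: mul_sum_le.
    - by apply: (@growth_ge (g + Q) (Q + g)); lia.
  by apply: scaled z1 _ _; rewrite // mul1n; apply: (@growth_ge 1 (Q + g)); lia.
case: ifP => _.
  by apply: scaled z1 _ _; rewrite // mul1n; apply: (@growth_ge 1 (Q + g)); lia.
split; [by []|by apply: sst; rewrite ltnS ltnS ltnS leq_double ltnW|by []| |].
  split=> //; apply: grow sz _; rewrite /csize /= !big_cons /fsize /=.
  set P := \prod_(f <- r) _.
  have -> : (zn + zd) * ((l + Q) * ((N + D) * P)) = (zn + zd) * ((N + D) * P) * (l + Q) by ring.
  by rewrite leq_mul2l; apply/orP; right; apply: (@growth_ge 1 (l + Q)); lia.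
split.
  move=> f [<-|[<-|/fr' //]] //=; split=> //=.
  by apply: leq_trans Bn; apply: leq_div.
by move=> f [<-|h] //=; apply: tl.
Qed.

Lemma conf_inv_lt j c L : conf_inv j c -> growth * j.+1 + T * n + n.*2 + j + 4 <= L -> conf_lt (2 ^ L) c.
Proof.
move=> [h1 h2 h3 [h4 h5] [h6 _]] hL.
have small x : x <= T * n + n.*2 + j + 4 -> x < 2 ^ L.
  move=> hx; apply: leq_ltn_trans (ltn_expl L (isT : 1 < 2)); lia.
have big x : x <= csize c -> x < 2 ^ L.
  move=> hx; apply: leq_ltn_trans (leq_trans hx h5) _.
  have : growth ^ j.+1 <= 2 ^ (growth * j.+1).
    by rewrite expnM leq_exp2r// ltnW// ltn_expl.
  move/leq_ltn_trans; apply; rewrite ltn_exp2l//; lia.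
have pr stk : (forall f, List.In f stk -> 0 < fden f) -> 0 < \prod_(f <- stk) fsize f.
  elim: stk => [|f r IH] h; first by rewrite big_nil.
  rewrite big_cons muln_gt0 IH ?andbT; last by move=> f' hf; apply: h; right.
  by rewrite /fsize addn_gt0 h ?orbT//; left.
have p0 : 0 < \prod_(f <- cstack c) fsize f by apply: pr => f /h6[].
split; try by apply: small; lia.
- by move=> u; apply: small; have := h2 u; lia.
- by split; apply: big; rewrite /csize; nia.
move=> f hf; have [f1 f2 f3 f4] := h6 f hf.
have le stk : List.In f stk -> (forall f, List.In f stk -> 0 < fden f) -> fsize f <= \prod_(f <- stk) fsize f.
  elim: stk => //= f' r IH [->|hr] hd; rewrite big_cons.
    by rewrite leq_pmulr// pr// => x hx; apply: hd; right.
  apply: leq_trans (IH hr _) _; first by move=> x hx; apply: hd; right.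
  by rewrite leq_pmull// /fsize addn_gt0 hd ?orbT//; left.
have lef : fsize f <= csize c.
  apply: leq_trans (le _ hf _) _; first by move=> x /h6[].
  by rewrite /csize leq_pmull// addn_gt0 h4 orbT.
split; try by apply: small; lia.
  by apply: big; apply: leq_trans lef; rewrite leq_addr.
by apply: big; apply: leq_trans lef; rewrite leq_addl.
Qed.

End Bounds.

(** * The machine evaluates the truncated recursion *)

Section Correctness.
Context {R : realType}.
Variables (n : nat) (G : sgraph n) (nadj : nat -> nat -> bool) (deg : nat -> nat).
Variables T Q b g l : nat.
Hypotheses (Q0 : 0 < Q) (g0 : 0 < g).
Hypothesis nadjE : forall u v : 'I_n, nadj u v = G u v.
Hypothesis degE : forall v : 'I_n, deg v = degree G v.
Local Notation mstep := (mstep n nadj deg T Q b g l).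
Implicit Types (st : nat -> nat) (r : seq frame).

Local Open Scope ring_scope.
Definition quot (x y : nat) : R := x%:R / y%:R.
Local Notation bt := (quot b Q).
Local Notation gt := (quot g Q).
Local Notation lt := (quot l Q).

Definition nbr_message (k B : nat) (st : nat -> nat) (v u : 'I_n) : R :=
  if st u == 0%N then
    message bt gt
      (if k is k'.+1 then
         if (B %/ degree G v == 0)%N then 0
         else approx bt gt lt G k' (B %/ degree G v)%N (set_status st v u.*2.+3) u
       else 0)
  else pin_message bt gt (st u) v.

Lemma approx_nbr k B st v :
  approx bt gt lt G k B st v = lt * \prod_(u | G v u) nbr_message k B st v u.
Proof. by case: k. Qed.

Lemma quotM (x y x' y' : nat) : quot (x * x') (y * y') = quot x y * quot x' y'.
Proof. by rewrite /quot !natrM invfM mulrACA. Qed.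

Lemma quot_pin1 : quot Q g = gt^-1.
Proof. by rewrite /quot invf_div. Qed.

Lemma message0 : message bt gt 0 = gt^-1.
Proof. by rewrite /message mulr0 !add0r div1r. Qed.

Lemma quot_message (N D : nat) : (0 < D)%N ->
  quot (b * N + Q * D) (Q * N + g * D) = message bt gt (quot N D).
Proof.
move=> D0; rewrite /quot /message !natrD !natrM.
have pQ : (Q%:R : R) != 0 by rewrite pnatr_eq0 -lt0n.
have pg : (g%:R : R) != 0 by rewrite pnatr_eq0 -lt0n.
have pD : (D%:R : R) != 0 by rewrite pnatr_eq0 -lt0n.
have p1 : Q%:R * N%:R + g%:R * D%:R != 0 :> R.
  by rewrite lt0r_neq0// ltr_wpDl ?mulr_ge0// mulr_gt0// ltr0n.
have -> : N%:R / D%:R + g%:R / Q%:R = (Q%:R * N%:R + g%:R * D%:R) / (D%:R * Q%:R) :> R.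
  by field; rewrite pQ pD.
by field; rewrite pQ pD p1.
Qed.
Local Close Scope ring_scope.

Definition alive (st : nat -> nat) : nat := #|[pred u : 'I_n | st u == 0]|.
Definition pinned1 (st : nat -> nat) (v : 'I_n) (i : nat) : nat :=
  \sum_(u < n | i <= u) (G v u && (st u != 0) && (st u < v.*2.+3)).
(** Two steps for push and pop, plus an allowance for the call at u. *)
Definition nbr_steps (k B : nat) (v u : 'I_n) : nat :=
  2 + G v u * (2 * n * (k * (B %/ degree G v))).

Lemma big_from_ord (S : Type) (idx : S) (op : Monoid.com_law idx) (i : nat) (lti : i < n) (F : 'I_n -> S) :
  \big[op/idx]_(u < n | i <= u) F u =
  op (F (Ordinal lti)) (\big[op/idx]_(u < n | i < u) F u).
Proof.
rewrite (bigD1 (Ordinal lti))//=; congr (op _ _); apply: eq_bigl => u.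
by rewrite -(inj_eq val_inj) /= ltn_neqAle eq_sym andbC.
Qed.

Lemma set_status_restore st (v t : nat) : st v = 0 -> set_status (set_status st v t) v 0 = st.
Proof. by move=> sv; apply/funext => w; rewrite /set_status; case: eqP => // ->. Qed.

Lemma alive_set_status st (v : 'I_n) t k : st v = 0 -> t != 0 -> alive st <= k.+1 ->
  alive (set_status st v t) <= k.
Proof.
move=> sv t0; rewrite /alive (cardD1 v) inE sv eqxx add1n ltnS => h; apply: leq_trans h.
apply: subset_leq_card; apply/fintype.subsetP => u; rewrite !inE /set_status.
by rewrite -(inj_eq val_inj u v) /=; case: (nat_of_ord u == nat_of_ord v); rewrite //= (negbTE t0).
Qed.

(** The shares of the children sum to at most B; this keeps the computation tree polynomial for
    unbounded degree. *)
Lemma frame_steps_le k B v : \sum_(u < n) nbr_steps k B v u <= 2 * n * (1 + k * B).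
Proof.
rewrite /nbr_steps big_split /= sum_nat_const card_ord -big_distrl /=.
have -> : \sum_(u < n) (G v u : nat) = degree G v.
  rewrite /degree -sum1_card [RHS]big_mkcond; apply: eq_bigr => u _.
  by rewrite inE; case: (G v u).
have := leq_trunc_div B (degree G v); set d := degree G v; set q := B %/ d => h.
rewrite mulnDr muln1 mulnC leq_add2l.
have -> : d * (2 * n * (k * q)) = 2 * n * k * (q * d) by ring.
by rewrite [X in _ <= X]mulnA leq_mul2l h orbT.
Qed.

(** Processes the neighbours from i on, restoring all statuses. The machine has no fuel; it agrees
    with [approx] because each call consumes a free vertex, and k bounds their number. The outer
    induction is over calls, the inner one over neighbours. *)
Lemma call k B st (v : 'I_n) i N D r zn zd kk :
  alive st <= k -> st v = 0 -> i <= n -> 0 < D ->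
  exists j N' D',
  [/\ iter j mstep (Conf kk st (Frame v B i N D :: r) zn zd) =
        Conf kk st (Frame v B n N' D' :: r)
          (if r is [::] then zn * g ^ pinned1 st v i else zn)
          (if r is [::] then zd * Q ^ pinned1 st v i else zd),
      0 < D',
      (quot N' D' = quot N D * \prod_(u < n | (i <= u)%N) (if G v u then nbr_message k B st v u else 1))%R &
      j <= \sum_(u < n | i <= u) nbr_steps k B v u].
Proof.
elim: k B st v i N D r zn zd => [|k IHk] B st v i N D r zn zd al sv.
  by move: al; rewrite leqn0 => /eqP/card0_eq/(_ v); rewrite inE sv.
move em : (n - i) => m; elim: m i em N D zn zd => [|m IH] i em N D zn zd ni D0.
  have -> : i = n by lia.
  have no (u : 'I_n) : (n <= u) = false by rewrite leqNgt ltn_ord.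
  exists 0, N, D; split=> //=.
  - by rewrite /pinned1 !big_pred0// !expn0 !muln1; case: r.
  - by rewrite big_pred0// mulr1.
have lti : i < n by lia.
pose u := Ordinal lti.
have em1 : n - i.+1 = m by lia.
have advance j1 N1 D1 :
    iter j1 mstep (Conf kk st (Frame v B i N D :: r) zn zd) =
      Conf kk st (Frame v B i.+1 N1 D1 :: r)
        (if r is [::] then zn * g ^ (G v u && (st u != 0) && (st u < v.*2.+3)) else zn)
        (if r is [::] then zd * Q ^ (G v u && (st u != 0) && (st u < v.*2.+3)) else zd) ->
    0 < D1 -> (quot N1 D1 = quot N D * (if G v u then nbr_message k.+1 B st v u else 1))%R ->
    j1 <= nbr_steps k.+1 B v u ->
    exists j N' D',
  [/\ iter j mstep (Conf kk st (Frame v B i N D :: r) zn zd) =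
        Conf kk st (Frame v B n N' D' :: r)
          (if r is [::] then zn * g ^ pinned1 st v i else zn)
          (if r is [::] then zd * Q ^ pinned1 st v i else zd),
      0 < D',
      (quot N' D' = quot N D * \prod_(u < n | (i <= u)%N) (if G v u then nbr_message k.+1 B st v u else 1))%R &
      j <= \sum_(u < n | i <= u) nbr_steps k.+1 B v u].
  move=> e1 D10 q1 j1le.
  have [j [N' [D' [e2 D0' q2 jle]]]] := IH _ em1 N1 D1
     (if r is [::] then zn * g ^ (G v u && (st u != 0) && (st u < v.*2.+3)) else zn)
     (if r is [::] then zd * Q ^ (G v u && (st u != 0) && (st u < v.*2.+3)) else zd) lti D10.
  exists (j + j1), N', D'; rewrite iterD e1 e2; split=> //.
  - by case: (r) => //; rewrite /pinned1 (big_from_ord _ lti) -/u !expnD !mulnA.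
  - by rewrite q2 q1 (big_from_ord _ lti) -/u mulrA.
  - by rewrite (big_from_ord _ lti) addnC leq_add.
have na : nadj v i = G v u := nadjE v u.
have ju : 1 <= nbr_steps k.+1 B v u by [].
case Gvu : (G v u) advance => advance; last first.
  apply: (advance 1 N D) => //; last by rewrite mulr1.
  by rewrite /= lti na Gvu /= !expn0 !muln1; case: (r).
case: (eqVneq (st i) 0) => su; last first.
  have nm : nbr_message k.+1 B st v u = pin_message bt gt (st i) v by rewrite /nbr_message (negbTE su).
  case: (ltngtP (st i) v.*2.+3) => cmp.
  - apply: (advance 1 (N * Q) (D * g)) => //; [|by rewrite muln_gt0 D0|].
      rewrite /= lti na Gvu su cmp /= ltnNge (ltnW cmp) /= !expn1; by case: (r).
    by rewrite quotM nm /pin_message ltnNge (ltnW cmp) /= cmp quot_pin1.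
  - apply: (advance 1 (N * b) (D * Q)) => //; [|by rewrite muln_gt0 D0|].
      by rewrite /= lti na Gvu su cmp /= [st i < _]ltnNge (ltnW cmp) /= !expn0 !muln1; case: (r).
    by rewrite quotM nm /pin_message cmp.
  - apply: (advance 1 N D) => //.
      by rewrite /= lti na Gvu su cmp !ltnn /= !expn0 !muln1; case: (r).
    by rewrite nm /pin_message cmp ltnn mulr1.
have zz : G v u && (st u != 0) && (st u < v.*2.+3) = false by rewrite /= su /= andbF.
set B' := B %/ degree G v.
have Bdeg : B %/ deg v = B' by rewrite degE.
have [Bz|Bz] := eqVneq B' 0.
  apply: (advance 1 (N * Q) (D * g)) => //; [|by rewrite muln_gt0 D0|].
    by rewrite /= lti na Gvu su Bdeg Bz /= !expn0 !muln1; case: (r).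
  by rewrite quotM /nbr_message /= su /= -/B' Bz /= message0 quot_pin1.
set st' := set_status st v i.*2.+3.
have al' : alive st' <= k by apply: alive_set_status al.
have su' : st' u = 0.
  rewrite /st' /set_status /=; case: eqP => // e; move: Gvu; rewrite (_ : u = v) ?(adj_irr G)//.
  exact: val_inj.
have [j [N' [D' [e D0' q jle]]]] := IHk B' st' u 0 l Q (Frame v B i N D :: r) zn zd al' su' (leq0n n) Q0.
(* One step to push, j for the call, one to pop. *)
apply: (advance (1 + (j + 1)) (N * (b * N' + Q * D')) (D * (Q * N' + g * D'))).
- rewrite iterD iterD /= lti na Gvu /= su /= Bdeg (negbTE Bz) -/st' e /= ltnn.
  by rewrite set_status_restore// !expn0 !muln1; case: (r).
- by rewrite muln_gt0 D0 addn_gt0 [X in _ || X]muln_gt0 g0 D0' orbT.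
- rewrite quotM quot_message// /nbr_message /= su /= -/B' (negbTE Bz) q.
  congr (_ * message _ _ _)%R; rewrite approx_nbr; congr (_ * _)%R.
  by rewrite [RHS]big_mkcond.
- rewrite /nbr_steps Gvu mul1n -/B' add1n addn1 !ltnS -[X in _ <= X]add0n.
  apply: leq_trans jle _; apply: leq_trans (frame_steps_le k B' u) _.
  by rewrite leq_mul2l mulSn leq_add2r lt0n Bz orbT.
Qed.

Lemma croot_mstep c : croot c <= croot (mstep c).
Proof.
case: c => k st [|f r] zn zd //=.
by do ![case: ifP => // _]; case: r => //=.
Qed.

Lemma croot_iter c i j : i <= j -> croot (iter i mstep c) <= croot (iter j mstep c).
Proof.
move=> /subnK <-; elim: (j - i) => [|m IH] //; apply: leq_trans IH _.
by rewrite addSn iterS croot_mstep.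
Qed.

Lemma root_call K (k : 'I_n) zn zd : n <= K -> 0 < zd ->
  exists j zn' zd',
  [/\ iter j mstep (Conf k (root_status k) [::] zn zd) = Conf k.+1 (root_status k.+1) [::] zn' zd',
      0 < zd',
      (quot zn' zd' = quot zn zd * (gt ^+ #|[pred w : 'I_n | G k w && (w < k)%N]| *
         (1 + approx bt gt lt G K (T * degree G k) (root_status k) k)))%R,
      j <= 2 + 2 * n * (1 + K * (T * n)) &
      forall i, i < j -> croot (iter i mstep (Conf k (root_status k) [::] zn zd)) <= k].
Proof.
move=> nK zd0; have sk : root_status k k = 0 by rewrite /root_status ltnn.
have al : alive (root_status k) <= K.
  by apply: leq_trans nK; rewrite -[X in _ <= X]card_ord max_card.
have [j [N [D [e D0 q jle]]]] := @call K (T * degree G k) (root_status k) k 0 l Q [::] zn zd k al sk (leq0n n) Q0.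
have e' : iter j.+1 mstep (Conf k (root_status k) [::] zn zd) =
   Conf k (root_status k) [:: Frame k (T * degree G k) n N D]
      (zn * g ^ pinned1 (root_status k) k 0) (zd * Q ^ pinned1 (root_status k) k 0).
  by rewrite iterSr /= degE e.
have p1 : pinned1 (root_status k) k 0 = #|[pred w : 'I_n | G k w && (w < k)%N]|.
  rewrite /pinned1 -sum1_card [RHS]big_mkcond; apply: eq_bigr => w _.
  by rewrite inE /root_status; case: (G k w) => //; case: (w < k).
exists j.+2, (zn * g ^ pinned1 (root_status k) k 0 * (N + D)), (zd * Q ^ pinned1 (root_status k) k 0 * D); split.
- rewrite iterS e' /= ltnn; congr Conf; apply/funext => w; rewrite /set_status /root_status ltnS.
  by case: ltngtP.
- by rewrite !muln_gt0 zd0 expn_gt0 Q0 D0.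
- rewrite p1 !quotM -mulrA; congr (_ * (_ * _))%R.
    by rewrite /quot !natrX expr_div_n.
  rewrite approx_nbr (_ : (lt * _)%R = quot N D); last first.
    by rewrite q; congr (_ * _)%R; rewrite [LHS]big_mkcond.
  by rewrite /quot natrD mulrDl divff ?pnatr_eq0 -?lt0n// addrC.
- rewrite !ltnS; apply: leq_trans jle _; apply: leq_trans (frame_steps_le _ _ _) _.
  by rewrite leq_mul2l leq_add2l leq_mul2l leq_mul2l degree_le !orbT.
- move=> i; rewrite ltnS => ij; apply: leq_trans (croot_iter _ ij) _.
  by rewrite e'.
Qed.

(** The last clause says that the guard of the main loop holds at every step before the final
    one. *)
Lemma all_roots K : n <= K ->
  exists J zn zd,
  [/\ iter J mstep (Conf 0 (root_status 0) [::] 1 1) = Conf n (root_status n) [::] zn zd,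
      0 < zd,
      (quot zn zd = \prod_(k < n) (gt ^+ #|[pred w : 'I_n | G k w && (w < k)%N]| *
         (1 + approx bt gt lt G K (T * degree G k) (root_status k) k)))%R,
      J <= n * (2 + 2 * n * (1 + K * (T * n))) &
      forall i, i < J -> croot (iter i mstep (Conf 0 (root_status 0) [::] 1 1)) < n].
Proof.
move=> nK.
have gen m : m <= n -> exists J zn zd,
  [/\ iter J mstep (Conf 0 (root_status 0) [::] 1 1) = Conf m (root_status m) [::] zn zd,
      0 < zd,
      (quot zn zd = \prod_(k < n | (k < m)%N) (gt ^+ #|[pred w : 'I_n | G k w && (w < k)%N]| *
         (1 + approx bt gt lt G K (T * degree G k) (root_status k) k)))%R,
      J <= m * (2 + 2 * n * (1 + K * (T * n))) &
      forall i, i < J -> croot (iter i mstep (Conf 0 (root_status 0) [::] 1 1)) < m].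
  elim: m => [|m IH] mn.
    by exists 0, 1, 1; split=> //; rewrite big_pred0// /quot divr1.
  have [J [zn [zd [e zd0 q Jle cr]]]] := IH (ltnW mn).
  have [j [zn' [zd' [e' zd0' q' jle cr']]]] := @root_call K (Ordinal mn) zn zd nK zd0.
  exists (j + J), zn', zd'; split=> //.
  - by rewrite iterD e e'.
  - rewrite q' q [RHS](bigD1 (Ordinal mn))//= mulrC; congr (_ * _)%R.
    apply: eq_bigl => i; rewrite ltnS -(inj_eq val_inj) /=.
    by case: ltngtP.
  - by rewrite mulSn leq_add.
  - move=> i ij; have [iJ|Ji] := ltnP i J; first by apply: leqW; apply: cr.
    rewrite -(subnK Ji) iterD e ltnS; apply: cr'.
    by rewrite ltn_subLR// addnC.
have [J [zn [zd [e zd0 q Jle cr]]]] := gen n (leqnn n).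
exists J, zn, zd; split=> //; rewrite q [LHS]big_mkcond.
by apply: eq_bigr => k _; rewrite ltn_ord.
Qed.

End Correctness.

(** * Auxiliary loops of the program *)

Section Program.
Context {R : realType}.
Variable rho : real_datum -> R.
Implicit Types (s : state) (c : cmd) (e : expr).

Definition reach c s s' (tmax : nat) : Prop := exists2 t, exec rho c s s' t & t <= tmax.

Lemma reach_seq c1 c2 s s1 s2 t1 t2 :
  reach c1 s s1 t1 -> reach c2 s1 s2 t2 -> reach (Seq c1 c2) s s2 (t1 + t2).+1.
Proof.
move=> [u1 x1 y1] [u2 x2 y2]; exists (u1 + u2).+1; first exact: exec_seq x1 x2.
by rewrite ltnS leq_add.
Qed.

Lemma reach_run c s s' L : loop_free c -> 0 < L -> bounded L s -> run rho c s = s' ->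
  reach c s s' (cmd_time c * L).
Proof. by move=> lf L0 bs <-; have [t [x y _]] := run_exec rho lf L0 bs; exists t. Qed.

Definition increment (a : nat) : cmd := Put a (Const 0) (Add (scalar a) (Const 1)).

Lemma update_update s a i x y : update (update s a i x) a i y = update s a i y.
Proof. by apply/funext => b; apply/funext => j; rewrite /update; case: (_ && _). Qed.

Lemma update_same s a i : update s a i (s a i) = s.
Proof.
apply/funext => b; apply/funext => j; rewrite /update; case: ifP => // /andP[/eqP -> /eqP ->] //.
Qed.

Lemma reach_count (a : nat) e s L i N : 0 < L -> s a 0 = i -> bounded L s -> i + N < 2 ^ L ->
  (forall j, j < N -> eval rho (update s a 0 (i + j)) e <> 0) ->
  eval rho (update s a 0 (i + N)) e = 0 ->
  reach (While e (increment a)) s (update s a 0 (i + N)) (N.+1 * (loop_time e (increment a) * L)).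
Proof.
move=> L0 sa bs iN gt ge.
have bu j : j <= N -> bounded L (update s a 0 (i + j)).
  by move=> jN; apply: bounded_update => //; apply: leq_ltn_trans iN; rewrite leq_add2l.
pose Inv j s' := s' = update s a 0 (i + j).
have [|||s' [t [x Is y]]] := @while_exec _ rho e (increment a) L N Inv s isT L0.
- by rewrite /Inv addn0 -sa update_same.
- move=> j _ jN ->; split; [exact: gt|by apply: bu; apply: ltnW|].
  by rewrite /Inv /= update_update {2}/update !eqxx /= addn1 addnS.
- by move=> _ ->; split; [|apply: bu].
by exists t => //; rewrite -Is.
Qed.

(** One linear scan of the adjacency matrix; dividing the position by n recovers the row. *)
Definition degree_loop : cmd :=
  While (Sub (Mul (scalar 0) (scalar 0)) (scalar 18))
    (Seq (Put 9 (Div (scalar 18) (scalar 0))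
            (Add (Get 9 (Div (scalar 18) (scalar 0))) (Get 1 (scalar 18))))
         (increment 18)).

Definition degree_state s (n j : nat) : state := fun a i =>
  if (a == 18) && (i == 0) then j else
  if a == 9 then \sum_(0 <= x < j) (if x %/ n == i then s 1 x else 0) else s a i.

Lemma reach_degree s n L : 0 < L -> s 0 0 = n -> s 18 0 = 0 -> (forall i, s 9 i = 0) ->
  bounded L s -> (forall x, s 1 x <= 1) -> n * n < 2 ^ L ->
  reach degree_loop s (degree_state s n (n * n))
    ((n * n).+1 * (loop_time (Sub (Mul (scalar 0) (scalar 0)) (scalar 18))
       (Seq (Put 9 (Div (scalar 18) (scalar 0))
            (Add (Get 9 (Div (scalar 18) (scalar 0))) (Get 1 (scalar 18))))
         (increment 18)) * L)).
Proof.
move=> L0 s0 s18 s9 bs s1 nL; rewrite /degree_loop.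
set e := Sub _ _; set c := Seq _ _.
have sum_le j i : \sum_(0 <= x < j) (if x %/ n == i then s 1 x else 0) <= j.
  rewrite -[X in _ <= X]subn0 -[X in _ <= X]muln1 -sum_nat_const_nat; apply: leq_sum => x _.
  by case: ifP.
have bd j : j <= n * n -> bounded L (degree_state s n j).
  move=> jn a i; rewrite /degree_state; do ![case: ifP => _] => //.
    exact: leq_ltn_trans nL.
  by apply: leq_ltn_trans (sum_le j i) _; apply: leq_ltn_trans nL.
pose Inv j s' := s' = degree_state s n j.
have [|||s' [t [x Is y]]] := @while_exec _ rho e c L (n * n) Inv s isT L0.
- apply/funext => a; apply/funext => i; rewrite /degree_state.
  case: ifP => [/andP[/eqP -> /eqP ->] //|_]; case: eqP => // ->.
  by rewrite big_nil s9.
- move=> j _ jn ->; split; [|by apply: bd; apply: ltnW|].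
    by rewrite /= /degree_state /= s0; apply/eqP; rewrite subn_eq0 -ltnNge.
  apply/funext => a; apply/funext => i; rewrite /= /update /degree_state /= s0.
  have [->|a18] := eqVneq a 18.
    by case: eqP => //= _; rewrite addn1.
  rewrite /=; have [_|a9] := eqVneq a 9 => //=.
  rewrite big_nat_recr//= eq_sym; case: eqP => [->|] //; by rewrite addn0.
- move=> _ ->; split; last exact: bd.
  by rewrite /= /degree_state /= s0 subnn.
by exists t => //; rewrite -Is.
Qed.

Lemma degree_sum (f : nat -> nat) (n m u : nat) :
  \sum_(0 <= x < m * n) (if x %/ n == u then f x else 0) =
  if u < m then \sum_(0 <= w < n) f (u * n + w) else 0.
Proof.
elim: m => [|m IH]; first by rewrite mul0n big_nil.
rewrite mulSn addnC (big_cat_nat (leq0n _) (leq_addr n (m * n))) /= IH.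
have -> (F : nat -> nat) : \sum_(m * n <= i < m * n + n) F i = \sum_(0 <= i < n) F (i + m * n).
  by rewrite -{1}[m * n]add0n big_addn addKn.
have -> : \sum_(0 <= i < n) (if (i + m * n) %/ n == u then f (i + m * n) else 0) =
    if m == u then \sum_(0 <= w < n) f (u * n + w) else 0.
  have dE i : i < n -> (i + m * n) %/ n = m.
    by move=> ltn; rewrite addnC divnMDl ?divn_small ?addn0//; apply: leq_ltn_trans ltn.
  case: eqP => [<-|ne].
    by apply: eq_big_nat => i /andP[_ /dE ->]; rewrite eqxx addnC.
  by rewrite big_nat big1// => i /andP[_ /dE ->]; case: eqP.
by rewrite ltnS; case: (ltngtP u m); rewrite ?addn0.
Qed.

Fixpoint epow e (m : nat) : expr := if m is m'.+1 then Mul e (epow e m') else Const 1.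

Lemma eval_epow s e m : eval rho s (epow e m) = eval rho s e ^ m.
Proof. by elim: m => //= m ->; rewrite expnS. Qed.

End Program.

(** * Running time *)

Section PolynomialBounds.
Implicit Types f g : nat -> nat -> nat.

Definition poly_bounded f : Prop := exists C k, forall n e, f n e <= C * (n + e + 1) ^ k.

Lemma poly_bounded_const c : poly_bounded (fun _ _ => c).
Proof. by exists c, 0 => n e; rewrite expn0 muln1. Qed.

Lemma poly_bounded_fst : poly_bounded (fun n _ => n).
Proof. by exists 1, 1 => n e; lia. Qed.

Lemma poly_bounded_snd : poly_bounded (fun _ e => e).
Proof. by exists 1, 1 => n e; lia. Qed.

Lemma poly_bounded_mul f g : poly_bounded f -> poly_bounded g -> poly_bounded (fun n e => f n e * g n e).
Proof.
move=> [C [k hf]] [C' [k' hg]]; exists (C * C'), (k + k') => n e.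
by rewrite expnD mulnACA leq_mul.
Qed.

Lemma poly_bounded_add f g : poly_bounded f -> poly_bounded g -> poly_bounded (fun n e => f n e + g n e).
Proof.
move=> [C [k hf]] [C' [k' hg]]; exists (C + C'), (k + k') => n e.
have X0 : 0 < n + e + 1 by rewrite addn1.
rewrite mulnDl; apply: leq_add.
  by apply: leq_trans (hf n e) _; rewrite leq_mul2l leq_pexp2l ?orbT// leq_addr.
by apply: leq_trans (hg n e) _; rewrite leq_mul2l leq_pexp2l ?orbT// leq_addl.
Qed.

Lemma poly_bounded_exp f m : poly_bounded f -> poly_bounded (fun n e => f n e ^ m).
Proof.
move=> hf; elim: m => [|m IH]; first exact: poly_bounded_const.
by have [C [k h]] := poly_bounded_mul hf IH; exists C, k => n e; rewrite expnS.
Qed.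

End PolynomialBounds.

(* [e] stands for ceil(1/eps); c1, c2, m and M depend on the parameters only: c1 and c2 make the
   decay and rounding errors small, 1/m bounds the decay exponent from below, and M bounds beta,
   gamma and lambda. *)
Section Resources.
Variables c1 c2 m M : nat.
Implicit Types n e : nat.

(** The square accounts for the factor n lost at the root and for the n factors of the telescoped
    product, each allowed an error of order 1/(n e). *)
Definition precision n e : nat := c1 * (n + 1) ^ 2 * e.
Definition budget n e : nat := precision n e ^ m.
(** At least n, as [root_call] needs, and above the budget, as [root_decay] needs. *)
Definition fuel n e : nat := n + budget n e + 2.
Definition perturb_exp n e : nat := (2 * n + 1) * (1 + fuel n e * (budget n e * n)).
(** Each root contributes the perturbation of its ratio and at most n factors gamma. *)
Definition total_exp n e : nat := n * (perturb_exp n e + n).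
Definition denom n e : nat := c2 * e * (total_exp n e + 1).
Definition steps n e : nat := n * (2 + 2 * n * (1 + fuel n e * (budget n e * n))).
Definition param_max n e : nat := M * denom n e + 2.
Definition growth_max n e : nat := (3 * param_max n e + denom n e + 2) ^ 2.
(** The first summands are what [conf_inv_lt] asks for after [steps] transitions; the parenthesized
    ones dominate the values stored by the preprocessing. *)
Definition bits n e : nat :=
  growth_max n e * (steps n e + 1) + budget n e * n + 2 * n + steps n e + 4 +
  (n * n + n + e + denom n e + budget n e + param_max n e + 2).

Lemma poly_bounded_budget : poly_bounded budget.
Proof.
apply: poly_bounded_exp; apply: poly_bounded_mul poly_bounded_snd.
apply: poly_bounded_mul (poly_bounded_const _) _; apply: poly_bounded_exp.
exact: poly_bounded_add poly_bounded_fst (poly_bounded_const _).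
Qed.

Lemma poly_bounded_fuel : poly_bounded fuel.
Proof.
apply: poly_bounded_add (poly_bounded_const _).
exact: poly_bounded_add poly_bounded_fst poly_bounded_budget.
Qed.

Lemma poly_bounded_denom : poly_bounded denom.
Proof.
apply: poly_bounded_mul.
  exact: poly_bounded_mul (poly_bounded_const _) poly_bounded_snd.
apply: poly_bounded_add (poly_bounded_const _).
apply: poly_bounded_mul poly_bounded_fst _; apply: poly_bounded_add poly_bounded_fst.
apply: poly_bounded_mul.
  apply: poly_bounded_add (poly_bounded_const _).
  exact: poly_bounded_mul (poly_bounded_const _) poly_bounded_fst.
apply: poly_bounded_add (poly_bounded_const _) _; apply: poly_bounded_mul poly_bounded_fuel _.
exact: poly_bounded_mul poly_bounded_budget poly_bounded_fst.
Qed.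

Lemma poly_bounded_steps : poly_bounded steps.
Proof.
apply: poly_bounded_mul poly_bounded_fst _; apply: poly_bounded_add (poly_bounded_const _) _.
apply: poly_bounded_mul.
  exact: poly_bounded_mul (poly_bounded_const _) poly_bounded_fst.
apply: poly_bounded_add (poly_bounded_const _) _; apply: poly_bounded_mul poly_bounded_fuel _.
exact: poly_bounded_mul poly_bounded_budget poly_bounded_fst.
Qed.

Lemma poly_bounded_param_max : poly_bounded param_max.
Proof.
apply: poly_bounded_add (poly_bounded_const _).
exact: poly_bounded_mul (poly_bounded_const _) poly_bounded_denom.
Qed.

Lemma poly_bounded_bits : poly_bounded bits.
Proof.
have h2 := poly_bounded_const 2; have h3 := poly_bounded_const 3; have h4 := poly_bounded_const 4.
have h1 := poly_bounded_const 1.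
have n := poly_bounded_fst; have e := poly_bounded_snd.
have P := poly_bounded_param_max; have D := poly_bounded_denom; have S := poly_bounded_steps.
have B := poly_bounded_budget.
have G : poly_bounded growth_max.
  apply: poly_bounded_exp.
  exact: (poly_bounded_add (poly_bounded_add (poly_bounded_mul h3 P) D) h2).
have A1 := poly_bounded_add (poly_bounded_mul G (poly_bounded_add S h1)) (poly_bounded_mul B n).
have A2 := poly_bounded_add (poly_bounded_add (poly_bounded_add A1 (poly_bounded_mul h2 n)) S) h4.
have A3 := poly_bounded_add (poly_bounded_add (poly_bounded_mul n n) n) e.
exact: (poly_bounded_add A2 (poly_bounded_add (poly_bounded_add (poly_bounded_add (poly_bounded_add A3 D) B) P) h2)).
Qed.

(** Dominates the iteration count of every loop. *)
Definition load n e : nat := e + param_max n e + n * n + steps n e + 2.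
(** The program has eleven parts joined by ten [Seq], each part costing at most X = k bits load, and
    11 X + 10 <= 22 X. *)
Definition time_bound (k : nat) n e : nat := 22 * (k * (bits n e * load n e)).

Lemma load_ge n e :
  [/\ e <= load n e, (param_max n e).+1 <= load n e, (n * n).+1 <= load n e & (steps n e).+1 <= load n e].
Proof. by rewrite /load; move: (param_max n e) (n * n) (steps n e) => x y z; split; lia. Qed.

Lemma bits_gt n e :
  [/\ e < bits n e, budget n e < bits n e, denom n e < bits n e, n * n < bits n e &
      n.+1 < bits n e /\ param_max n e < bits n e].
Proof.
rewrite /bits; move: (growth_max n e * (steps n e + 1)) (budget n e * n) (n * n) => x1 x2 x3.
by move: (param_max n e) (steps n e) (denom n e) (budget n e) => x4 x5 x6 x7; do ?split; lia.
Qed.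

Lemma poly_bounded_time_bound k : poly_bounded (time_bound k).
Proof.
have h2 := poly_bounded_const 2; have n := poly_bounded_fst.
have ld := poly_bounded_add (poly_bounded_add (poly_bounded_add (poly_bounded_add poly_bounded_snd
  poly_bounded_param_max) (poly_bounded_mul n n)) poly_bounded_steps) h2.
exact: (poly_bounded_mul (poly_bounded_const 22) (poly_bounded_mul (poly_bounded_const k)
  (poly_bounded_mul poly_bounded_bits ld))).
Qed.

Definition precision_expr : expr := Mul (Mul (Const c1) (epow (Add (scalar 0) (Const 1)) 2)) (scalar 3).
Definition budget_expr : expr := epow precision_expr m.
Definition denom_expr : expr :=
  let n := scalar 0 in let t := scalar 4 in
  let k := Add (Add n t) (Const 2) in
  let p := Mul (Add (Mul (Const 2) n) (Const 1)) (Add (Const 1) (Mul k (Mul t n))) in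
  Mul (Mul (Const c2) (scalar 3)) (Add (Mul n (Add p n)) (Const 1)).

Definition param_loop (x : real_datum) (a : nat) : cmd :=
  While (Query x (scalar a) (scalar 5)) (increment a).

Definition eps_loop : cmd :=
  While (Sub (Const 1) (Query Eps (Const 1) (scalar 3))) (increment 3).

Definition main_loop : cmd := While (Sub (scalar 0) (scalar 17)) body.

(* For [beta = 0] the numerator in array 6 is left at 0, so that the approximation is exact. *)
Definition program (beta0 : bool) : cmd :=
  Seq (Put 3 (Const 0) (Const 1)) (Seq eps_loop
  (Seq (Put 4 (Const 0) budget_expr) (Seq (Put 5 (Const 0) denom_expr)
  (Seq (if beta0 then Skip else param_loop Beta 6) (Seq (param_loop Gamma 7) (Seq (param_loop Lambda 8)
  (Seq degree_loop (Seq (Put 2 (Const 0) (Const 1)) (Seq (Put 2 (Const 1) (Const 1)) main_loop))))))))).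

End Resources.

(** * Execution of the whole program *)

Section MainLoop.
Context {R : realType}.
Variable rho : real_datum -> R.
Variables (n : nat) (G : sgraph n) (nadj : nat -> nat -> bool) (deg : nat -> nat).
Variables T Q b g l K L : nat.
Hypotheses (Q0 : 0 < Q) (g0 : 0 < g).
Hypothesis nadjE : forall u v : 'I_n, nadj u v = G u v.
Hypothesis degE : forall v : 'I_n, deg v = degree G v.
Hypothesis degn : forall u, deg u <= n.
Hypothesis nK : n <= K.

Let J := n * (2 + 2 * n * (1 + K * (T * n))).
Hypothesis hL : growth Q b g l * J.+1 + T * n + n.*2 + J + 4 <= L.

Lemma main_loop_correct s :
  brep n nadj deg T Q b g l L s (Conf 0 (root_status 0) [::] 1 1) ->
  exists s', reach rho main_loop s s' (J.+1 * (loop_time (Sub (scalar 0) (scalar 17)) body * L)) /\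
    0 < s' 2 1 /\
    (quot (s' 2 0) (s' 2 1) = \prod_(k < n) (quot g Q ^+ #|[pred w : 'I_n | G k w && (w < k)%N]| *
         (1 + approx (quot b Q) (quot g Q) (quot l Q) G K (T * degree G k) (root_status k) k)) :> R)%R.
Proof.
move=> H0.
have [J' [zn [zd [e zd0 q Jle cr]]]] := @all_roots R n G nadj deg T Q b g l Q0 g0 nadjE degE K nK.
rewrite -/J in Jle; set c0 := Conf _ _ _ _ _ in H0 e cr.
set st := mstep n nadj deg T Q b g l in e cr.
have inv j : j <= J' -> conf_inv n T Q b g l j (iter j st c0).
  elim: j => [|j IH] jJ.
    split=> //=; first split=> //.
    rewrite /csize /= big_nil muln1 expn1 /growth; apply: (@leq_trans (2 ^ 2)) => //.
    by rewrite leq_exp2r// leq_addl.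
  by rewrite iterS; apply: mstep_inv => //; [apply: IH; apply: ltnW|apply: cr].
have small j : j <= J' -> growth Q b g l * j.+1 + T * n + n.*2 + j + 4 <= L.
  move=> jJ; apply: leq_trans hL; rewrite !leq_add2r.
  have jJ2 := leq_trans jJ Jle.
  by rewrite leq_add// leq_add2r leq_add2r leq_mul2l ltnS jJ2 orbT.
have L0 : 0 < L by apply: leq_trans hL; rewrite addn4.
pose Inv j s1 := brep n nadj deg T Q b g l L s1 (iter j st c0).
have [|||s' [t [x I y]]] := @while_exec _ rho (Sub (scalar 0) (scalar 17)) body L J' Inv s isT L0.
- exact: H0.
- move=> j s1 jJ I1; split.
  + have := cr j jJ; move: I1; rewrite /Inv; case: (iter j st c0) => k1 st1 stk1 zn1 zd1 I1 /= lt.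
    have [ek _ _ _ _] := brep_vars I1; have en : s1 0 0 = n by case: I1 => [[[]]].
    by rewrite ek en; apply/eqP; rewrite subn_eq0 -ltnNge.
  + by case: I1.
  + rewrite /Inv iterS; apply: body_step => //.
    by rewrite -iterS; apply: conf_inv_lt (inv _ jJ) (small _ jJ).
- move=> s1 I1; split; last by case: I1.
  move: I1; rewrite /Inv e => I1; have [ek _ _ _ _] := brep_vars I1.
  have en : s1 0 0 = n by case: I1 => [[[]]].
  by rewrite /= ek en subnn.
rewrite /Inv e in I; have [_ _ _ ezn ezd] := brep_vars I.
exists s'; split; last by rewrite ezn ezd.
exists t => //; apply: leq_trans y _; by rewrite leq_mul2r ltnS Jle orbT.
Qed.

End MainLoop.

Section Execution.
Context {R : realType}.
Variables beta gamma lambda eps : R.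
Hypothesis af : antiferromagnetic beta gamma lambda.
Variables c1 c2 m M : nat.
Hypothesis c20 : 0 < c2.
Hypotheses (bM : (beta <= M%:R)%R) (gM : (gamma <= M%:R)%R) (lM : (lambda <= M%:R)%R).
Variables (n : nat) (G : sgraph n) (E : nat).
Hypotheses (E0 : 0 < E) (hE : (1 <= eps * E%:R)%R)
  (hE' : forall j, j < E -> (eps * j%:R < 1)%R).

Local Notation rho := (real_inputs beta gamma lambda eps).
Local Notation L := (bits c1 c2 m M n E).
Local Notation T := (budget c1 m n E).
Local Notation Q := (denom c1 c2 m n E).
Local Notation P := (param_max c1 c2 m M n E).

(** For x > 0 this is the first integer above x Q, where the query loop stops; being positive, it
    keeps the rounded gamma and lambda positive. *)
Definition numerator (x : R) : nat := if x == 0%R then 0 else (Num.truncn (x * Q%:R)%R).+1.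

Lemma reach_le c s s' t t' : t <= t' -> reach rho c s s' t -> reach rho c s s' t'.
Proof. by move=> tt [u x y]; exists u => //; apply: leq_trans tt. Qed.

Lemma L0 : 0 < L. Proof. by rewrite /bits !addnS. Qed.

Lemma leq_addrW x a b : x <= a -> x <= a + b.
Proof. by move=> h; apply: leq_trans h (leq_addr b a). Qed.

Lemma lt_bits x : x < L -> x < 2 ^ L.
Proof. by move=> h; apply: ltn_trans h (ltn_expl _ _). Qed.

Lemma reach_param (x : real_datum) (a : nat) s : (0 < rho x)%R -> (rho x <= M%:R)%R ->
  s 5 0 = Q -> s a 0 = 0 -> a != 5 -> bounded L s ->
  reach rho (param_loop x a) s (update s a 0 (numerator (rho x)))
    (P.+1 * (loop_time (Query x (scalar a) (scalar 5)) (increment a) * L)) /\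
  numerator (rho x) < P.
Proof.
move=> x0 xM s5 sa a5 bs; rewrite /numerator gt_eqF//.
have v0 : (0 <= rho x * Q%:R)%R by rewrite mulr_ge0// ltW.
have /andP[h1 h2] := truncn_itv v0.
set N := (Num.truncn _).+1 in h2 *.
have NP : N < P.
  rewrite /N /P /param_max addn2 !ltnS -(@ler_nat R) natrM; apply: le_trans h1 _.
  by rewrite ler_wpM2r.
split=> //.
have N2 : 0 + N < 2 ^ L.
  by apply: lt_bits; have [_ _ _ _ [_ bP]] := bits_gt c1 c2 m M n E; apply: ltn_trans bP.
have ev j : eval rho (update s a 0 (0 + j)) (Query x (scalar a) (scalar 5)) = (j%:R <= rho x * Q%:R)%R.
  by rewrite /= /update !eqxx /= eq_sym (negbTE a5) /= s5.
apply: reach_le (reach_count L0 sa bs N2 _ _).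
- by rewrite leq_mul2r ltnS (ltnW NP) orbT.
- move=> j jN; rewrite ev (le_trans _ h1)// ler_nat; exact: jN.
- by rewrite ev leNgt h2.
Qed.

Definition input_deg (u : nat) : nat :=
  \sum_(0 <= x < n * n) (if x %/ n == u then input_state G 1 x else 0).
Definition input_adj (v u : nat) : bool := input_state G 1 (v * n + u) != 0.

Lemma input_adjE (u v : 'I_n) : input_adj u v = G u v.
Proof.
rewrite /input_adj /=; apply/idP/idP.
  rewrite eqb0 negbK => /existsP[u' /existsP[v' /andP[/eqP e]]].
  have n0 : 0 < n by apply: leq_ltn_trans (ltn_ord u).
  have eu : u = u'.
    apply: val_inj => /=; have := congr1 (divn^~ n) e.
    by rewrite /= !divnMDl// !divn_small// !addn0.
  have ev : v = v' by apply: val_inj => /=; move: e; rewrite eu => /addnI.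
  by rewrite eu ev.
by move=> Guv; rewrite eqb0 negbK; apply/existsP; exists u; apply/existsP; exists v; rewrite eqxx.
Qed.

Lemma input_adjN (v u : nat) : input_state G 1 (v * n + u) <= 1.
Proof. by rewrite /=; case: [exists _, _]. Qed.

Lemma input_degE (v : 'I_n) : input_deg v = degree G v.
Proof.
rewrite /input_deg degree_sum ltn_ord big_mkord /degree -sum1_card [RHS]big_mkcond.
apply: eq_bigr => u _; rewrite inE; have := input_adjE v u; rewrite /input_adj => <-.
by have := input_adjN v u; case: (input_state _ _ _) => [|[]].
Qed.

Lemma input_deg_le u : input_deg u <= n.
Proof.
rewrite /input_deg degree_sum; case: ifP => // _.
rewrite -[X in _ <= X]subn0 -[X in _ <= X]muln1 -sum_nat_const_nat; apply: leq_sum => w _.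
exact: input_adjN.
Qed.

Lemma bounded_input : bounded L (input_state G).
Proof.
have [_ _ _ _ [bn _]] := bits_gt c1 c2 m M n E.
have h1 : n < 2 ^ L by apply: lt_bits; apply: ltn_trans bn.
have h2 : 1 < 2 ^ L by apply: lt_bits; apply: leq_ltn_trans bn.
have h0 : 0 < 2 ^ L by apply: ltnW.
move=> [|[|a]] [|i] //=; apply: leq_ltn_trans h2; by case: [exists _, _].
Qed.

Lemma Q_gt0 : 0 < Q.
Proof. by rewrite /denom !muln_gt0 c20 E0 addn1. Qed.

Definition program_const : nat :=
  cmd_time (Put 3 (Const 0) (Const 1)) +
  loop_time (Sub (Const 1) (Query Eps (Const 1) (scalar 3))) (increment 3) +
  cmd_time (Put 4 (Const 0) (budget_expr c1 m)) + cmd_time (Put 5 (Const 0) (denom_expr c2)) +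
  loop_time (Query Beta (scalar 6) (scalar 5)) (increment 6) +
  loop_time (Query Gamma (scalar 7) (scalar 5)) (increment 7) +
  loop_time (Query Lambda (scalar 8) (scalar 5)) (increment 8) +
  loop_time (Sub (Mul (scalar 0) (scalar 0)) (scalar 18))
       (Seq (Put 9 (Div (scalar 18) (scalar 0))
            (Add (Get 9 (Div (scalar 18) (scalar 0))) (Get 1 (scalar 18))))
         (increment 18)) +
  cmd_time (Put 2 (Const 0) (Const 1)) + cmd_time (Put 2 (Const 1) (Const 1)) +
  loop_time (Sub (scalar 0) (scalar 17)) body + 1.

Lemma chain_time X : 0 < X ->
  (X + (X + (X + (X + (X + (X + (X + (X + (X + (X + X).+1).+1).+1).+1).+1).+1).+1).+1).+1).+1 <= 22 * X.
Proof. lia. Qed.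

Lemma program_correct :
  exists s', [/\ reach rho (program c1 c2 m (beta == 0%R)) (input_state G) s'
      (time_bound c1 c2 m M program_const n E),
    0 < s' 2 1 &
    (quot (s' 2 0) (s' 2 1) = \prod_(k < n)
      (quot (numerator gamma) Q ^+ #|[pred w : 'I_n | G k w && (w < k)%N]| *
         (1 + approx (quot (numerator beta) Q) (quot (numerator gamma) Q) (quot (numerator lambda) Q) G
            (fuel c1 m n E) (T * degree G k) (root_status k) k)) :> R)%R].
Proof.
have [b0 bg g0 bg1 l0] := af.
set X := program_const * (L * load c1 c2 m M n E).
have [ld1 ld2 ld3 ld4] := load_ge c1 c2 m M n E.
have [bE bT bQ bnn [bn bP]] := bits_gt c1 c2 m M n E.
have X1 (A N : nat) : A <= program_const -> N <= load c1 c2 m M n E -> N * (A * L) <= X.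
  move=> hA hN; rewrite /X mulnCA; apply: leq_mul => //; rewrite mulnC leq_mul2l hN orbT//.
have X2 A : A <= program_const -> A * L <= X.
  by move=> hA; rewrite -[A * L]mul1n; apply: X1 => //; apply: leq_trans ld2.
have X0 : 0 < X by rewrite /X !muln_gt0 L0 /program_const addn1 /= (leq_trans _ ld2).
set s0 := input_state G; have bs0 := bounded_input.
pose s1 := update s0 3 0 1.
pose s2 := update s0 3 0 E.
pose s3 := update s2 4 0 T.
pose s4 := update s3 5 0 Q.
pose s5 := update s4 6 0 (numerator beta).
pose s6 := update s5 7 0 (numerator gamma).
pose s7 := update s6 8 0 (numerator lambda).
pose s8 := degree_state s7 n (n * n).
pose s9 := update s8 2 0 1.
pose s10 := update s9 2 1 1.
have v1 : 1 < 2 ^ L by apply: lt_bits; apply: leq_ltn_trans bn.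
have vE : E < 2 ^ L by apply: lt_bits.
have vT : T < 2 ^ L by apply: lt_bits.
have vQ : Q < 2 ^ L by apply: lt_bits.
have vnn : n * n < 2 ^ L by apply: lt_bits.
have bs1 : bounded L s1 by apply: bounded_update.
have bs2 : bounded L s2 by apply: bounded_update.
have bs3 : bounded L s3 by apply: bounded_update.
have bs4 : bounded L s4 by apply: bounded_update.
have r1 : reach rho (Put 3 (Const 0) (Const 1)) s0 s1 X.
  by apply: reach_le (reach_run _ L0 bs0 erefl) => //; apply: X2; do 11 apply: leq_addrW; exact: leqnn.
(* The counter starts at 1 and stops at the least E with eps E >= 1, after E - 1 increments. *)
have r2 : reach rho eps_loop s1 s2 X.
  have -> : s2 = update s1 3 0 (1 + E.-1) by rewrite /s1 update_update add1n prednK.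
  have ev j : eval rho (update s1 3 0 (1 + j)) (Sub (Const 1) (Query Eps (Const 1) (scalar 3))) =
     1 - (1 <= eps * (1 + j)%N%:R)%R by [].
  apply: reach_le (reach_count (N := E.-1) L0 _ bs1 _ _ _) => //.
  - by rewrite prednK//; apply: X1; [do 10 apply: leq_addrW; exact: leq_addl|by []].
  - by rewrite add1n prednK.
  - move=> j jE; rewrite ev leNgt hE'//; by rewrite add1n -ltn_predRL.
  - by rewrite ev add1n prednK// hE.
have r3 : reach rho (Put 4 (Const 0) (budget_expr c1 m)) s2 s3 X.
  apply: reach_le (reach_run _ L0 bs2 _) => //; first by apply: X2; do 9 apply: leq_addrW; exact: leq_addl.
  rewrite run_Put /budget_expr eval_epow; congr (update _ _ _ (_ ^ _)).
  by rewrite /= muln1 /precision -mulnn.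
have r4 : reach rho (Put 5 (Const 0) (denom_expr c2)) s3 s4 X.
  by apply: reach_le (reach_run _ L0 bs3 _) => //; apply: X2; do 8 apply: leq_addrW; exact: leq_addl.
have [r5 nb] : reach rho (if beta == 0%R then Skip else param_loop Beta 6) s4 s5 X /\ numerator beta < P.
  have [bz|bnz] := eqVneq beta 0%R.
    have nz : numerator beta = 0 by rewrite /numerator bz eqxx.
    have -> : s5 = s4 by rewrite /s5 nz -[X in _ = X](@update_same s4 6 0).
    split; last by rewrite nz /P /param_max addn2.
    apply: reach_le (reach_run _ L0 bs4 erefl) => //; apply: X2; exact: leq_addl.
  have bp : (0 < beta)%R by rewrite lt_neqAle eq_sym bnz.
  have [r lt] := @reach_param Beta 6 s4 bp bM erefl erefl isT bs4.
  split=> //; apply: reach_le r; apply: X1; [do 7 apply: leq_addrW; exact: leq_addl|by []].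
have bs5 : bounded L s5.
  by apply: bounded_update => //; apply: lt_bits; apply: ltn_trans nb bP.
have [r6 ng] := @reach_param Gamma 7 s5 g0 gM erefl erefl isT bs5; rewrite [rho Gamma]/= in r6 ng.
have bs6 : bounded L s6.
  by apply: bounded_update => //; apply: lt_bits; apply: ltn_trans ng bP.
have [r7 nl] := @reach_param Lambda 8 s6 l0 lM erefl erefl isT bs6; rewrite [rho Lambda]/= in r7 nl.
have bs7 : bounded L s7.
  by apply: bounded_update => //; apply: lt_bits; apply: ltn_trans nl bP.
have s71 x : s7 1 x = input_state G 1 x by [].
have r8 := @reach_degree R rho s7 n L L0 erefl erefl (fun=> erefl) bs7 _ vnn.
have {}r8 : reach rho degree_loop s7 s8 X.
  apply: reach_le (r8 _); first by apply: X1; [do 4 apply: leq_addrW; exact: leq_addl|by []].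
  by move=> x; rewrite s71 /=; case: [exists _, _].
have bs8 : bounded L s8.
  move=> a i; rewrite /s8 /degree_state; case: ifP => // _; case: eqP => // _.
  rewrite -/(input_deg i); apply: leq_ltn_trans (input_deg_le i) _.
  by apply: lt_bits; apply: ltn_trans bn.
have bs9 : bounded L s9 by apply: bounded_update.
have bs10 : bounded L s10 by apply: bounded_update.
have r9 : reach rho (Put 2 (Const 0) (Const 1)) s8 s9 X.
  by apply: reach_le (reach_run _ L0 bs8 erefl) => //; apply: X2; do 3 apply: leq_addrW; exact: leq_addl.
have r10 : reach rho (Put 2 (Const 1) (Const 1)) s9 s10 X.
  by apply: reach_le (reach_run _ L0 bs9 erefl) => //; apply: X2; do 2 apply: leq_addrW; exact: leq_addl.
have H : brep n input_adj input_deg T Q (numerator beta) (numerator gamma) (numerator lambda) L s10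
   (Conf 0 (root_status 0) [::] 1 1).
  split=> //; split=> //.
have ng0 : 0 < numerator gamma by rewrite /numerator gt_eqF.
have nK : n <= fuel c1 m n E by rewrite /fuel -addnA leq_addr.
have hL : growth Q (numerator beta) (numerator gamma) (numerator lambda) *
     (n * (2 + 2 * n * (1 + fuel c1 m n E * (T * n)))).+1 + T * n + n.*2 +
     n * (2 + 2 * n * (1 + fuel c1 m n E * (T * n))) + 4 <= L.
  rewrite -/(steps c1 m n E) /bits.
  have : growth Q (numerator beta) (numerator gamma) (numerator lambda) <= growth_max c1 c2 m M n E.
    rewrite /growth /growth_max leq_exp2r//; move: nb ng nl; clear.
    by move: (numerator _) (numerator _) (numerator _) (denom _ _ _ _ _) (param_max _ _ _ _ _ _) => x1 x2 x3 x4 x5; lia.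
  move=> hg; rewrite addn1 -mul2n -[X in _ <= X]addnA addnA; apply: leq_trans (leq_addr _ _).
  by rewrite !leq_add2r leq_mul2r hg orbT.
have [s' [r11 [d0 q]]] := @main_loop_correct R rho n G input_adj input_deg T Q (numerator beta)
  (numerator gamma) (numerator lambda) (fuel c1 m n E) L Q_gt0 ng0 input_adjE input_degE input_deg_le nK hL s10 H.
exists s'; split=> //.
have r6' : reach rho (param_loop Gamma 7) s5 s6 X.
  by apply: reach_le r6; apply: X1; [do 6 apply: leq_addrW; exact: leq_addl|by []].
have r7' : reach rho (param_loop Lambda 8) s6 s7 X.
  by apply: reach_le r7; apply: X1; [do 5 apply: leq_addrW; exact: leq_addl|by []].
have r11' : reach rho main_loop s10 s' X.
  by apply: reach_le r11; rewrite -/(steps c1 m n E); apply: X1; [do 1 apply: leq_addrW; exact: leq_addl|by []].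
have := reach_seq r1 (reach_seq r2 (reach_seq r3 (reach_seq r4 (reach_seq r5 (reach_seq r6'
  (reach_seq r7' (reach_seq r8 (reach_seq r9 (reach_seq r10 r11'))))))))).
by apply: reach_le; apply: chain_time.
Qed.

End Execution.

Local Open Scope ring_scope.

(** * Error analysis *)

Section ErrorAnalysis.
Context {R : realType}.
Implicit Types x y r : R.

(** The bound (1 + x)^k <= 1/(1 - k x) without division, so that k x < 1 need not be assumed. *)
Lemma expr1D_le x (k : nat) : 0 <= x -> (1 + x) ^+ k * (1 - k%:R * x) <= 1.
Proof.
move=> x0; elim: k => [|k IH]; first by rewrite expr0 mul0r subr0 mulr1.
apply: le_trans IH; rewrite exprSr -mulrA ler_wpM2l ?exprn_ge0 ?addr_ge0//.
rewrite -natr1; have := mulr_ge0 (ler0n R k) (sqr_ge0 x); have := sqr_ge0 x.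
by rewrite -subr_ge0 => h1 h2; rewrite (_ : _ - _ = k%:R * x ^+ 2 + x ^+ 2); [rewrite addr_ge0// -[x ^+ 2]subr0|ring].
Qed.

(** The absolute error is at most 1/Q, and 1/c3 is a lower bound for a nonzero x. *)
Lemma near_numerator c1 c2 m n E x (c3 : R) : (0 < denom c1 c2 m n E)%N -> 0 <= x -> 0 <= c3 ->
  (x = 0 \/ 1 <= c3 * x) ->
  near_ratio (1 + c3 / (denom c1 c2 m n E)%:R) (quot (numerator c1 c2 m n E x) (denom c1 c2 m n E)) x.
Proof.
set Q := denom _ _ _ _ _ => Q0 x0 c30 hx; rewrite /numerator -/Q.
have Qp : 0 < Q%:R :> R by rewrite ltr0n.
have r1 : 1 <= 1 + c3 / Q%:R by rewrite lerDl divr_ge0// ltW.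
case: eqP hx => [->|xn] hx; first by rewrite /quot mul0r; split; rewrite mulr0.
case: hx => // hx.
have /andP[h1 h2] := truncn_itv (mulr_ge0 x0 (ltW Qp)).
rewrite /quot; split.
  rewrite ler_pdivrMr// mulrDl mul1r mulrDl -[X in _ <= _ + X]mulrA -natr1.
  rewrite [x * _]mulrC mulrA divfK ?gt_eqF// [Q%:R * x]mulrC.
  by rewrite lerD// ltW.
have h : x <= (Num.truncn (x * Q%:R)).+1%:R / Q%:R by rewrite ler_pdivlMr// ltW.
by apply: le_trans h _; rewrite ler_peMl// divr_ge0// ltW.
Qed.

Lemma near_ratio_1D r x y : 1 <= r -> near_ratio r x y -> near_ratio r (1 + x) (1 + y).
Proof. by move=> r1 [h1 h2]; split; rewrite mulrDr mulr1 lerD. Qed.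

(** Decay controls ratios only in absolute terms; this suffices because the factors 1 + R are at
    least 1. *)
Lemma near_ratio_abs (h x y : R) : 0 <= x -> 0 <= y -> 0 <= h -> `|x - y| <= h ->
  near_ratio (1 + h) (1 + x) (1 + y).
Proof.
move=> x0 y0 h0; rewrite ler_norml => /andP[h1 h2].
have := mulr_ge0 h0 x0; have := mulr_ge0 h0 y0 => p1 p2.
by split; rewrite mulrDl mul1r mulrDr mulr1; lra.
Qed.

(** For unbounded degree the powers of 1/gamma stay bounded only because uniqueness forces gamma >
    1. *)
Lemma wmax_exists (beta gamma lambda : R) Delta :
  antiferromagnetic beta gamma lambda -> unique_up_to beta gamma lambda Delta ->
  exists2 wmax : R, 0 <= wmax &
    forall d, leq_degree_bound d Delta -> lambda * gamma^-1 ^+ d <= wmax ^+ 2.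
Proof.
move=> af U; have [_ _ g0 _ l0] := af.
have sq (x : R) : 0 <= x -> x <= (1 + x) ^+ 2 by move=> x0; have := sqr_ge0 x; lra.
case: Delta U => [D|] U /=.
  set y := Num.max 1 gamma^-1; have y1 : 1 <= y by rewrite le_max lexx.
  have p0 : 0 <= lambda * y ^+ D by rewrite mulr_ge0 ?(ltW l0)// exprn_ge0// (le_trans ler01).
  exists (1 + lambda * y ^+ D); first by rewrite addr_ge0.
  move=> d dD; apply: le_trans (sq _ p0); rewrite ler_pM2l//.
  apply: (@le_trans _ _ (y ^+ d)); last exact: ler_weXn2l.
  by rewrite lerXn2r ?nnegrE ?invr_ge0 ?(ltW g0) ?(le_trans ler01)// le_max lexx orbT.
have g1 := unique_all_gamma_gt1 af U.
exists (1 + lambda); first by rewrite addr_ge0// ltW.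
move=> d _; apply: le_trans (sq _ (ltW l0)); rewrite ler_piMr ?(ltW l0)//.
by rewrite exprn_ile1 ?invr_ge0 ?(ltW g0)// invf_le1// ltW.
Qed.

End ErrorAnalysis.

Theorem theorem2 (R : realType) (beta gamma lambda : R) (Delta : degree_bound)
  (hparam : antiferromagnetic beta gamma lambda)
  (hDelta : leq_degree_bound 3 Delta)
  (hunique : unique_up_to beta gamma lambda Delta) :
  partition_function_FPTAS beta gamma lambda Delta.
Proof.
have af := hparam; have [b0 bg g0 bg1 l0] := hparam.
have [kappa kappa0 contr] := uniform_contraction af hunique.
have [wmax w0 wP] := wmax_exists af hunique.
(* The constant obtained by combining [root_decay] with [rate_le]: a truncated root ratio errs by at
   most K0 n / precision. *)
pose K0 := 2 * wmax * (wmax / Num.sqrt gamma * speed beta gamma wmax).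
have K00 : 0 <= K0.
  by rewrite !mulr_ge0 ?invr_ge0 ?sqrtr_ge0.
(* For beta = 0 the inverse is 0 by convention and the first summand disappears. *)
pose c3 := beta^-1 + gamma^-1 + lambda^-1.
have [ib ig il] : [/\ 0 <= beta^-1, 0 < gamma^-1 & 0 < lambda^-1] by rewrite invr_ge0 !invr_gt0.
have c30 : 0 <= c3 by rewrite /c3; lra.
pose c1 := (Num.bound (4 * K0)).+1; pose c2 := (Num.bound (4 * c3)).+1.
pose m := Num.bound kappa^-1; pose M := Num.bound (beta + gamma + lambda).
have bound x : 0 <= x -> x <= (Num.bound x).+1%:R :> R.
  by move=> /archi_boundP/ltW/le_trans; apply; rewrite ler_nat.
have hc1 : 4 * K0 <= c1%:R by apply: bound; rewrite mulr_ge0.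
have hc2 : 4 * c3 <= c2%:R by apply: bound; rewrite mulr_ge0.
have hm : kappa^-1 <= m%:R by apply: ltW; apply: archi_boundP; rewrite invr_ge0 ltW.
have hM : beta + gamma + lambda <= M%:R by apply: ltW; apply: archi_boundP; lra.
have [Cp [kp hpoly]] := poly_bounded_time_bound c1 c2 m M (program_const c1 c2 m).
(* The power of 2 comes from E <= 1/eps + 1, which gives n + E + 1 <= 2 (n + 1/eps + 1). *)
exists (program c1 c2 m (beta == 0)), (Cp * 2 ^ kp)%N, kp.
move=> n G eps hdeg eps0.
have exE : exists q : nat, 1 <= eps * q%:R.
  exists (Num.bound eps^-1); rewrite mulrC -ler_pdivrMr// div1r.
  by apply: ltW; apply: archi_boundP; rewrite invr_ge0 ltW.
pose E := ex_minn exE.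
have [hE hE'] : 1 <= eps * E%:R /\ forall j, (j < E)%N -> eps * j%:R < 1.
  rewrite /E; case: ex_minnP => q h1 h2; split=> // j jq; rewrite ltNge; apply/negP => /h2.
  by rewrite leqNgt jq.
have E0 : (0 < E)%N by rewrite lt0n; apply: contraTneq hE => ->; rewrite mulr0 ler10.
have Ep : 0 < E%:R :> R by rewrite ltr0n.
have bM : beta <= M%:R by lra.
have gM : gamma <= M%:R by lra.
have lM : lambda <= M%:R by lra.
have [s' [[t ex tle] d0 q]] :=
  @program_correct R beta gamma lambda eps af c1 c2 m M isT bM gM lM n G E E0 hE hE'.
exists s', t.
suff [lo up] : (1 - eps) * partition_function beta gamma lambda G <= quot (output_num s') (output_den s') /\
    quot (output_num s') (output_den s') <= (1 + eps) * partition_function beta gamma lambda G.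
  split=> //.
  apply: (@le_trans _ _ (Cp * (n + E + 1) ^ kp)%N%:R).
    by rewrite ler_nat; apply: leq_trans tle (hpoly n E).
  rewrite !natrM !natrX -mulrA ler_wpM2l// -exprMn lerXn2r ?nnegrE ?mulr_ge0 ?addr_ge0 ?invr_ge0 ?(ltW eps0)//.
  have : E.-1%:R <= eps^-1.
    rewrite -[X in _ <= X]mul1r ler_pdivlMr// mulrC ltW// hE'//.
    by rewrite prednK.
  rewrite !natrD (_ : E%:R = E.-1%:R + 1 :> R); last by rewrite natr1 prednK.
  have : 0 <= n%:R :> R by []. have : 0 < eps^-1 by rewrite invr_gt0.
  by lra.
set Q := denom c1 c2 m n E; set T := budget c1 m n E.
have Q0 : (0 < Q)%N by apply: Q_gt0.
have Qp : 0 < Q%:R :> R by rewrite ltr0n.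
pose bt := quot (R := R) (numerator c1 c2 m n E beta) Q.
pose gt := quot (R := R) (numerator c1 c2 m n E gamma) Q.
pose lt := quot (R := R) (numerator c1 c2 m n E lambda) Q.
pose r := 1 + c3 / Q%:R.
have r1 : 1 <= r by rewrite lerDl divr_ge0// ltW.
have nb : near_ratio r bt beta.
  apply: near_numerator => //; have [->|bn] := eqVneq beta 0; [by left|right].
  have bp : 0 < beta by rewrite lt_neqAle eq_sym bn.
  by rewrite -ler_pdivrMr// div1r /c3; lra.
have ng : near_ratio r gt gamma.
  apply: near_numerator => //; first exact: ltW.
  by right; rewrite -ler_pdivrMr// div1r /c3; lra.
have nl : near_ratio r lt lambda.
  apply: near_numerator => //; first exact: ltW.
  by right; rewrite -ler_pdivrMr// div1r /c3; lra.
have bt0 : 0 <= bt by rewrite divr_ge0.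
have gt0 : 0 < gt by rewrite divr_gt0// ltr0n /numerator gt_eqF.
have lt0 : 0 < lt by rewrite divr_gt0// ltr0n /numerator gt_eqF.
pose K := fuel c1 m n E.
pose At k := approx bt gt lt G K (T * degree G k)%N (root_status k) k.
pose A k := approx beta gamma lambda G K (T * degree G k)%N (root_status k) k.
pose Rk (k : 'I_n) := ratio beta gamma lambda G (root_status k) k.
pose cnt (k : 'I_n) := #|[pred w : 'I_n | G k w && (w < k)%N]|.
(* Chosen so that n factors 1 + h lose at most 1/(4 E) in total. *)
pose h : R := (4 * n.+1%:R * E%:R)^-1.
have h0 : 0 <= h by rewrite invr_ge0 !mulr_ge0.
have A0 k : 0 <= A k by apply: approx_pos.
have At0 k : 0 <= At k by apply: approx_pos.
have Rk0 k : 0 <= Rk k by apply: ratio_ge0.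
have decayk (k : 'I_n) : `|A k - Rk k| <= h.
  have N0 : (0 < precision c1 n E)%N by rewrite /precision !muln_gt0 E0 !addn1.
  have T0 : (0 < T)%N by rewrite /T /budget expn_gt0 N0.
  have hTk : (T <= n + T + 1)%N by rewrite addnAC leq_addl.
  have := root_decay af kappa0 contr w0 wP hdeg k T0 hTk.
  have -> : (n + T + 1).+1 = K by rewrite /K /fuel -/T addn1 addn2.
  move/le_trans; apply.
  have rl := @rate_le R gamma kappa wmax kappa0 w0 _ _ T N0 hm (leqnn _).
  have sp : 0 <= speed beta gamma wmax by rewrite sqrtr_ge0.
  apply: (@le_trans _ _ (K0 * n%:R / (precision c1 n E)%:R)).
    have -> : K0 * n%:R / (precision c1 n E)%:R = 2 * wmax * (n%:R * (wmax / Num.sqrt gamma / (precision c1 n E)%:R) * speed beta gamma wmax).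
      by rewrite /K0; ring.
    by rewrite ler_wpM2l ?mulr_ge0// ler_wpM2r// ler_wpM2l.
  have Np : 0 < (precision c1 n E)%:R :> R by rewrite ltr0n.
  have np : 0 < n.+1%:R :> R by [].
  rewrite /h ler_pdivrMr// [X in _ <= X]mulrC ler_pdivlMr ?mulr_gt0//.
  rewrite /precision addn1 -mulnn !natrM.
  have -> : K0 * n%:R * (4 * n.+1%:R * E%:R) = (4 * K0) * (n%:R * n.+1%:R) * E%:R by ring.
  by rewrite ler_wpM2r// ler_pM ?mulr_ge0// ler_wpM2r// ler_nat.
set Zt := quot _ _; have ZtE : Zt = \prod_(k < n) (gt ^+ cnt k * (1 + At k)) by exact: q.
set Z := partition_function _ _ _ _.
have ZE : Z = \prod_(k < n) (gamma ^+ cnt k * (1 + Rk k)) by exact: partition_function_telescope.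
(* Truncated recursion with exact parameters: it separates the rounding error from the truncation
   error. *)
pose Zm := \prod_(k < n) (gamma ^+ cnt k * (1 + A k)).
have gpow r' k : 0 <= r' -> 0 <= r' ^+ k :> R by move=> ?; apply: exprn_ge0.
have near1 : near_ratio (r ^+ total_exp c1 m n E) Zt Zm.
  rewrite ZtE /Zm; apply: (@near_ratio_le _ (r ^+ \sum_(k < n) (cnt k + perturb_exp c1 m n E)%N)).
  - rewrite ler_weXn2l// /total_exp -[X in (_ <= X * _)%N]card_ord -sum_nat_const.
    apply: leq_sum => k _; rewrite addnC leq_add2l.
    by rewrite -[X in (_ <= X)%N]card_ord max_card.
  - by apply: prodr_ge0 => k _; rewrite mulr_ge0 ?addr_ge0 ?gpow ?(ltW gt0).
  - by apply: prodr_ge0 => k _; rewrite mulr_ge0 ?addr_ge0 ?gpow ?(ltW g0).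
  apply: near_ratio_prod => k _; split; rewrite ?mulr_ge0 ?addr_ge0 ?gpow ?(ltW g0) ?(ltW gt0)//.
  rewrite exprD; apply: near_ratio_mul; rewrite ?addr_ge0 ?gpow ?(ltW g0) ?(ltW gt0)//.
    have := @near_ratio_prod R 'I_(cnt k) (index_enum _) xpredT (fun=> gt) (fun=> gamma) r (fun=> 1%N).
    rewrite !prodr_const card_ord sum_nat_const card_ord muln1; apply.
    by move=> _ _; rewrite expr1 !ltW.
  apply: near_ratio_1D; first exact: exprn_ege1.
  have := approx_perturb af r1 nb ng nl bt0 gt0 lt0 G K (T * degree G k) (root_status k) k.
  apply: near_ratio_le; rewrite ?At0 ?A0// ler_weXn2l// /perturb_exp addn1 leq_mul2l /=.
  by rewrite leq_add2l leq_mul2l leq_mul2l degree_le !orbT.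
have near2 : near_ratio ((1 + h) ^+ n) Zm Z.
  rewrite ZE /Zm; have := @near_ratio_prod R 'I_n (index_enum _) xpredT (fun k => gamma ^+ cnt k * (1 + A k))
    (fun k => gamma ^+ cnt k * (1 + Rk k)) (1 + h) (fun=> 1%N).
  rewrite sum_nat_const card_ord muln1; apply => k _.
  split; rewrite ?mulr_ge0 ?addr_ge0 ?gpow ?(ltW g0)//.
  have [u1 u2] := near_ratio_abs (A0 k) (Rk0 k) h0 (decayk k).
  by rewrite expr1; split; rewrite mulrCA ler_wpM2l ?gpow ?(ltW g0).
have hp : 0 <= 1 + h by rewrite addr_ge0.
have rp : 0 <= r by apply: le_trans r1.
have [up lo] := near_ratio_trans (gpow _ _ rp) (gpow _ _ hp) near1 near2.
set rr := r ^+ _ * _ in up lo.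
have Z0 : 0 <= Z by rewrite ZE prodr_ge0// => k _; rewrite mulr_ge0 ?addr_ge0 ?gpow ?(ltW g0).
(* Each of the two error factors is at most 1/(1 - d). Their product is at most 1/(1 - 2 d), hence
   at most 1 + 4 d as d <= 1/4, and 4 d = 1/E <= eps. *)
pose d : R := (4 * E%:R)^-1.
have dE : 4 * d * E%:R = 1 by rewrite /d; field; rewrite gt_eqF.
have d0' : 0 < d by rewrite invr_gt0 mulr_gt0.
have d4 : 4 * d <= 1.
  have : 1 <= E%:R :> R by rewrite ler1n.
  by nra.
have deps : 4 * d <= eps.
  have -> : 4 * d = E%:R^-1 by rewrite /d; field; rewrite gt_eqF.
  by rewrite -div1r ler_pdivrMr.
have rr0 : 0 <= rr by rewrite mulr_ge0 ?gpow.
have rrd : rr * (1 - d) ^+ 2 <= 1.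
  have e1 : r ^+ total_exp c1 m n E * (1 - d) <= 1.
    apply: le_trans (expr1D_le (total_exp c1 m n E) (_ : 0 <= c3 / Q%:R)); last by rewrite divr_ge0// ltW.
    rewrite ler_wpM2l ?gpow// lerB// mulrA ler_pdivrMr// /d /Q /denom natrM [(c2 * E)%:R]natrM.
    have -> : (4 * E%:R)^-1 * (c2%:R * E%:R * (total_exp c1 m n E + 1)%:R) = (c2%:R / 4) * (total_exp c1 m n E + 1)%:R :> R.
      by field; rewrite gt_eqF.
    rewrite [X in X <= _]mulrC ler_pM// ?ler_nat ?leq_addr//.
    by rewrite ler_pdivlMr// mulrC.
  have e2 : (1 + h) ^+ n * (1 - d) <= 1.
    apply: le_trans (expr1D_le n h0); rewrite ler_wpM2l ?gpow// lerB// /h /d.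
    rewrite ler_pdivrMr ?mulr_gt0// [X in _ <= X]mulrC ler_pdivlMr ?mulr_gt0//.
    by rewrite mulrCA mulrA ler_wpM2r// ler_wpM2l// ler_nat.
  have -> : rr * (1 - d) ^+ 2 = (r ^+ total_exp c1 m n E * (1 - d)) * ((1 + h) ^+ n * (1 - d)) by rewrite /rr; ring.
  have d1 : 0 <= 1 - d by lra.
  by rewrite -[X in _ <= X]mulr1 ler_pM ?mulr_ge0 ?gpow.
have sqd : (1 - d) ^+ 2 >= 1 - 2 * d by have := sqr_ge0 d; lra.
have rr1 : rr * (1 - 2 * d) <= 1 by apply: le_trans rrd; rewrite ler_wpM2l.
split.
  have : (1 - 2 * d) * Z <= Zt.
    have p : 0 <= 1 - 2 * d by lra.
    have := ler_wpM2l p lo; move/le_trans; apply.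
    rewrite mulrA mulrC -[X in _ <= X]mulr1 [(1 - _) * _]mulrC ler_wpM2l//.
    by rewrite /Zt divr_ge0.
  by apply: le_trans; rewrite ler_wpM2r//; lra.
apply: le_trans up _; rewrite ler_wpM2r//.
have rr2 : rr <= 1 + 4 * d by nra.
by lra.
Qed.
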